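(* Let $H$ and $L$ be finite-dimensional Hopf algebras over a field $k$. If $H$ and $L$ are monoidally Morita equivalent, then, for any integer $n \ge 2$, the braid group representations $$\rho_n^{\mathcal{D}(H)}: B_n \to \mathrm{Aut}(\mathcal{D}(H)^{\otimes n}) \quad \text{and} \quad \rho_n^{\mathcal{D}(L)}: B_n \to \mathrm{Aut}(\mathcal{D}(L)^{\otimes n})$$ are equivalent (as $k$-linear representations of $B_n$).
   Context: Two Hopf algebras $H$ and $L$ over $k$ are monoidally Morita equivalent if the categories $\mathrm{Mod}(H)$ and $\mathrm{Mod}(L)$ of left modules (with tensor product $\otimes_k$ and action through the comultiplication) are equivalent as $k$-linear monoidal categories. Drinfeld double: for a finite-dimensional Hopf algebra $H$ with antipode $S$, $\mathcal{D}(H)$ is the Hopf algebra with underlying coalgebra $H^{*\mathrm{cop}}\otimes H$ ($H^{*\mathrm{cop}}$ is the dual Hopf algebra with opposite comultiplication), with elements $f\otimes x$ written $f\bowtie x$, and multiplication $(f\bowtie x)(g\bowtie y)=\sum f\, g(S^{-1}(x_{(3)})\,?\,x_{(1)})\bowtie x_{(2)}y$. It has the universal $R$-matrix $\mathcal{R}=\sum_i (\varepsilon\bowtie h_i)\otimes(h_i^*\bowtie 1)$, where $\{h_i\}$ is a basis of $H$ and $\{h_i^*\}$ the dual basis. Braid representations: $B_n$ ($n\ge2$) is the braid group on $n$ strands with standard generators $\sigma_1,\dots,\sigma_{n-1}$. If $A$ is a Hopf algebra with universal $R$-matrix $R=\sum_i s_i\otimes t_i$ and $V$ is a left $A$-module,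 let $c_{V,V}(v\otimes w)=\sum_i t_iw\otimes s_iv$ and let $\rho_n^V:B_n\to\mathrm{Aut}(V^{\otimes n})$ be the representation given by $\rho_n^V(\sigma_i)=\mathrm{id}_V^{\otimes(i-1)}\otimes c_{V,V}\otimes\mathrm{id}_V^{\otimes(n-i-1)}$. Here $\rho_n^{\mathcal{D}(H)}$ is taken with $(A,R)=(\mathcal{D}(H),\mathcal{R})$ and $V=\mathcal{D}(H)$, the left regular module. *)

(* Defs.v *)
From HB Require Import structures.
From mathcomp Require Import all_boot all_order all_algebra all_field.
From mathcomp Require Import boolp functions.

Set Implicit Arguments.
Unset Strict Implicit.
Unset Printing Implicit Defensive.

Import GRing.Theory.
Local Open Scope ring_scope.
Local Open Scope quotient_scope.

Definition bilin (k : fieldType) (V W U : lmodType k) (b : V -> W -> U) : Prop :=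
  (forall w, linear (b^~ w)) /\ (forall v, linear (b v)).

Section Linear.
Variables (k : fieldType) (U V : lmodType k) (f : U -> V).
Hypothesis lf : linear f.

Lemma lin0 : f 0 = 0.
Proof.
by have := lf (-1) 0 0; rewrite scaler0 addr0 scaleN1r addNr.
Qed.

Lemma linD x y : f (x + y) = f x + f y.
Proof. by have := lf 1 x y; rewrite !scale1r. Qed.

Lemma linZ a x : f (a *: x) = a *: f x.
Proof. by have := lf a x 0; rewrite lin0 !addr0. Qed.

Lemma lin_sum I (r : seq I) (F : I -> U) :
  f (\sum_(i <- r) F i) = \sum_(i <- r) f (F i).
Proof. exact: (big_morph f linD lin0). Qed.
End Linear.

Section Tensor.
Variables (k : fieldType) (V W : lmodType k).

Definition feval (U : lmodType k) (b : V -> W -> U) (s : seq (V * W)) : U :=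
  \sum_(p <- s) b p.1 p.2.

(* A sequence stands for the formal sum of the pure tensors of its entries (a
   scalar can be absorbed in the first factor).  Two formal sums are identified
   when no bilinear map distinguishes them. *)
Definition tensor_rel : rel (seq (V * W)) := fun s t =>
  `[< forall (U : lmodType k) (b : V -> W -> U),
        bilin b -> feval b s = feval b t >].

Lemma tensor_rel_equiv : equiv_class_of tensor_rel.
Proof.
split=> [s|s t|t s u].
- exact/asboolP.
- by apply/asboolP/asboolP => h U b bb; rewrite h.
- by move=> /asboolP h1 /asboolP h2; apply/asboolP => U b bb; rewrite h1 ?h2.
Qed.
Canonical tensor_equiv := EquivRelPack tensor_rel_equiv.

Definition tensor : Type := {eq_quot tensor_rel}.
HB.instance Definition _ := Choice.on tensor.
HB.instance Definition _ := EqQuotient.on tensor.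

Definition pure (v : V) (w : W) : tensor := \pi_tensor [:: (v, w)].

(* For bilinear b this is the linear map on the tensor product with value
   b v w at the pure tensor of v and w (lemmas tlift_pure, tlift_linear,
   tlift_unique); the value is meaningless when b is not bilinear. *)
Definition tlift (U : lmodType k) (b : V -> W -> U) (t : tensor) : U :=
  feval b (repr t).

Lemma tlift_pi (U : lmodType k) (b : V -> W -> U) s :
  bilin b -> tlift b (\pi_tensor s) = feval b s.
Proof.
move=> bb; rewrite /tlift.
have /eqmodP/asboolP -> // : \pi_tensor (repr (\pi_tensor s)) = \pi_tensor s.
by rewrite reprK.
Qed.

Lemma feval_cat (U : lmodType k) (b : V -> W -> U) s t :
  feval b (s ++ t) = feval b s + feval b t.
Proof. exact: big_cat. Qed.

Lemma feval_scale (U : lmodType k) (b : V -> W -> U) a s : bilin b ->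
  feval b [seq (a *: p.1, p.2) | p <- s] = a *: feval b s.
Proof.
move=> [bl _]; rewrite /feval big_map scaler_sumr.
by apply: eq_bigr => p _ /=; rewrite (linZ (bl p.2)).
Qed.

Lemma tensor_eq (s t : tensor) :
  (forall (U : lmodType k) (b : V -> W -> U),
     bilin b -> tlift b s = tlift b t) -> s = t.
Proof.
move=> h; rewrite -[s]reprK -[t]reprK; apply/eqmodP/asboolP => U b bb.
exact: h.
Qed.

Definition tzero : tensor := \pi_tensor [::].
Definition tadd (s t : tensor) : tensor := \pi_tensor (repr s ++ repr t).
Definition tscale (a : k) (t : tensor) : tensor :=
  \pi_tensor [seq (a *: p.1, p.2) | p <- repr t].

Lemma tlift_zero (U : lmodType k) (b : V -> W -> U) : bilin b -> tlift b tzero = 0.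
Proof. by move=> bb; rewrite tlift_pi // /feval big_nil. Qed.
Lemma tlift_add (U : lmodType k) (b : V -> W -> U) s t :
  bilin b -> tlift b (tadd s t) = tlift b s + tlift b t.
Proof. by move=> bb; rewrite tlift_pi // feval_cat. Qed.
Lemma tlift_scale (U : lmodType k) (b : V -> W -> U) a t :
  bilin b -> tlift b (tscale a t) = a *: tlift b t.
Proof. by move=> bb; rewrite tlift_pi // feval_scale. Qed.

Let tE := (tlift_zero, tlift_add, tlift_scale).

Lemma taddA : associative tadd.
Proof. by move=> s t u; apply: tensor_eq => U b bb; rewrite !tE // addrA. Qed.
Lemma taddC : commutative tadd.
Proof. by move=> s t; apply: tensor_eq => U b bb; rewrite !tE // addrC. Qed.
Lemma tadd0 : left_id tzero tadd.
Proof. by move=> t; apply: tensor_eq => U b bb; rewrite !tE // add0r. Qed.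
Lemma taddN : left_inverse tzero (tscale (-1)) tadd.
Proof.
by move=> t; apply: tensor_eq => U b bb; rewrite !tE // scaleN1r addNr.
Qed.
HB.instance Definition _ := GRing.isZmodule.Build tensor taddA taddC tadd0 taddN.

Lemma tscaleA a b t : tscale a (tscale b t) = tscale (a * b) t.
Proof. by apply: tensor_eq => U c bc; rewrite !tE // scalerA. Qed.
Lemma tscale1 : left_id 1 tscale.
Proof. by move=> t; apply: tensor_eq => U c bc; rewrite !tE // scale1r. Qed.
Lemma tscaleDr : right_distributive tscale +%R.
Proof. by move=> a s t; apply: tensor_eq => U c bc; rewrite !tE // scalerDr. Qed.
Lemma tscaleDl t : {morph tscale^~ t : a b / a + b}.
Proof. by move=> a b; apply: tensor_eq => U c bc; rewrite !tE // scalerDl. Qed.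
HB.instance Definition _ := GRing.Zmodule_isLmodule.Build k tensor
  tscaleA tscale1 tscaleDr tscaleDl.

Lemma tlift_linear (U : lmodType k) (b : V -> W -> U) :
  bilin b -> linear (tlift b).
Proof. by move=> bb a s t; rewrite tlift_add // tlift_scale. Qed.

Lemma tlift_pure (U : lmodType k) (b : V -> W -> U) v w :
  bilin b -> tlift b (pure v w) = b v w.
Proof. by move=> bb; rewrite tlift_pi // /feval big_seq1. Qed.

Lemma pure_bilin : bilin pure.
Proof.
split=> [w a v v'|v a w w']; apply: tensor_eq => U b bb;
  rewrite (tlift_linear bb) !tlift_pure //.
- by rewrite bb.1.
- by rewrite bb.2.
Qed.

Lemma tensor_sum (t : tensor) : t = \sum_(p <- repr t) pure p.1 p.2.
Proof.
apply: tensor_eq => U b bb; rewrite (lin_sum (tlift_linear bb)) {1}/tlift /feval.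
by apply: eq_bigr => p _; rewrite tlift_pure.
Qed.

Lemma tensor_ext (U : lmodType k) (f g : tensor -> U) : linear f -> linear g ->
  (forall v w, f (pure v w) = g (pure v w)) -> forall t, f t = g t.
Proof.
move=> lf lg h t; rewrite (tensor_sum t) (lin_sum lf) (lin_sum lg).
by apply: eq_bigr => p _.
Qed.

Lemma tlift_unique (U : lmodType k) (b : V -> W -> U) (f : tensor -> U) :
  bilin b -> linear f -> (forall v w, f (pure v w) = b v w) ->
  forall t, f t = tlift b t.
Proof.
move=> bb lf h; apply: tensor_ext => // [|v w]; first exact: tlift_linear.
by rewrite h tlift_pure.
Qed.

Lemma tlift_param (T U : lmodType k) (b : T -> V -> W -> U) t :
  (forall v w, linear (fun x => b x v w)) -> linear (fun x => tlift (b x) t).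
Proof.
move=> lb a x y; rewrite /tlift /feval scaler_sumr -big_split /=.
by apply: eq_bigr => p _; rewrite lb.
Qed.

End Tensor.

Notation "V ⊗ W" := (tensor V W) (at level 40, left associativity) : type_scope.
Notation "v ⊠ w" := (pure v w) (at level 40, left associativity) : ring_scope.

Section TensorMaps.
Variable k : fieldType.

Definition tmap (V W V' W' : lmodType k) (f : V -> V') (g : W -> W')
    : V ⊗ W -> V' ⊗ W' :=
  tlift (fun v w => f v ⊠ g w).

Definition tassoc (U V W : lmodType k) : (U ⊗ V) ⊗ W -> U ⊗ (V ⊗ W) :=
  tlift (fun uv w => tlift (fun u v => u ⊠ (v ⊠ w)) uv).

Definition tassocV (U V W : lmodType k) : U ⊗ (V ⊗ W) -> (U ⊗ V) ⊗ W :=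
  tlift (fun u vw => tlift (fun v w => (u ⊠ v) ⊠ w) vw).

Lemma tmap_bilin (V W V' W' : lmodType k) (f : V -> V') (g : W -> W') :
  linear f -> linear g -> bilin (fun v w => f v ⊠ g w).
Proof.
move=> lf lg; split=> [w a v v'|v a w w'] /=.
- by rewrite lf (pure_bilin _ _).1.
- by rewrite lg (pure_bilin _ _).2.
Qed.

Lemma tmap_linear (V W V' W' : lmodType k) (f : V -> V') (g : W -> W') :
  linear f -> linear g -> linear (tmap f g).
Proof. by move=> lf lg; apply/tlift_linear/tmap_bilin. Qed.

Lemma tmap_pure (V W V' W' : lmodType k) (f : V -> V') (g : W -> W') v w :
  linear f -> linear g -> tmap f g (v ⊠ w) = f v ⊠ g w.
Proof. by move=> lf lg; apply/(tlift_pure _ _ (tmap_bilin lf lg)). Qed.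

Lemma tassoc_inner (U V W : lmodType k) (w : W) :
  bilin (fun (u : U) (v : V) => u ⊠ (v ⊠ w)).
Proof.
split=> [v a u u'|u a v v'] /=; first by rewrite (pure_bilin _ _).1.
by rewrite (pure_bilin _ _).1 (pure_bilin _ _).2.
Qed.

Lemma tassoc_bilin (U V W : lmodType k) :
  bilin (fun (uv : U ⊗ V) (w : W) => tlift (fun u v => u ⊠ (v ⊠ w)) uv).
Proof.
split=> [w|uv] /=; first exact: tlift_linear (tassoc_inner _ _ w).
by apply: tlift_param => u v a w w' /=; rewrite !(pure_bilin _ _).2.
Qed.

Lemma tassoc_linear (U V W : lmodType k) : linear (@tassoc U V W).
Proof. exact: tlift_linear (tassoc_bilin _ _ _). Qed.

Lemma tassoc_pure (U V W : lmodType k) (u : U) (v : V) (w : W) :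
  tassoc ((u ⊠ v) ⊠ w) = u ⊠ (v ⊠ w).
Proof.
rewrite /tassoc (tlift_pure _ _ (tassoc_bilin _ _ _)).
exact: (tlift_pure _ _ (tassoc_inner _ _ w)).
Qed.

Lemma tassocV_inner (U V W : lmodType k) (u : U) :
  bilin (fun (v : V) (w : W) => (u ⊠ v) ⊠ w).
Proof.
split=> [w a v v'|v a w w'] /=; last by rewrite (pure_bilin _ _).2.
by rewrite (pure_bilin _ _).2 (pure_bilin _ _).1.
Qed.

Lemma tassocV_bilin (U V W : lmodType k) :
  bilin (fun (u : U) (vw : V ⊗ W) => tlift (fun v w => (u ⊠ v) ⊠ w) vw).
Proof.
split=> [vw|u] /=; last exact: tlift_linear (tassocV_inner _ _ u).
by apply: tlift_param => v w a u u' /=; rewrite !(pure_bilin _ _).1.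
Qed.

Lemma tassocV_linear (U V W : lmodType k) : linear (@tassocV U V W).
Proof. exact: tlift_linear (tassocV_bilin _ _ _). Qed.

Lemma tassocV_pure (U V W : lmodType k) (u : U) (v : V) (w : W) :
  tassocV (u ⊠ (v ⊠ w)) = (u ⊠ v) ⊠ w.
Proof.
rewrite /tassocV (tlift_pure _ _ (tassocV_bilin _ _ _)).
exact: (tlift_pure _ _ (tassocV_inner _ _ u)).
Qed.

Lemma lin_comp (U V W : lmodType k) (g : V -> W) (f : U -> V) :
  linear g -> linear f -> linear (g \o f).
Proof. by move=> lg lf a x y /=; rewrite lf lg. Qed.

Lemma lin_id (U : lmodType k) : linear (@id U).
Proof. by []. Qed.

Lemma lin_pure_l (U V : lmodType k) (v : V) : linear (fun u : U => u ⊠ v).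
Proof. exact: (pure_bilin U V).1. Qed.

Lemma lin_pure_r (U V : lmodType k) (u : U) : linear (fun v : V => u ⊠ v).
Proof. exact: (pure_bilin U V).2. Qed.

Lemma tensor3_ext (U V W X : lmodType k) (f g : (U ⊗ V) ⊗ W -> X) :
  linear f -> linear g ->
  (forall u v w, f ((u ⊠ v) ⊠ w) = g ((u ⊠ v) ⊠ w)) -> forall t, f t = g t.
Proof.
move=> lf lg h; apply: tensor_ext => // uv w.
apply: (tensor_ext (f := fun t => f (t ⊠ w)) (g := fun t => g (t ⊠ w))) => //.
- by move=> a x y /=; rewrite lin_pure_l lf.
- by move=> a x y /=; rewrite lin_pure_l lg.
Qed.

Lemma tensor3r_ext (U V W X : lmodType k) (f g : U ⊗ (V ⊗ W) -> X) :
  linear f -> linear g ->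
  (forall u v w, f (u ⊠ (v ⊠ w)) = g (u ⊠ (v ⊠ w))) -> forall t, f t = g t.
Proof.
move=> lf lg h; apply: tensor_ext => // u vw.
apply: (tensor_ext (f := fun t => f (u ⊠ t)) (g := fun t => g (u ⊠ t))) => //.
- by move=> a x y /=; rewrite lin_pure_r lf.
- by move=> a x y /=; rewrite lin_pure_r lg.
Qed.

Lemma tassocK (U V W : lmodType k) : cancel (@tassoc U V W) (@tassocV U V W).
Proof.
apply: (tensor3_ext (lin_comp (@tassocV_linear _ _ _) (@tassoc_linear _ _ _))
  (@lin_id _)) => u v w.
by rewrite /= tassoc_pure tassocV_pure.
Qed.

Lemma tassocVK (U V W : lmodType k) : cancel (@tassocV U V W) (@tassoc U V W).
Proof.
apply: (tensor3r_ext (lin_comp (@tassoc_linear _ _ _) (@tassocV_linear _ _ _))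
  (@lin_id _)) => u v w.
by rewrite /= tassocV_pure tassoc_pure.
Qed.

End TensorMaps.

Record lincat (k : fieldType) := LinCat {
  ob :> Type;
  mor : ob -> ob -> lmodType k;
  idm : forall X, mor X X;
  cmp : forall X Y Z, mor Y Z -> mor X Y -> mor X Z;
  cmp_bilin : forall X Y Z, bilin (@cmp X Y Z);
  cmp1f : forall X Y (f : mor X Y), cmp (idm Y) f = f;
  cmpf1 : forall X Y (f : mor X Y), cmp f (idm X) = f;
  cmpA : forall W X Y Z (h : mor Y Z) (g : mor X Y) (f : mor W X),
    cmp h (cmp g f) = cmp (cmp h g) f
}.
Arguments idm {k l} X.
Arguments cmp {k l X Y Z} g f.
Notation "g ∘ f" := (cmp g f) (at level 41, right associativity).

Definition is_iso (k : fieldType) (C : lincat k) (X Y : C) (f : mor X Y) : Prop :=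
  exists g : mor Y X, g ∘ f = idm X /\ f ∘ g = idm Y.

Record linfunctor (k : fieldType) (C D : lincat k) := LinFunctor {
  fob :> C -> D;
  fmap : forall X Y, mor X Y -> mor (fob X) (fob Y);
  fmap_linear : forall X Y, linear (@fmap X Y);
  fmap1 : forall X, fmap (idm X) = idm (fob X);
  fmap_cmp : forall X Y Z (g : mor Y Z) (f : mor X Y),
    fmap (g ∘ f) = fmap g ∘ fmap f
}.
Arguments fmap {k C D} l {X Y} f.

(* C and D are equivalent through F: F has a quasi-inverse G, with natural
   isomorphisms eta : Id -> GF and eps : FG -> Id. *)
Definition is_equivalence (k : fieldType) (C D : lincat k)
    (F : linfunctor C D) : Prop :=
  exists (G : linfunctor D C)
         (eta : forall X : C, mor X (G (F X)))
         (eps : forall Y : D, mor (F (G Y)) Y),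
    [/\ forall X, is_iso (eta X),
        forall Y, is_iso (eps Y),
        forall X X' (f : mor X X'), eta X' ∘ f = fmap G (fmap F f) ∘ eta X
      & forall Y Y' (f : mor Y Y'), eps Y' ∘ fmap F (fmap G f) = f ∘ eps Y].

Record moncat (k : fieldType) := MonCat {
  mcat :> lincat k;
  tob : mcat -> mcat -> mcat;
  tmor : forall (X X' Y Y' : mcat),
    mor X X' -> mor Y Y' -> mor (tob X Y) (tob X' Y');
  munit : mcat;
  massoc : forall X Y Z, mor (tob (tob X Y) Z) (tob X (tob Y Z));
  mlunit : forall X, mor (tob munit X) X;
  mrunit : forall X, mor (tob X munit) X;
  tmor_bilin : forall X X' Y Y', bilin (@tmor X X' Y Y');
  tmor1 : forall X Y, tmor (idm X) (idm Y) = idm (tob X Y);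
  tmor_cmp : forall X X' X'' Y Y' Y'' (f' : mor X' X'') (f : mor X X')
      (g' : mor Y' Y'') (g : mor Y Y'),
    tmor (f' ∘ f) (g' ∘ g) = tmor f' g' ∘ tmor f g;
  massoc_iso : forall X Y Z, is_iso (massoc X Y Z);
  mlunit_iso : forall X, is_iso (mlunit X);
  mrunit_iso : forall X, is_iso (mrunit X);
  massoc_nat : forall X X' Y Y' Z Z' (f : mor X X') (g : mor Y Y') (h : mor Z Z'),
    massoc X' Y' Z' ∘ tmor (tmor f g) h = tmor f (tmor g h) ∘ massoc X Y Z;
  mlunit_nat : forall X X' (f : mor X X'),
    mlunit X' ∘ tmor (idm munit) f = f ∘ mlunit X;
  mrunit_nat : forall X X' (f : mor X X'),
    mrunit X' ∘ tmor f (idm munit) = f ∘ mrunit X;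
  pentagon : forall W X Y Z,
    tmor (idm W) (massoc X Y Z) ∘ massoc W (tob X Y) Z
      ∘ tmor (massoc W X Y) (idm Z)
    = massoc W X (tob Y Z) ∘ massoc (tob W X) Y Z;
  triangle : forall X Y,
    tmor (idm X) (mlunit Y) ∘ massoc X munit Y = tmor (mrunit X) (idm Y)
}.
Arguments tob {k m} X Y.
Arguments tmor {k m X X' Y Y'} f g.
Arguments munit {k m}.
Arguments massoc {k m} X Y Z.
Arguments mlunit {k m} X.
Arguments mrunit {k m} X.

(* Strong: the structure morphisms mf2 and mf0 are isomorphisms. *)
Record monfunctor (k : fieldType) (C D : moncat k) := MonFunctor {
  mfun :> linfunctor C D;
  mf2 : forall X Y, mor (tob (mfun X) (mfun Y)) (mfun (tob X Y));
  mf0 : mor munit (mfun munit);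
  mf2_iso : forall X Y, is_iso (mf2 X Y);
  mf0_iso : is_iso mf0;
  mf2_nat : forall X X' Y Y' (f : mor X X') (g : mor Y Y'),
    mf2 X' Y' ∘ tmor (fmap mfun f) (fmap mfun g) = fmap mfun (tmor f g) ∘ mf2 X Y;
  mf2_assoc : forall X Y Z,
    fmap mfun (massoc X Y Z) ∘ mf2 (tob X Y) Z ∘ tmor (mf2 X Y) (idm (mfun Z))
    = mf2 X (tob Y Z) ∘ tmor (idm (mfun X)) (mf2 Y Z)
      ∘ massoc (mfun X) (mfun Y) (mfun Z);
  mf_lunit : forall X,
    fmap mfun (mlunit X) ∘ mf2 munit X ∘ tmor mf0 (idm (mfun X))
    = mlunit (mfun X);
  mf_runit : forall X,
    fmap mfun (mrunit X) ∘ mf2 X munit ∘ tmor (idm (mfun X)) mf0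
    = mrunit (mfun X)
}.

(* A monoidal structure on a quasi-inverse of F is not data here, as usual: it is
   induced by that of F. *)
Definition monoidally_equivalent (k : fieldType) (C D : moncat k) : Prop :=
  exists F : monfunctor C D, is_equivalence F.

(* Product of A ⊗ A: (a ⊗ b)(c ⊗ d) = ac ⊗ bd. *)
Definition tmul (k : fieldType) (A : falgType k) (s t : A ⊗ A) : A ⊗ A :=
  tlift (fun a b => tlift (fun c d => (a * c) ⊠ (b * d)) t) s.

(* Finite dimension is part of falgType. *)
Record hopfAlgebra (k : fieldType) := HopfAlgebra {
  halg :> falgType k;
  comul : {linear halg -> halg ⊗ halg};
  counit : 'Hom(halg, k^o);
  antipode : 'End(halg);
  comulA : forall x,
    tassoc (tmap comul id (comul x)) = tmap id comul (comul x);
  counitl : forall x, tlift (fun a b => counit a *: b) (comul x) = x;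
  counitr : forall x, tlift (fun a b => counit b *: a) (comul x) = x;
  comul1 : comul 1 = 1 ⊠ 1;
  comulM : forall x y, comul (x * y) = tmul (comul x) (comul y);
  counit1 : counit 1 = 1;
  counitM : forall x y, counit (x * y) = counit x * counit y;
  antipodel : forall x,
    tlift (fun a b => antipode a * b) (comul x) = (counit x)%:A;
  antipoder : forall x,
    tlift (fun a b => a * antipode b) (comul x) = (counit x)%:A
}.
Arguments comul {k h}.
Arguments counit {k h}.
Arguments antipode {k h}.

Record hmodule (k : fieldType) (H : falgType k) := HModule {
  hcar :> lmodType k;
  act : H -> hcar -> hcar;
  act_bilin : bilin act;
  act1 : forall m, act 1 m = m;
  actM : forall x y m, act (x * y) m = act x (act y m)
}.
Arguments act {k H h} x m.

Section ModuleHom.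
Variables (k : fieldType) (H : falgType k) (M N : hmodule H).

Definition is_hmap (f : M -> N) : Prop :=
  linear f /\ forall x m, f (act x m) = act x (f m).

Definition hmap_pred : {pred (M -> N)} := fun f => `[< is_hmap f >].

Lemma hmap_submod : submod_closed hmap_pred.
Proof.
split.
  apply/asboolP; split=> [a u v|x m].
    by rewrite -[RHS]/(a *: 0 + 0) scaler0 addr0.
  by rewrite -[LHS]/(0 : N) -[X in act x X]/(0 : N) (lin0 ((act_bilin N).2 x)).
move=> a f g /asboolP [lf ef] /asboolP [lg eg]; apply/asboolP; split.
  move=> b u v; rewrite -![(a *: f + g) _]/(a *: f _ + g _) lf lg.
  rewrite !scalerDr !scalerA (mulrC a b) -!addrA; congr (_ + _).
  by rewrite addrCA.
move=> x m; rewrite -![(a *: f + g) _]/(a *: f _ + g _) ef eg.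
by rewrite (linD ((act_bilin N).2 x)) (linZ ((act_bilin N).2 x)).
Qed.
HB.instance Definition _ := GRing.isSubmodClosed.Build k (M -> N) hmap_pred
  hmap_submod.

Record hmap := HMap { hfun : M -> N; hfunP : hfun \in hmap_pred }.
HB.instance Definition _ := [isSub for hfun].
HB.instance Definition _ := [Choice of hmap by <:].
HB.instance Definition _ := [SubChoice_isSubLmodule of hmap by <:].

Definition mkhmap (f : M -> N) (hf : is_hmap f) : hmap :=
  HMap (introT (asboolP _) hf).

Lemma hmap_lin (f : hmap) : linear (hfun f).
Proof. by case: f => f /= /asboolP []. Qed.
Lemma hmap_act (f : hmap) x m : hfun f (act x m) = act x (hfun f m).
Proof. by case: f => f /= /asboolP []. Qed.
Lemma hmap_eq (f g : hmap) : hfun f =1 hfun g -> f = g.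
Proof. by move=> h; apply: val_inj; apply: funext. Qed.
Lemma hmapD (f g : hmap) m : hfun (f + g) m = hfun f m + hfun g m.
Proof. by []. Qed.
Lemma hmapZ a (f : hmap) m : hfun (a *: f) m = a *: hfun f m.
Proof. by []. Qed.
End ModuleHom.

Section ModCat.
Variables (k : fieldType) (H : falgType k).

Lemma hmap_id_subproof (M : hmodule H) : is_hmap (@id M).
Proof. by []. Qed.
Definition hmap_id (M : hmodule H) : hmap M M := mkhmap (hmap_id_subproof M).

Lemma hmap_comp_subproof (M N P : hmodule H) (g : hmap N P) (f : hmap M N) :
  is_hmap (hfun g \o hfun f).
Proof.
split=> [a u v|x m] /=; first by rewrite !hmap_lin.
by rewrite !hmap_act.
Qed.
Definition hmap_comp (M N P : hmodule H) (g : hmap N P) (f : hmap M N) :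
  hmap M P := mkhmap (hmap_comp_subproof g f).

Lemma hmap_comp_bilin (M N P : hmodule H) : bilin (@hmap_comp M N P).
Proof.
split=> [f a g g'|g a f f']; apply: hmap_eq => m; first by [].
exact: (hmap_lin g a (hfun f m) (hfun f' m)).
Qed.

Definition modlincat : lincat k.
Proof.
refine (@LinCat k (hmodule H) (fun M N => hmap M N : lmodType k)
  hmap_id hmap_comp hmap_comp_bilin _ _ _); by move=> *; apply: hmap_eq.
Defined.

Lemma hmap_iso (M N : hmodule H) (f : hmap M N) (g : N -> M) :
  cancel (hfun f) g -> cancel g (hfun f) -> is_iso (f : @mor k modlincat M N).
Proof.
move=> fK gK; have gP : is_hmap g.
  split=> [a u v|x m]; apply: (can_inj fK).
    by rewrite gK (hmap_lin f) !gK.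
  by rewrite gK (hmap_act f) gK.
by exists (mkhmap gP); split; apply: hmap_eq => m /=; rewrite (fK, gK).
Qed.
End ModCat.

Section ModMonoidal.
Variables (k : fieldType) (H : hopfAlgebra k).

(* act2 s (m ⊗ n) = sum of a m ⊗ b n when s is the sum of the a ⊗ b. *)
Definition act2 (M N : hmodule H) (s : H ⊗ H) (t : M ⊗ N) : M ⊗ N :=
  tlift (fun a b => tmap (act a) (act b) t) s.

Lemma act2_inner (M N : hmodule H) (t : M ⊗ N) :
  bilin (fun a b : H => tmap (act a) (act b) t).
Proof.
split=> [b a x y|a c x y] /=.
  apply: (tlift_param (b := fun x m n => act x m ⊠ act b n)).
  by move=> m n c u v /=; rewrite (act_bilin M).1 (pure_bilin _ _).1.
apply: (tlift_param (b := fun x m n => act a m ⊠ act x n)).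
by move=> m n d u v /=; rewrite (act_bilin N).1 (pure_bilin _ _).2.
Qed.

Lemma act2_bilin (M N : hmodule H) : bilin (@act2 M N).
Proof.
split=> [t|s]; first exact: tlift_linear (act2_inner t).
apply: (tlift_param (b := fun t a b => tmap (act a) (act b) t)) => a b.
by apply: tmap_linear; [exact: (act_bilin M).2 | exact: (act_bilin N).2].
Qed.

Lemma act2_pure (M N : hmodule H) a b (m : M) (n : N) :
  act2 (a ⊠ b) (m ⊠ n) = act a m ⊠ act b n.
Proof.
rewrite /act2 (tlift_pure _ _ (act2_inner _)) tmap_pure //.
- exact: (act_bilin M).2.
- exact: (act_bilin N).2.
Qed.

Lemma tmul_inner (t : H ⊗ H) :
  bilin (fun a b : H => tlift (fun c d => (a * c) ⊠ (b * d)) t).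
Proof.
split=> [b|a].
  apply: (tlift_param (b := fun a c d => (a * c) ⊠ (b * d))) => c d e u v.
  by rewrite mulrDl -scalerAl (pure_bilin _ _).1.
apply: (tlift_param (b := fun b c d => (a * c) ⊠ (b * d))) => c d e u v.
by rewrite mulrDl -scalerAl (pure_bilin _ _).2.
Qed.

Lemma tmul_inner2 (a b : H) : bilin (fun c d : H => (a * c) ⊠ (b * d)).
Proof.
split=> [d e u v|c e u v] /=; rewrite mulrDr -scalerAr.
- by rewrite (pure_bilin _ _).1.
- by rewrite (pure_bilin _ _).2.
Qed.

Lemma tmul_bilin : bilin (@tmul k H).
Proof.
split=> [t|s]; first exact: tlift_linear (tmul_inner t).
apply: (tlift_param
  (b := fun t a b => tlift (fun c d => (a * c) ⊠ (b * d)) t)) => a b.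
exact: tlift_linear (tmul_inner2 a b).
Qed.

Lemma tmul_pure (a b c d : H) : tmul (a ⊠ b) (c ⊠ d) = (a * c) ⊠ (b * d).
Proof.
by rewrite /tmul (tlift_pure _ _ (tmul_inner _)) (tlift_pure _ _ (tmul_inner2 _ _)).
Qed.

Lemma act2M (M N : hmodule H) (s s' : H ⊗ H) (t : M ⊗ N) :
  act2 (tmul s s') t = act2 s (act2 s' t).
Proof.
apply: (tensor_ext (f := fun t => act2 (tmul s s') t)
  (g := fun t => act2 s (act2 s' t))) => [||m n].
- exact: (act2_bilin M N).2.
- by move=> a u v; rewrite !(act2_bilin M N).2.
apply: (tensor_ext (f := fun s => act2 (tmul s s') (m ⊠ n))
  (g := fun s => act2 s (act2 s' (m ⊠ n)))) => [||a b].
- by move=> c u v; rewrite tmul_bilin.1 (act2_bilin M N).1.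
- exact: (act2_bilin M N).1.
apply: (tensor_ext (f := fun s' => act2 (tmul (a ⊠ b) s') (m ⊠ n))
  (g := fun s' => act2 (a ⊠ b) (act2 s' (m ⊠ n)))) => [||c d].
- by move=> e u v; rewrite tmul_bilin.2 (act2_bilin M N).1.
- by move=> e u v; rewrite (act2_bilin M N).1 (act2_bilin M N).2.
by rewrite tmul_pure !act2_pure !actM.
Qed.

(* x (m ⊗ n) = x_(1) m ⊗ x_(2) n. *)
Definition mod_tensor (M N : hmodule H) : hmodule H.
Proof.
refine (@HModule k H (M ⊗ N) (fun x t => act2 (comul x) t) _ _ _).
- split=> [t a x y|x]; last exact: (act2_bilin M N).2.
  by rewrite linearP (act2_bilin M N).1.
- apply: (tensor_ext (f := fun t => act2 (comul 1) t) (g := id)) => //.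
    exact: (act2_bilin M N).2.
  by move=> m n; rewrite comul1 act2_pure !act1.
- by move=> x y t; rewrite comulM act2M.
Defined.

(* x c = eps(x) c. *)
Definition mod_unit : hmodule H.
Proof.
refine (@HModule k H k^o (fun x c => counit x *: c) _ _ _).
- split=> [c a x y|x a c d]; first by rewrite linearP scalerDl scalerA.
  by rewrite scalerDr !scalerA mulrC.
- by move=> c; rewrite counit1 scale1r.
- by move=> x y c; rewrite counitM scalerA.
Defined.

Lemma mod_tmor_subproof (M M' N N' : hmodule H) (f : hmap M M') (g : hmap N N') :
  @is_hmap k H (mod_tensor M N) (mod_tensor M' N') (tmap (hfun f) (hfun g)).
Proof.
have lt : linear (tmap (hfun f) (hfun g)) by apply: tmap_linear; exact: hmap_lin.
split=> // x; rewrite /= ; move: (comul x) => s.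
apply: (tensor_ext (f := fun t => tmap (hfun f) (hfun g) (act2 s t))
  (g := fun t => act2 s (tmap (hfun f) (hfun g) t))) => [||m n].
- by move=> a u v; rewrite (act2_bilin M N).2 lt.
- by move=> a u v; rewrite lt (act2_bilin M' N').2.
apply: (tensor_ext (f := fun s => tmap (hfun f) (hfun g) (act2 s (m ⊠ n)))
  (g := fun s => act2 s (tmap (hfun f) (hfun g) (m ⊠ n)))) => [||a b].
- by move=> a u v; rewrite (act2_bilin M N).1 lt.
- exact: (act2_bilin M' N').1.
by rewrite act2_pure !tmap_pure ?act2_pure ?hmap_act //; exact: hmap_lin.
Qed.
Definition mod_tmor (M M' N N' : hmodule H) (f : hmap M M') (g : hmap N N') :
  hmap (mod_tensor M N) (mod_tensor M' N') := mkhmap (mod_tmor_subproof f g).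

Lemma mod_assoc_subproof (M N P : hmodule H) :
  @is_hmap k H (mod_tensor (mod_tensor M N) P) (mod_tensor M (mod_tensor N P))
    (@tassoc k M N P).
Proof.
split=> [|x]; first exact: tassoc_linear.
apply: (tensor3_ext
  (f := fun t => tassoc (act (h := mod_tensor (mod_tensor M N) P) x t))
  (g := fun t => act (h := mod_tensor M (mod_tensor N P)) x (tassoc t)))
  => [||m n p].
- by move=> a u v; rewrite (act_bilin (mod_tensor (mod_tensor M N) P)).2 tassoc_linear.
- by move=> a u v; rewrite tassoc_linear (act_bilin (mod_tensor M (mod_tensor N P))).2.
rewrite /= tassoc_pure.
(* K (a ⊗ (b ⊗ c)) = a m ⊗ (b n ⊗ c p) *)
pose K (w : H ⊗ (H ⊗ H)) : M ⊗ (N ⊗ P) :=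
  tmap (fun a => act a m) (fun s => act2 s (n ⊠ p)) w.
have lm : linear (fun a => act a m) by exact: (act_bilin M).1.
have ls : linear (fun s => act2 s (n ⊠ p)) by exact: (act2_bilin N P).1.
have lK : linear K by exact: tmap_linear.
have -> : forall s, act2 (M := M) (N := mod_tensor N P) s (m ⊠ (n ⊠ p)) =
    K (tmap id comul s).
  apply: tensor_ext => [||a b].
  - exact: (act2_bilin _ _).1.
  - by move=> a u v; rewrite tmap_linear ?lK //; exact: linearP.
  - by rewrite act2_pure /= tmap_pure ?/K ?tmap_pure //; exact: linearP.
rewrite -comulA.
move: (comul x); apply: tensor_ext => [||a b].
- move=> a u v.
  by rewrite (act2_bilin (mod_tensor M N) P).1 tassoc_linear.
- move=> a u v; rewrite tmap_linear //; last exact: linearP.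
  by rewrite tassoc_linear lK.
rewrite (act2_pure (M := mod_tensor M N)) /= tmap_pure //; last exact: linearP.
move: (comul a); apply: tensor_ext => [||c d].
- move=> c u v.
  by rewrite (act2_bilin M N).1 (pure_bilin _ _).1 tassoc_linear.
- by move=> c u v; rewrite (pure_bilin _ _).1 tassoc_linear lK.
by rewrite act2_pure !tassoc_pure /K tmap_pure // act2_pure.
Qed.
Definition mod_assoc (M N P : hmodule H) :
    hmap (mod_tensor (mod_tensor M N) P) (mod_tensor M (mod_tensor N P)) :=
  mkhmap (mod_assoc_subproof M N P).

Definition lunit_fun (V : lmodType k) : k^o ⊗ V -> V :=
  tlift (fun (c : k^o) (v : V) => c *: v).
Definition runit_fun (V : lmodType k) : V ⊗ k^o -> V :=
  tlift (fun (v : V) (c : k^o) => c *: v).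

Lemma lunit_bilin (V : lmodType k) : bilin (fun (c : k^o) (v : V) => c *: v).
Proof.
split=> [v a c d|c a u v]; first by rewrite scalerDl scalerA.
by rewrite scalerDr !scalerA mulrC.
Qed.
Lemma runit_bilin (V : lmodType k) : bilin (fun (v : V) (c : k^o) => c *: v).
Proof. by case: (lunit_bilin V) => h1 h2; split. Qed.

Lemma lunit_linear (V : lmodType k) : linear (@lunit_fun V).
Proof. exact: tlift_linear (lunit_bilin V). Qed.
Lemma runit_linear (V : lmodType k) : linear (@runit_fun V).
Proof. exact: tlift_linear (runit_bilin V). Qed.
Lemma lunit_pure (V : lmodType k) (c : k^o) (v : V) :
  lunit_fun (@pure k k^o V c v) = c *: v.
Proof. exact: tlift_pure (lunit_bilin V). Qed.
Lemma runit_pure (V : lmodType k) (c : k^o) (v : V) :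
  runit_fun (@pure k V k^o v c) = c *: v.
Proof. exact: tlift_pure (runit_bilin V). Qed.

Lemma mod_lunit_subproof (M : hmodule H) :
  @is_hmap k H (mod_tensor mod_unit M) M (@lunit_fun M).
Proof.
split=> [|x]; first exact: lunit_linear.
apply: tensor_ext => [||c m] /=.
- by move=> a u v; rewrite (act2_bilin mod_unit M).2 lunit_linear.
- by move=> a u v; rewrite lunit_linear (act_bilin M).2.
rewrite lunit_pure -{2}(counitl x); move: (comul x).
have bc : bilin (fun a b : H => counit a *: b).
  split=> [b a u v|a b u v]; first by rewrite linearP scalerDl scalerA.
  by rewrite scalerDr !scalerA mulrC.
apply: tensor_ext => [||a b].
- by move=> a u v; rewrite (act2_bilin mod_unit M).1 lunit_linear.
- by move=> a u v; rewrite (tlift_linear bc) (act_bilin M).1.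
rewrite (act2_pure (M := mod_unit)) /= lunit_pure (tlift_pure _ _ bc).
rewrite (linZ ((act_bilin M).1 _)) (linZ ((act_bilin M).2 b)) scalerA.
by [].
Qed.
Definition mod_lunit (M : hmodule H) : hmap (mod_tensor mod_unit M) M :=
  mkhmap (mod_lunit_subproof M).

Lemma mod_runit_subproof (M : hmodule H) :
  @is_hmap k H (mod_tensor M mod_unit) M (@runit_fun M).
Proof.
split=> [|x]; first exact: runit_linear.
apply: tensor_ext => [||m c] /=.
- by move=> a u v; rewrite (act2_bilin M mod_unit).2 runit_linear.
- by move=> a u v; rewrite runit_linear (act_bilin M).2.
rewrite runit_pure -{2}(counitr x); move: (comul x).
have bc : bilin (fun a b : H => counit b *: a).
  split=> [b a u v|a b u v]; last by rewrite linearP scalerDl scalerA.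
  by rewrite scalerDr !scalerA mulrC.
apply: tensor_ext => [||a b].
- by move=> a u v; rewrite (act2_bilin M mod_unit).1 runit_linear.
- by move=> a u v; rewrite (tlift_linear bc) (act_bilin M).1.
rewrite (act2_pure (N := mod_unit)) /= runit_pure (tlift_pure _ _ bc).
rewrite (linZ ((act_bilin M).1 _)) (linZ ((act_bilin M).2 a)) scalerA.
by [].
Qed.
Definition mod_runit (M : hmodule H) : hmap (mod_tensor M mod_unit) M :=
  mkhmap (mod_runit_subproof M).

Lemma hmap_eq2 (M N P : hmodule H) (f g : hmap (mod_tensor M N) P) :
  (forall (m : M) (n : N), hfun f (m ⊠ n) = hfun g (m ⊠ n)) -> f = g.
Proof.
by move=> h; apply: hmap_eq; apply: (tensor_ext (hmap_lin f) (hmap_lin g)).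
Qed.

Lemma hmap_eq3 (M N P Q : hmodule H)
    (f g : hmap (mod_tensor (mod_tensor M N) P) Q) :
  (forall (m : M) (n : N) (p : P),
     hfun f ((m ⊠ n) ⊠ p) = hfun g ((m ⊠ n) ⊠ p)) -> f = g.
Proof.
by move=> h; apply: hmap_eq; apply: (tensor3_ext (hmap_lin f) (hmap_lin g)).
Qed.

Lemma mod_tmor_pure (M M' N N' : hmodule H) (f : hmap M M') (g : hmap N N') m n :
  hfun (mod_tmor f g) (m ⊠ n) = hfun f m ⊠ hfun g n.
Proof. by apply: tmap_pure; exact: hmap_lin. Qed.

Lemma mod_tmor_bilin (M M' N N' : hmodule H) : bilin (@mod_tmor M M' N N').
Proof.
split=> [g a f f'|f a g g']; apply: hmap_eq2 => m n.
  rewrite (hmapD (a *: mod_tmor f g)) (hmapZ a (mod_tmor f g)) !mod_tmor_pure.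
  exact: (pure_bilin _ _).1.
rewrite (hmapD (a *: mod_tmor f g)) (hmapZ a (mod_tmor f g)) !mod_tmor_pure.
exact: (pure_bilin _ _).2.
Qed.

Lemma mod_lunit_iso (M : hmodule H) :
  is_iso (mod_lunit M : @mor k (modlincat H) (mod_tensor mod_unit M) M).
Proof.
apply: (hmap_iso (f := mod_lunit M)
    (g := fun m : M => (@pure k k^o M 1 m : mod_tensor mod_unit M))) => [|m].
  apply: (tensor_ext (f := fun t => @pure k k^o M 1 (lunit_fun t)) (g := id)) => //.
    by move=> a u v; rewrite lunit_linear (pure_bilin _ _).2.
  move=> c m; rewrite lunit_pure (linZ (@lin_pure_r _ _ _ _)).
  by rewrite -(linZ (@lin_pure_l _ _ _ _)) -[c *: _]/(c * 1) mulr1.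
by rewrite /= lunit_pure scale1r.
Qed.

Lemma mod_runit_iso (M : hmodule H) :
  is_iso (mod_runit M : @mor k (modlincat H) (mod_tensor M mod_unit) M).
Proof.
apply: (hmap_iso (f := mod_runit M)
    (g := fun m : M => (@pure k M k^o m 1 : mod_tensor M mod_unit))) => [|m].
  apply: (tensor_ext (f := fun t => @pure k M k^o (runit_fun t) 1) (g := id)) => //.
    by move=> a u v; rewrite runit_linear (pure_bilin _ _).1.
  move=> m c; rewrite runit_pure (linZ (@lin_pure_l _ _ _ _)).
  by rewrite -(linZ (@lin_pure_r _ _ _ _)) -[c *: _]/(c * 1) mulr1.
by rewrite /= runit_pure scale1r.
Qed.

Lemma mod_pentagon (W M N P : hmodule H) :
  hmap_comp (mod_tmor (hmap_id W) (mod_assoc M N P))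
    (hmap_comp (mod_assoc W (mod_tensor M N) P)
      (mod_tmor (mod_assoc W M N) (hmap_id P)))
  = hmap_comp (mod_assoc W M (mod_tensor N P)) (mod_assoc (mod_tensor W M) N P).
Proof.
apply: hmap_eq2 => wmn p; move: wmn.
apply: tensor3_ext => [a u v|a u v|w m n].
- by rewrite (pure_bilin _ _).1 hmap_lin.
- by rewrite (pure_bilin _ _).1 hmap_lin.
by rewrite /= !(tmap_pure, tassoc_pure) //; exact: tassoc_linear.
Qed.

Definition Mod : moncat k.
Proof.
refine (@MonCat k (modlincat H) mod_tensor mod_tmor mod_unit mod_assoc
  mod_lunit mod_runit mod_tmor_bilin _ _ _ mod_lunit_iso mod_runit_iso _ _ _
  mod_pentagon _).
- by move=> M N; apply: hmap_eq2 => m n; rewrite mod_tmor_pure.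
- move=> M M' M'' N N' N'' f' f g' g; apply: hmap_eq2 => m n.
  by rewrite mod_tmor_pure /= -[RHS]/(hfun (mod_tmor f' g') (hfun (mod_tmor f g) _))
     !mod_tmor_pure.
- move=> M N P; apply: (hmap_iso (f := mod_assoc M N P) (g := @tassocV k M N P)).
    exact: tassocK.
  exact: tassocVK.
- move=> M M' N N' P P' f g h; apply: hmap_eq3 => m n p.
  rewrite -[LHS]/(tassoc (hfun (mod_tmor (mod_tmor f g) h) ((m ⊠ n) ⊠ p))).
  rewrite -[RHS]/(hfun (mod_tmor f (mod_tmor g h)) (tassoc ((m ⊠ n) ⊠ p))).
  by rewrite tassoc_pure !mod_tmor_pure tassoc_pure.
- move=> M M' f; apply: hmap_eq2 => c m.
  rewrite -[LHS]/(lunit_fun (hfun (mod_tmor (hmap_id mod_unit) f) (c ⊠ m))).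
  rewrite mod_tmor_pure lunit_pure -[RHS]/(hfun f (lunit_fun (c ⊠ m))).
  by rewrite lunit_pure (linZ (hmap_lin f)).
- move=> M M' f; apply: hmap_eq2 => m c.
  rewrite -[LHS]/(runit_fun (hfun (mod_tmor f (hmap_id mod_unit)) (m ⊠ c))).
  rewrite mod_tmor_pure runit_pure -[RHS]/(hfun f (runit_fun (m ⊠ c))).
  by rewrite runit_pure (linZ (hmap_lin f)).
- move=> M N; apply: hmap_eq3 => m c n.
  rewrite -[LHS]/(hfun (mod_tmor (hmap_id M) (mod_lunit N)) (tassoc ((m ⊠ c) ⊠ n))).
  rewrite tassoc_pure !mod_tmor_pure.
  rewrite -[LHS]/(m ⊠ lunit_fun (c ⊠ n)) -[RHS]/(runit_fun (m ⊠ c) ⊠ n).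
  rewrite lunit_pure runit_pure.
  by rewrite (linZ (@lin_pure_l _ _ _ _)) (linZ (@lin_pure_r _ _ _ _)).
Defined.
End ModMonoidal.

Definition monoidally_Morita_equivalent (k : fieldType) (H L : hopfAlgebra k) :
  Prop := monoidally_equivalent (Mod H) (Mod L).

Section Double.
Variables (k : fieldType) (H : hopfAlgebra k).

Definition dual : vectType k := 'Hom(H, k^o).

(* The product of the dual Hopf algebra: (f g)(x) = f(x_(1)) g(x_(2)). *)
Definition convol (f g : dual) : dual :=
  linfun (fun x : H => tlift (fun a b => f a * g b : k^o) (comul x)).

(* x |-> x_(1) ⊗ x_(2) ⊗ x_(3) *)
Definition comul3 (x : H) : (H ⊗ H) ⊗ H := tmap comul id (comul x).

(* The functional g(S^{-1}(c) ? a).  Since H is finite-dimensional the antipode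
   is bijective, so that the linear map antipode^-1 is its inverse. *)
Definition twist (g : dual) (c a : H) : dual :=
  linfun (fun z : H => g ((antipode^-1)%VF c * z * a)).

(* The underlying vector space of D(H); the pure tensor f ⊠ x is f ⋈ x. *)
Definition drinfeldDouble : lmodType k := dual ⊗ H.

(* (f ⋈ x)(g ⋈ y) = f g(S^{-1}(x_(3)) ? x_(1)) ⋈ x_(2) y *)
Definition dmul_pure (f : dual) (x : H) (g : dual) (y : H) : drinfeldDouble :=
  tlift (fun x12 x3 =>
    tlift (fun x1 x2 => convol f (twist g x3 x1) ⊠ (x2 * y)) x12) (comul3 x).

Definition dmul (s t : drinfeldDouble) : drinfeldDouble :=
  tlift (fun f x => tlift (fun g y => dmul_pure f x g y) t) s.

Definition dual_basis (i : 'I_(\dim {:H})) : dual :=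
  linfun (fun x : H => coord (vbasis {:H}) i x : k^o).

Definition Rmatrix : drinfeldDouble ⊗ drinfeldDouble :=
  \sum_(i < \dim {:H})
    ((counit : dual) ⊠ (vbasis {:H})`_i : drinfeldDouble)
      ⊠ (dual_basis i ⊠ 1 : drinfeldDouble).

Lemma linfun_form (f : H -> k^o) : linear f -> linfun f =1 f.
Proof.
move=> lf x.
pose F := HB.pack_for {linear H -> k^o} f (GRing.isLinear.Build _ _ _ _ f lf).
exact: (lfunE F).
Qed.

Lemma convolE (f g : dual) x :
  convol f g x = tlift (fun a b => f a * g b : k^o) (comul x).
Proof.
apply: (linfun_form (f := fun x => tlift _ (comul x))) => e u v.
rewrite linearP tlift_linear //; split=> [w|w] c y z /=.
  by rewrite linearP mulrDl -scalerAl.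
by rewrite linearP mulrDr -scalerAr.
Qed.

Lemma twistE (g : dual) c a z :
  twist g c a z = g ((antipode^-1)%VF c * z * a).
Proof.
apply: (linfun_form (f := fun z => g (_ * z * a))) => e u v.
by rewrite mulrDr mulrDl -scalerAr -scalerAl linearP.
Qed.

Lemma dual_basisE (i j : 'I_(\dim {:H})) :
  dual_basis i (vbasis {:H})`_j = (i == j)%:R.
Proof.
rewrite (linfun_form (f := fun x => coord (vbasis {:H}) i x)) => [|e u v].
  by rewrite coord_free ?(basis_free (vbasisP _)) // eq_sym.
by rewrite linearP.
Qed.

End Double.

Section BraidGroup.
Variable n : nat.

(* The letter (i, false) is the i-th generator (counted from 0) and (i, true)
   is its inverse. *)
Definition braid_word := seq ('I_n.-1 * bool).

Inductive braid_eq : braid_word -> braid_word -> Prop :=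
| BraidRefl s : braid_eq s s
| BraidSym s t : braid_eq s t -> braid_eq t s
| BraidTrans s t u : braid_eq s t -> braid_eq t u -> braid_eq s u
| BraidCat s t s' t' : braid_eq s t -> braid_eq s' t' ->
    braid_eq (s ++ s') (t ++ t')
| BraidInv i b : braid_eq [:: (i, b); (i, ~~ b)] [::]
| BraidFar (i j : 'I_n.-1) : (i.+1 < j)%N ->
    braid_eq [:: (i, false); (j, false)] [:: (j, false); (i, false)]
| BraidNear (i j : 'I_n.-1) : j = i.+1 :> nat ->
    braid_eq [:: (i, false); (j, false); (i, false)]
             [:: (j, false); (i, false); (j, false)].

Definition braid_rel : rel braid_word := fun s t => `[< braid_eq s t >].

Lemma braid_rel_equiv : equiv_class_of braid_rel.
Proof.
split=> [s|s t|t s u].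
- exact/asboolP/BraidRefl.
- by apply/asboolP/asboolP; exact: BraidSym.
- by move=> /asboolP h1 /asboolP h2; apply/asboolP/(BraidTrans h1 h2).
Qed.
Canonical braid_equiv := EquivRelPack braid_rel_equiv.

Definition braid : Type := {eq_quot braid_rel}.
HB.instance Definition _ := Choice.on braid.
HB.instance Definition _ := EqQuotient.on braid.

Lemma braid_piP s t : braid_eq s t -> \pi_braid s = \pi_braid t.
Proof. by move=> h; apply/eqmodP/asboolP. Qed.

Lemma braid_reprP s : braid_eq (repr (\pi_braid s)) s.
Proof.
have /eqmodP/asboolP // : \pi_braid (repr (\pi_braid s)) = \pi_braid s.
by rewrite reprK.
Qed.

Definition word_inv (s : braid_word) : braid_word :=
  rev [seq (p.1, ~~ p.2) | p <- s].

Lemma word_inv_cat s t : word_inv (s ++ t) = word_inv t ++ word_inv s.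
Proof. by rewrite /word_inv map_cat rev_cat. Qed.

Lemma word_invK : involutive word_inv.
Proof.
move=> s; rewrite /word_inv map_rev revK -map_comp -[RHS]map_id.
by apply: eq_map => -[i b] /=; rewrite negbK.
Qed.

Lemma word_mulV s : braid_eq (s ++ word_inv s) [::].
Proof.
elim: s => [|[i b] s IH]; first exact: BraidRefl.
rewrite -cat1s word_inv_cat -catA (catA s).
apply: (BraidTrans (t := [:: (i, b)] ++ ([::] ++ word_inv [:: (i, b)]))).
  apply: BraidCat; first exact: BraidRefl.
  by apply: BraidCat => //; exact: BraidRefl.
exact: BraidInv.
Qed.

Lemma word_Vmul s : braid_eq (word_inv s ++ s) [::].
Proof. by rewrite -{2}[s]word_invK; exact: word_mulV. Qed.

Lemma word_inv_eq s t : braid_eq s t -> braid_eq (word_inv s) (word_inv t).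
Proof.
move=> h; have R := BraidRefl.
apply: (BraidTrans (t := word_inv s ++ (t ++ word_inv t))).
  rewrite -{1}[word_inv s]cats0; apply: BraidCat => //.
  exact/BraidSym/word_mulV.
rewrite catA -{2}[word_inv t]cat0s; apply: BraidCat => //.
apply: BraidTrans (word_Vmul s); apply: BraidCat => //; exact: BraidSym.
Qed.

Definition braid_mul (x y : braid) : braid := \pi_braid (repr x ++ repr y).
Definition braid_one : braid := \pi_braid [::].
Definition braid_inv (x : braid) : braid := \pi_braid (word_inv (repr x)).

Lemma braid_mul_pi s t : braid_mul (\pi_braid s) (\pi_braid t) = \pi_braid (s ++ t).
Proof. by apply/braid_piP/BraidCat; exact: braid_reprP. Qed.
Lemma braid_inv_pi s : braid_inv (\pi_braid s) = \pi_braid (word_inv s).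
Proof. by apply/braid_piP/word_inv_eq; exact: braid_reprP. Qed.

Lemma braid_mulA : associative braid_mul.
Proof.
move=> x y z; rewrite -[x]reprK -[y]reprK -[z]reprK.
move: (repr x) (repr y) (repr z) => s t u.
rewrite (braid_mul_pi t u) (braid_mul_pi s t) (braid_mul_pi s).
by rewrite (braid_mul_pi (s ++ t)) catA.
Qed.
Lemma braid_mul1 : left_id braid_one braid_mul.
Proof. by move=> x; rewrite -[x]reprK; move: (repr x) => s; rewrite braid_mul_pi. Qed.
Lemma braid_mulr1 : right_id braid_one braid_mul.
Proof. by move=> x; rewrite -[x]reprK; move: (repr x) => s; rewrite braid_mul_pi cats0. Qed.
Lemma braid_mulV : left_inverse braid_one braid_inv braid_mul.
Proof.
move=> x; rewrite -[x]reprK; move: (repr x) => s; rewrite braid_inv_pi braid_mul_pi.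
exact/braid_piP/word_Vmul.
Qed.
Lemma braid_mulrV : right_inverse braid_one braid_inv braid_mul.
Proof.
move=> x; rewrite -[x]reprK; move: (repr x) => s; rewrite braid_inv_pi braid_mul_pi.
exact/braid_piP/word_mulV.
Qed.
HB.instance Definition _ := isGroup.Build braid braid_mulA braid_mul1
  braid_mulr1 braid_mulV braid_mulrV.

Definition sigma (i : 'I_n.-1) : braid := \pi_braid [:: (i, false)].

End BraidGroup.

(* As G is a group, each rho g is automatically in Aut(V). *)
Record representation (k : fieldType) (G : groupType) (V : lmodType k) :=
  Representation {
    rho :> G -> V -> V;
    rho_linear : forall g, linear (rho g);
    rho1 : forall v, rho 1%g v = v;
    rhoM : forall g h v, rho (g * h)%g v = rho g (rho h v)
  }.

Definition equivalent_representations (k : fieldType) (G : groupType)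
    (V W : lmodType k) (r : representation G V) (s : representation G W) : Prop :=
  exists Phi : V -> W,
    [/\ linear Phi, bijective Phi & forall g v, Phi (r g v) = s g (Phi v)].

(* V ⊗ (V ⊗ (... ⊗ (V ⊗ k))), with n factors V. *)
Fixpoint tpow (k : fieldType) (V : lmodType k) (n : nat) : lmodType k :=
  if n is m.+1 then V ⊗ tpow V m else k^o.

(* id^{⊗ i} ⊗ c ⊗ id^{⊗ (n - i - 2)} on the n-th tensor power, for i + 2 <= n. *)
Fixpoint braid_at (k : fieldType) (V : lmodType k) (c : V ⊗ V -> V ⊗ V)
    (n i : nat) {struct n} : tpow V n -> tpow V n :=
  match n return tpow V n -> tpow V n with
  | m.+1 =>
    match i with
    | 0 =>
      match m return tpow V m.+1 -> tpow V m.+1 with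
      | p.+1 => fun t => tassoc (tmap c id (tassocV t))
      | 0 => id
      end
    | j.+1 => tmap id (braid_at c (n := m) j)
    end
  | 0 => id
  end.

(* c_{V,V}(v ⊗ w) = sum of t w ⊗ s v, for R the sum of the s ⊗ t. *)
Definition braiding (k : fieldType) (A V : lmodType k) (R : A ⊗ A)
    (av : A -> V -> V) : V ⊗ V -> V ⊗ V :=
  tlift (fun v w => tlift (fun s t => av t w ⊠ av s v) R).

(* c_{V,V} for V = D(H), the left regular module. *)
Definition drinfeld_braiding (k : fieldType) (H : hopfAlgebra k) :
    drinfeldDouble H ⊗ drinfeldDouble H -> drinfeldDouble H ⊗ drinfeldDouble H :=
  braiding (Rmatrix H) (@dmul k H).

(* A representation of B_n is determined by the images of the generators. *)
Definition is_drinfeld_braid_representation (k : fieldType) (H : hopfAlgebra k)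
    (n : nat) (r : representation (braid n) (tpow (drinfeldDouble H) n)) : Prop :=
  forall (i : 'I_n.-1) t, r (sigma i) t = braid_at (@drinfeld_braiding k H) i t.

(* Main.v *)
From HB Require Import structures.
Require Import Defs.
From mathcomp Require Import all_boot all_order all_algebra all_field.
From mathcomp Require Import boolp functions.

Set Implicit Arguments.
Unset Strict Implicit.
Unset Printing Implicit Defensive.

Import GRing.Theory.
Local Open Scope ring_scope.

(** The modules over D(H) are the Yetter-Drinfeld modules over H, which form the
    Drinfeld centre of Mod(H); a monoidal equivalence of Mod(H) with Mod(L)
    carries one centre to the other.  The proof makes this concrete for the one
    object that matters, the regular module D(H).

    A Yetter-Drinfeld module W is an H-module with an action of the dual algebra
    subject to one compatibility condition.  For every H-module X the map
    x ⊗ w |-> sum of h_i^* w ⊗ h_i x is then H-linear from X ⊗ W to W ⊗ X,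
    natural in X, and satisfies the hexagon identity (ydbraid_hmap, ydbraid_nat,
    ydbraid_hexagon).  D(H) is such a module (double_yd), and for X = W = D(H)
    the map above is the braiding of the theorem.  Naturality and hexagon give
    the Yang-Baxter equation, the antipode gives the inverse, and so B_n acts
    (braid_representation_exists).  The product of D(H) involves the inverse of
    the antipode, so the antipode of a finite-dimensional Hopf algebra must be
    shown to be bijective first; this is done with integrals (antipode_eq0).

    Let F be a monoidal equivalence from Mod(H) to Mod(L), with tensorator J.
    If X is an H-module, H ⊗ X is free of rank dim X, which forces F to preserve
    dimensions (fo_dim).  Hence Hom(F(H), Z) has the dimension of Z for every
    finite-dimensional Z.  As F(H) is finitely generated and projective, this
    numerical property makes it free of rank one (regular_generator).  A free
    generator e of F(H) yields linear bijections from X to F(X), natural in X: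
    x goes to F(a |-> a x)(e) (fiber_map).

    The maps J^-1 F(ydbraid) J from FX ⊗ FW to FW ⊗ FX inherit naturality and
    hexagon.  Evaluated at X = H, where F(H) is L, they define an action of the
    dual of L on FW, and these maps become the half-braidings of the
    Yetter-Drinfeld module obtained in this way (transport_yd,
    transport_ydbraidE).

    D(L) is the free Yetter-Drinfeld module on one generator: a vector w of W
    gives the morphism f ⋈ x |-> f (x w) (double_to_yd).  Take W = F(D(H)) and
    for w the image of 1.  A linear form that vanishes on the image of this
    morphism produces, as F is full, a morphism of H-modules on D(H) that kills
    all f ⋈ x; so the morphism is onto, and it is bijective by dimension
    (double_comparison_bij).  Thus D(L) is F(D(H)), with the same braiding.

    Finally B_n acts on the powers of V = D(H) by H-linear maps, so that the
    natural bijection of the n-th power of V with its image under F is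
    equivariant; J identifies that image with the n-th power of F(V), and the
    previous paragraph identifies the latter with the n-th power of D(L). *)

(** * Linearity *)

Section LinearClosure.
Variables (k : fieldType) (U : lmodType k).

Lemma lin_comp_app (V W : lmodType k) (g : V -> W) (f : U -> V) :
  linear g -> linear f -> linear (fun x => g (f x)).
Proof. exact: lin_comp. Qed.

Lemma lin_app2l (V V' W : lmodType k) (g : V -> V' -> W) (f : U -> V) v' :
  (forall w, linear (g^~ w)) -> linear f -> linear (fun x => g (f x) v').
Proof. by move=> lg lf a x y; rewrite lf lg. Qed.

Lemma lin_app2r (V V' W : lmodType k) (g : V -> V' -> W) (f : U -> V') v :
  (forall w, linear (g w)) -> linear f -> linear (fun x => g v (f x)).
Proof. by move=> lg lf a x y; rewrite lf lg. Qed.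

Lemma lin_app3l (V V' V'' W : lmodType k) (g : V -> V' -> V'' -> W) (f : U -> V) v' v'' :
  (forall w w', linear (fun x => g x w w')) -> linear f -> linear (fun x => g (f x) v' v'').
Proof. by move=> lg lf a x y; rewrite lf lg. Qed.

Lemma lin_app3m (V V' V'' W : lmodType k) (g : V -> V' -> V'' -> W) (f : U -> V') v v'' :
  (forall w w', linear (fun x => g w x w')) -> linear f -> linear (fun x => g v (f x) v'').
Proof. by move=> lg lf a x y; rewrite lf lg. Qed.

Lemma lin_app3r (V V' V'' W : lmodType k) (g : V -> V' -> V'' -> W) (f : U -> V'') v v' :
  (forall w w', linear (g w w')) -> linear f -> linear (fun x => g v v' (f x)).
Proof. by move=> lg lf a x y; rewrite lf lg. Qed.

Lemma lin_ext (V : lmodType k) (f g : U -> V) :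
  f =1 g -> linear g -> linear f.
Proof. by move=> e lg a x y; rewrite !e lg. Qed.

Lemma lin_add (V : lmodType k) (f g : U -> V) :
  linear f -> linear g -> linear (fun x => f x + g x).
Proof. by move=> lf lg a x y; rewrite lf lg scalerDr addrACA. Qed.

Lemma lin_scaler (V : lmodType k) c (f : U -> V) :
  linear f -> linear (fun x => c *: f x).
Proof. by move=> lf a x y; rewrite lf scalerDr !scalerA mulrC. Qed.

Lemma lin_opp (V : lmodType k) (f : U -> V) :
  linear f -> linear (fun x => - f x).
Proof. by move=> lf a x y; rewrite lf opprD scalerN. Qed.

Lemma lin_scalel (V : lmodType k) (f : U -> k^o) (v : V) :
  linear f -> linear (fun x => f x *: v).
Proof. by move=> lf a x y; rewrite lf scalerDl -scalerA. Qed.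

Lemma lin_mull (A : lalgType k) (f : U -> A) (c : A) :
  linear f -> linear (fun x => f x * c).
Proof. by move=> lf a x y; rewrite lf mulrDl -scalerAl. Qed.

Lemma lin_mulr (A : algType k) (f : U -> A) (c : A) :
  linear f -> linear (fun x => c * f x).
Proof. by move=> lf a x y; rewrite lf mulrDr -scalerAr. Qed.

Lemma lin_purel (V W : lmodType k) (f : U -> V) (w : W) :
  linear f -> linear (fun x => f x ⊠ w).
Proof. by move=> lf a x y; rewrite lf (pure_bilin _ _).1. Qed.

Lemma lin_purer (V W : lmodType k) (v : V) (f : U -> W) :
  linear f -> linear (fun x => v ⊠ f x).
Proof. by move=> lf a x y; rewrite lf (pure_bilin _ _).2. Qed.

Lemma lin_tlift (V W X : lmodType k) (b : V -> W -> X) (f : U -> V ⊗ W) :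
  bilin b -> linear f -> linear (fun x => tlift b (f x)).
Proof. by move=> bb lf; apply: lin_comp => //; apply: tlift_linear. Qed.

Lemma lin_tliftl (V W X : lmodType k) (b : U -> V -> W -> X) t :
  (forall v w, linear (fun x => b x v w)) -> linear (fun x => tlift (b x) t).
Proof. exact: tlift_param. Qed.

Lemma lin_tmap (V W V' W' : lmodType k) (g : V -> V') (h : W -> W')
    (f : U -> V ⊗ W) :
  linear g -> linear h -> linear f -> linear (fun x => tmap g h (f x)).
Proof. by move=> lg lh lf; apply: lin_comp => //; apply: tmap_linear. Qed.

Lemma lin_tassoc (V W X : lmodType k) (f : U -> (V ⊗ W) ⊗ X) :
  linear f -> linear (fun x => tassoc (f x)).
Proof. by move=> lf; apply: lin_comp => //; apply: tassoc_linear. Qed.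

Lemma lin_tassocV (V W X : lmodType k) (f : U -> V ⊗ (W ⊗ X)) :
  linear f -> linear (fun x => tassocV (f x)).
Proof. by move=> lf; apply: lin_comp => //; apply: tassocV_linear. Qed.

Lemma lin_bigsum (V : lmodType k) I (r : seq I) (F : I -> U -> V) :
  (forall i, linear (F i)) -> linear (fun x => \sum_(i <- r) F i x).
Proof.
move=> lF a x y; rewrite scaler_sumr -big_split /=.
by apply: eq_bigr => i _; rewrite lF.
Qed.

Lemma lin_actl (A : falgType k) (M : hmodule A) (f : U -> A) (m : M) :
  linear f -> linear (fun x => act (f x) m).
Proof. by move=> lf a x y; rewrite lf (act_bilin M).1. Qed.

Lemma lin_actr (A : falgType k) (M : hmodule A) a (f : U -> M) :
  linear f -> linear (fun x => act a (f x)).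
Proof. by move=> lf b x y; rewrite lf (act_bilin M).2. Qed.

Lemma lin_hfun (A : falgType k) (M N : hmodule A) (g : hmap M N) (f : U -> M) :
  linear f -> linear (fun x => hfun g (f x)).
Proof. by move=> lf; apply: lin_comp => //; apply: hmap_lin. Qed.

Lemma lin_lfunl (V W : vectType k) (f : U -> 'Hom(V, W)) v :
  linear f -> linear (fun x => f x v).
Proof. by move=> lf a x y; rewrite lf add_lfunE scale_lfunE. Qed.

Lemma lin_lfunr (V W : vectType k) (g : 'Hom(V, W)) (f : U -> V) :
  linear f -> linear (fun x => g (f x)).
Proof. by move=> lf a x y; rewrite lf linearP. Qed.

Lemma lin_linear (V W : lmodType k) (g : {linear V -> W}) (f : U -> V) :
  linear f -> linear (fun x => g (f x)).
Proof. by move=> lf a x y; rewrite lf linearP. Qed.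

End LinearClosure.

(** Linearity side conditions are decided by the syntax of the function, down
    to variables, for which a hypothesis of the context is used.  This is why
    sections below keep the bilinearity of their operations as local facts. *)
Ltac lin :=
  cbv beta;
  lazymatch goal with
  | |- bilin _ => split; lin
  | |- GRing.linear_for _ (fun _ => _) => lin_leaf
  | |- GRing.linear_for ?s ?f =>
      first [ lin_leaf | change (GRing.linear_for s (fun x => f x)); lin_leaf ]
  | |- is_true _ => by []
  | |- forall _, _ => first [ lin_leaf | intro; lin ]
  end
with lin_leaf :=
  lazymatch goal with
    | |- GRing.linear_for _ (fun x => x) => exact: lin_id
    | |- GRing.linear_for _ (fun x => Algebra.add (@?f x) (@?g x)) => apply: lin_add; lin
    | |- GRing.linear_for _ (fun x => Algebra.opp (@?f x)) => apply: lin_opp; lin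
    | |- GRing.linear_for _ (fun x => GRing.scale (@?f x) (@?g x)) =>
        first [ apply: lin_scaler; lin | apply: lin_scalel; lin ]
    | |- GRing.linear_for _ (fun x => GRing.mul (@?f x) (@?g x)) =>
        first [ apply: lin_mull; lin | apply: lin_mulr; lin ]
    | |- GRing.linear_for _ (fun x => pure (@?f x) (@?g x)) =>
        first [ apply: lin_purel; lin | apply: lin_purer; lin ]
    | |- GRing.linear_for _ (fun x => tlift (@?f x) (@?g x)) =>
        first [ apply: lin_tlift; lin | apply: lin_tliftl; lin ]
    | |- GRing.linear_for _ (fun x => tmap (@?f x) (@?g x) (@?h x)) => apply: lin_tmap; lin
    | |- GRing.linear_for _ (fun x => tassoc (@?f x)) => apply: lin_tassoc; lin
    | |- GRing.linear_for _ (fun x => tassocV (@?f x)) => apply: lin_tassocV; lin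
    | |- GRing.linear_for _ (fun x => act (@?f x) (@?g x)) =>
        first [ apply: lin_actl; lin | apply: lin_actr; lin ]
    | |- GRing.linear_for _ (fun x => hfun (@?f x) (@?g x)) => apply: lin_hfun; lin
    | |- GRing.linear_for _ (fun x => fun_of_lfun (@?f x) (@?g x)) =>
        first [ apply: lin_lfunl; lin | apply: lin_lfunr; lin ]
    | |- GRing.linear_for _ (fun x => bigop.body (@?f x) (@?g x) (@?h x)) =>
        apply: lin_bigsum; lin
    | |- GRing.linear_for _ (fun x => GRing.Linear.sort (@?f x) (@?g x)) =>
        apply: lin_linear; lin
    | |- _ => lin_hyp
    end
with lin_hyp :=
  match goal with
  | H : GRing.linear_for _ _ |- _ =>
      first [ exact: H | apply: (lin_comp_app H); lin ]
  | H : forall a, GRing.linear_for _ _ |- _ =>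
      first [ exact: H | apply: (lin_app2l _ H); lin | apply: (lin_app2r _ H); lin ]
  | H : forall a b, GRing.linear_for _ _ |- _ =>
      first [ exact: H | apply: (lin_app3l _ _ H); lin
        | apply: (lin_app3m _ _ H); lin | apply: (lin_app3r _ _ H); lin ]
  | H : bilin _ |- _ =>
      first [ apply: (lin_app2l _ H.1); lin | apply: (lin_app2r _ H.2); lin ]
  end.

(** * Sweedler calculus *)
Section Sweedler.
Variables (k : fieldType).

(** A value of tlift is by definition a finite sum over a formal sum of pure
    tensors; the rules for finite sums become the following ones. *)
Lemma eq_tlift (V W U : lmodType k) (b c : V -> W -> U) t :
  (forall v w, b v w = c v w) -> tlift b t = tlift c t.
Proof. by move=> e; apply: eq_bigr => p _; rewrite e. Qed.

Lemma lin_tliftE (V W U X : lmodType k) (f : U -> X) (b : V -> W -> U) t :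
  linear f -> f (tlift b t) = tlift (fun v w => f (b v w)) t.
Proof. by move=> lf; rewrite /tlift /feval (lin_sum lf). Qed.

Lemma scale_tlift (V W U : lmodType k) c (b : V -> W -> U) t :
  c *: tlift b t = tlift (fun v w => c *: b v w) t.
Proof. exact: scaler_sumr. Qed.

Lemma mul_tliftl (V W : lmodType k) (A : lalgType k) (b : V -> W -> A) t c :
  tlift b t * c = tlift (fun v w => b v w * c) t.
Proof. exact: mulr_suml. Qed.

Lemma mul_tliftr (V W : lmodType k) (A : lalgType k) (b : V -> W -> A) t c :
  c * tlift b t = tlift (fun v w => c * b v w) t.
Proof. exact: mulr_sumr. Qed.

Lemma sum_tlift (V W U : lmodType k) I (r : seq I) (b : I -> V -> W -> U) t :
  \sum_(i <- r) tlift (b i) t = tlift (fun v w => \sum_(i <- r) b i v w) t.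
Proof. exact: exchange_big. Qed.

Lemma tlift_exch (V W V' W' U : lmodType k) (b : V -> W -> V' -> W' -> U) s t :
  tlift (fun v w => tlift (fun v' w' => b v w v' w') t) s =
  tlift (fun v' w' => tlift (fun v w => b v w v' w') s) t.
Proof. exact: exchange_big. Qed.

Lemma tlift_tmap (V W V' W' U : lmodType k) (b : V' -> W' -> U)
    (f : V -> V') (g : W -> W') t :
  bilin b -> linear f -> linear g ->
  tlift b (tmap f g t) = tlift (fun v w => b (f v) (g w)) t.
Proof.
move=> bb lf lg; rewrite /tmap lin_tliftE; last exact: tlift_linear.
by apply: eq_tlift => v w; rewrite tlift_pure.
Qed.

Lemma lin_comp_bilin (V W U X : lmodType k) (f : U -> X) (b : V -> W -> U) :
  linear f -> bilin b -> bilin (fun v w => f (b v w)).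
Proof. by move=> lf [l1 l2]; split=> [w|v]; apply: (lin_comp_app lf). Qed.

End Sweedler.

(** Sweedler notation: E is summed over the pure tensors a ⊗ b of the coproduct
    of x. *)
Reserved Notation "\sw_ ( a , b <- x ) E"
  (at level 41, E at level 41, a name, b name, x at level 50,
   format "\sw_ ( a ,  b  <-  x )  E").

(** * The antipode *)
Section Antipode.
Variables (k : fieldType) (H : hopfAlgebra k).
Implicit Types x y : H.
Local Notation "\sw_ ( a , b <- x ) E" :=
  (tlift (fun a b : H => E) (comul x)) : ring_scope.

Section Rules.
Variable U : lmodType k.

Lemma sw_coassoc (E : H -> H -> H -> U) x :
  (forall b c, linear (fun a => E a b c)) ->
  (forall a c, linear (fun b => E a b c)) ->
  (forall a b, linear (E a b)) ->
  \sw_(a, b <- x) \sw_(c, d <- a) E c d b =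
  \sw_(a, b <- x) \sw_(c, d <- b) E a c d.
Proof.
move=> l1 l2 l3.
pose G (t : H ⊗ (H ⊗ H)) := tlift (fun a s => tlift (fun c d => E a c d) s) t.
have bG : bilin (fun (a : H) (s : H ⊗ H) => tlift (fun c d => E a c d) s) by lin.
have lG : linear G by apply: tlift_linear.
have <- : G (tmap id comul (comul x)) =
    \sw_(a, b <- x) \sw_(c, d <- b) E a c d.
  by rewrite /G tlift_tmap //; exact: linearP.
rewrite -comulA /tassoc (lin_tliftE (f := G)) // tlift_tmap //.
- apply: eq_tlift => a b; rewrite !(lin_tliftE (f := G)) //.
  apply: eq_tlift => c d; rewrite /G tlift_pure // tlift_pure //; lin.
- by apply: lin_comp_bilin => //; exact: tassoc_bilin.
- exact: linearP.
Qed.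

Lemma sw_counitl (E : H -> U) x : linear E -> \sw_(a, b <- x) counit a *: E b = E x.
Proof.
move=> lE; rewrite -[in RHS](counitl x) lin_tliftE //.
by apply: eq_tlift => a b; rewrite (linZ lE).
Qed.

Lemma sw_counitr (E : H -> U) x : linear E -> \sw_(a, b <- x) counit b *: E a = E x.
Proof.
move=> lE; rewrite -[in RHS](counitr x) lin_tliftE //.
by apply: eq_tlift => a b; rewrite (linZ lE).
Qed.

Lemma sw_mul (E : H -> H -> U) x y : bilin E ->
  \sw_(a, b <- x * y) E a b = \sw_(a, b <- x) \sw_(c, d <- y) E (a * c) (b * d).
Proof.
move=> bE; case: (bE) => l1 l2; rewrite comulM /tmul lin_tliftE; last exact: tlift_linear.
apply: eq_tlift => a b; rewrite lin_tliftE; last exact: tlift_linear.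
by apply: eq_tlift => c d; rewrite tlift_pure.
Qed.

Lemma sw_1 (E : H -> H -> U) : bilin E -> \sw_(a, b <- 1) E a b = E 1 1.
Proof. by move=> bE; rewrite comul1 tlift_pure. Qed.

Lemma sw_antipodel (E : H -> U) x : linear E ->
  \sw_(a, b <- x) E (antipode a * b) = counit x *: E 1.
Proof. by move=> lE; rewrite -(linZ lE) -antipodel lin_tliftE. Qed.

Lemma sw_antipoder (E : H -> U) x : linear E ->
  \sw_(a, b <- x) E (a * antipode b) = counit x *: E 1.
Proof. by move=> lE; rewrite -(linZ lE) -antipoder lin_tliftE. Qed.
End Rules.

(** Both sides are convolution inverses of the product of H.  Concretely,
    S(x1 y1) x2 y2 S(y3) S(x3) is summed in two ways. *)
Lemma antipodeM x y : antipode (x * y) = antipode y * antipode x.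
Proof.
pose T := \sw_(a, b <- x) \sw_(c, d <- y)
    (\sw_(p, q <- a * c) (antipode p * q)) * (antipode d * antipode b).
transitivity T; last first.
  transitivity (\sw_(a, b <- x) counit a *: \sw_(c, d <- y)
      counit c *: (antipode d * antipode b)).
    apply: eq_tlift => a b. rewrite (@scale_tlift k).
    apply: eq_tlift => c d; rewrite antipodel counitM -!scalerAl mul1r.
    by rewrite scalerA.
  rewrite sw_counitl; last by lin.
  by rewrite (sw_counitl (E := fun z => antipode z * _)); last by lin.
transitivity (\sw_(a, b <- x) \sw_(c, d <- b) antipode (a * y) * (c * antipode d)).
  transitivity (\sw_(a, b <- x) counit b *: (antipode (a * y) * 1)).
    rewrite (sw_counitr (E := fun a => antipode (a * y) * 1)); [by rewrite mulr1|lin].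
  apply: eq_tlift => a b.
  by rewrite (sw_antipoder (E := fun z => antipode (a * y) * z)) //; lin.
rewrite -(sw_coassoc (E := fun a b c => antipode (a * y) * (b * antipode c))); [|lin..].
apply: eq_tlift => a b.
transitivity (\sw_(c, d <- a) \sw_(e, f <- y) \sw_(g, h <- f)
   antipode (c * e) * (d * (g * antipode h * antipode b))).
  apply: eq_tlift => c d. 
  transitivity (\sw_(e, f <- y) counit f *: (antipode (c * e) * (d * (1 * antipode b)))).
    by rewrite (sw_counitr (E := fun e => antipode (c * e) * (d * (1 * antipode b)))) ?mul1r //; lin.
  apply: eq_tlift => e f.
  by rewrite (sw_antipoder (E := fun z => antipode (c * e) * (d * (z * antipode b)))) //; lin.
rewrite tlift_exch; apply/esym.
transitivity (\sw_(e, f <- y) \sw_(g, h <- e) \sw_(c, d <- a)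
  antipode (c * g) * (d * h) * (antipode f * antipode b)).
  apply: eq_tlift => c d; rewrite sw_mul; last by lin.
  rewrite tlift_exch (@mul_tliftl k). 
  by apply: eq_tlift => e f; rewrite (@mul_tliftl k).
rewrite (sw_coassoc (E := fun e g h => \sw_(c, d <- a)
  antipode (c * e) * (d * g) * (antipode h * antipode b))); [|lin..].
apply: eq_tlift => e f; rewrite tlift_exch; apply: eq_tlift => c d.
by apply: eq_tlift => g h; rewrite !mulrA.
Qed.

Lemma antipode1 : antipode (1 : H) = 1.
Proof.
have := sw_antipodel 1 (@lin_id k H); rewrite sw_1; last by lin.
by rewrite /= mulr1 counit1 scale1r.
Qed.

Lemma counit_antipode x : counit (antipode x) = counit x.
Proof.
transitivity (\sw_(a, b <- x) (counit (antipode a * b) : k^o)).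
  transitivity (\sw_(a, b <- x) (counit b *: counit (antipode a) : k^o)).
    by rewrite (sw_counitr (E := fun a => counit (antipode a))) //; lin.
  by apply: eq_tlift => a b; rewrite counitM mulrC.
by rewrite (sw_antipodel (E := fun z => counit z : k^o)); [rewrite counit1 -[LHS]/(_ * _) mulr1|lin].
Qed.

(** The antipode reverses the coproduct.  As for antipodeM, both sides are
    convolution inverses of the coproduct. *)
Lemma sw_antipode (U : lmodType k) (E : H -> H -> U) x : bilin E ->
  \sw_(a, b <- antipode x) E a b =
  \sw_(a, b <- x) E (antipode b) (antipode a).
Proof.
move=> bE; case: (bE) => l1 l2.
pose K a b c d e : U := \sw_(p, q <- antipode a) E (p * b * antipode e) (q * (c * antipode d)).
transitivity (\sw_(a, b <- x) \sw_(b1, e <- b) \sw_(b2, d <- b1) \sw_(b', c <- b2) K a b' c d e); last first.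
  transitivity (\sw_(a, b <- x) \sw_(b1, b2 <- a) \sw_(d, e <- b) \sw_(b', c <- b2) K b1 b' c d e).
    rewrite (sw_coassoc (E := fun b1 b2 b => \sw_(d, e <- b) \sw_(b', c <- b2) K b1 b' c d e)); rewrite /K; [|lin..].
    apply: eq_tlift => a b.
    rewrite -(sw_coassoc (E := fun b2 d e => \sw_(b', c <- b2) K a b' c d e)) //; rewrite /K; lin.
  transitivity (\sw_(a, b <- x) counit a *: \sw_(d, e <- b) E (1 * antipode e) (1 * antipode d)).
    apply: eq_tlift => a b; rewrite (@scale_tlift k) tlift_exch; apply: eq_tlift => d e.
    transitivity (\sw_(b1, b2 <- a) \sw_(p, q <- antipode b1 * b2) E (p * antipode e) (q * antipode d)).
      apply: eq_tlift => b1 b2; rewrite sw_mul; last by lin.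
      rewrite tlift_exch; apply: eq_tlift => u v; apply: eq_tlift => p q.
      by rewrite !mulrA.
    rewrite (sw_antipodel (E := fun z => \sw_(p, q <- z) E (p * antipode e) (q * antipode d))); last by lin.
    by rewrite sw_1 //; lin.
  rewrite (sw_counitl (E := fun b => \sw_(d, e <- b) E (1 * antipode e) (1 * antipode d))); last by lin.
  by apply: eq_tlift => d e; rewrite !mul1r.
transitivity (\sw_(a, b <- x) counit b *: \sw_(p, q <- antipode a) E p q).
  by rewrite (sw_counitr (E := fun a => \sw_(p, q <- antipode a) E p q)) //; lin.
apply: eq_tlift => a b.
transitivity (\sw_(b1, e <- b) \sw_(p, q <- antipode a) E (p * (b1 * antipode e)) q).
  rewrite tlift_exch (@scale_tlift k); apply: eq_tlift => p q.
  rewrite (sw_antipoder (E := fun z => E (p * z) q)) ?mulr1 //; lin.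
apply: eq_tlift => b1 e.
transitivity (\sw_(b', b'' <- b1) \sw_(c, d <- b'') K a b' c d e); last first.
  by rewrite -(sw_coassoc (E := fun b' c d => K a b' c d e)) //; rewrite /K; lin.
transitivity (\sw_(b', b'' <- b1) counit b'' *: \sw_(p, q <- antipode a) E (p * b' * antipode e) (q * 1)).
  rewrite (sw_counitr (E := fun b' => \sw_(p, q <- antipode a) E (p * b' * antipode e) (q * 1))); last by lin.
  by apply: eq_tlift => p q; rewrite mulr1 mulrA.
apply: eq_tlift => b' b''; rewrite /K tlift_exch (@scale_tlift k); apply: eq_tlift => p q.
by rewrite (sw_antipoder (E := fun z => E (p * b' * antipode e) (q * z))) //; lin.
Qed.

End Antipode.

(** * The dual algebra *)
Section DualCalculus.
Variables (k : fieldType) (H : hopfAlgebra k).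
Implicit Types (x y : H) (f g : dual H).
Local Notation "\sw_ ( a , b <- x ) E" :=
  (tlift (fun a b : H => E) (comul x)) : ring_scope.

Definition hbas (i : 'I_(\dim {:H})) : H := (vbasis {:H})`_i.
Local Notation "''h_' i" := (hbas i) (at level 8, i at level 2).
Local Notation "''h*_' i" := (dual_basis i : dual H) (at level 8, i at level 2).

Definition shiftr (y : H) f : dual H := linfun (fun z : H => f (z * y) : k^o).
Definition shiftl (y : H) f : dual H := linfun (fun z : H => f (y * z) : k^o).

Lemma shiftrE y f z : shiftr y f z = f (z * y).
Proof. by rewrite linfun_form //; lin. Qed.

Lemma shiftlE y f z : shiftl y f z = f (y * z).
Proof. by rewrite linfun_form //; lin. Qed.

Lemma dual_eq f g : f =1 g -> f = g.
Proof. by move=> e; apply/lfunP. Qed.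

Lemma shiftr_bilin : bilin shiftr.
Proof.
split=> [f|y] a u v; apply/lfunP => z; rewrite !(add_lfunE, scale_lfunE, shiftrE) //.
by rewrite mulrDr linearD -scalerAr linearZ.
Qed.

Lemma shiftl_bilin : bilin shiftl.
Proof.
split=> [f|y] a u v; apply/lfunP => z; rewrite !(add_lfunE, scale_lfunE, shiftlE) //.
by rewrite mulrDl linearD -scalerAl linearZ.
Qed.

Lemma lin_dual (U : lmodType k) (f : U -> dual H) :
  (forall z, linear (fun u => f u z : k^o)) -> linear f.
Proof. by move=> lf a u v; apply/lfunP => z; rewrite lf add_lfunE scale_lfunE. Qed.

Lemma convol_bilin : bilin (@convol k H).
Proof.
split=> f; apply: lin_dual => z.
  by apply: lin_ext => [u|]; [exact: convolE|lin].
by apply: lin_ext => [u|]; [exact: convolE|lin].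
Qed.

Lemma shiftr_mul x y f : shiftr x (shiftr y f) = shiftr (x * y) f.
Proof. by apply: dual_eq => z; rewrite !shiftrE mulrA. Qed.

Lemma shiftr1 f : shiftr 1 f = f.
Proof. by apply: dual_eq => z; rewrite !shiftrE mulr1. Qed.

Lemma convolA f g (h : dual H) : convol f (convol g h) = convol (convol f g) h.
Proof.
apply: dual_eq => x; rewrite !convolE.
transitivity (\sw_(a, b <- x) \sw_(c, d <- b) (f a * (g c * h d) : k^o)).
  by apply: eq_tlift => a b; rewrite convolE (@mul_tliftr k).
rewrite -(sw_coassoc (E := fun a b c => f a * (g b * h c) : k^o)); [|lin..].
apply: eq_tlift => a b; rewrite convolE (@mul_tliftl k).
by apply: eq_tlift => c d; rewrite mulrA.
Qed.

Lemma convol_counitl f : convol counit f = f.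
Proof.
apply: dual_eq => x; rewrite convolE.
by rewrite (sw_counitl (E := fun a => f a : k^o)) //; lin.
Qed.

Lemma convol_counitr f : convol f counit = f.
Proof.
apply: dual_eq => x; rewrite convolE.
rewrite -[RHS](sw_counitr (E := fun a => f a : k^o)); last by lin.
by apply: eq_tlift => a b; exact: mulrC.
Qed.

Lemma basis_expand x : x = \sum_i 'h*_i x *: 'h_i.
Proof.
rewrite [LHS](coord_vbasis (memvf x)); apply: eq_bigr => i _.
congr (_ *: _); apply/esym.
by rewrite linfun_form // => a u v; rewrite linearP.
Qed.

Lemma sum_dual_basis f : f = \sum_i f 'h_i *: 'h*_i.
Proof.
apply: dual_eq => x; rewrite sum_lfunE {1}[x]basis_expand linear_sum.
by apply: eq_bigr => i _; rewrite scale_lfunE linearZ; exact: mulrC.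
Qed.

Lemma sum_basis_lin (U : lmodType k) (E : H -> U) x : linear E ->
  \sum_i 'h*_i x *: E 'h_i = E x.
Proof.
move=> lE; rewrite [in RHS](basis_expand x) (lin_sum lE).
by apply: eq_bigr => i _; rewrite (linZ lE).
Qed.

Lemma sum_dual_lin (U : lmodType k) (E : dual H -> U) f : linear E ->
  \sum_i f 'h_i *: E 'h*_i = E f.
Proof.
move=> lE; rewrite [in RHS](sum_dual_basis f) (lin_sum lE).
by apply: eq_bigr => i _; rewrite (linZ lE).
Qed.

(** The canonical element, the sum of the h_i^* ⊗ h_i, turns the coproduct of H
    into the product of the dual, because the latter is dual to the former. *)
Lemma casimir_comul (U : lmodType k) (E : dual H -> H -> H -> U) :
  (forall b c, linear (fun f => E f b c)) ->
  (forall f, bilin (E f)) ->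
  \sum_i \sw_(a, b <- 'h_i) E 'h*_i a b =
  \sum_i \sum_j E (convol 'h*_i 'h*_j) 'h_i 'h_j.
Proof.
move=> l1 bE.
have l2 f b : linear (fun a => E f a b) by exact: (bE f).1.
have l3 f a : linear (E f a) by exact: (bE f).2.
transitivity (\sum_l \sum_i \sum_j convol 'h*_i 'h*_j 'h_l *: E 'h*_l 'h_i 'h_j).
  apply: eq_bigr => l _.
  transitivity (\sw_(a, b <- 'h_l) \sum_i \sum_j ('h*_i a * 'h*_j b : k^o) *: E 'h*_l 'h_i 'h_j).
    apply: eq_tlift => a b.
    rewrite -(sum_basis_lin (E := fun a => E 'h*_l a b)) //; apply: eq_bigr => i _.
    rewrite -(sum_basis_lin (E := fun b => E 'h*_l 'h_i b)) // scaler_sumr.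
    by apply: eq_bigr => j _; rewrite scalerA.
  rewrite -sum_tlift; apply: eq_bigr => i _.
  rewrite -sum_tlift; apply: eq_bigr => j _.
  by rewrite convolE [RHS]scaler_suml.
rewrite exchange_big; apply: eq_bigr => i _.
rewrite exchange_big; apply: eq_bigr => j _.
by rewrite (sum_dual_lin (E := fun f => E f 'h_i 'h_j)).
Qed.

(** Across the canonical element an operator on H becomes its transpose. *)
Lemma casimir_transpose (U : lmodType k) (E : dual H -> H -> U) (T : H -> H)
    (T' : dual H -> dual H) :
  bilin E -> linear T -> (forall f x, T' f x = f (T x)) ->
  \sum_i E 'h*_i (T 'h_i) = \sum_i E (T' 'h*_i) 'h_i.
Proof.
move=> bE lT e.
transitivity (\sum_i \sum_j 'h*_j (T 'h_i) *: E 'h*_i 'h_j).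
  by apply: eq_bigr => i _; rewrite (sum_basis_lin (E := E 'h*_i)) //; exact: bE.2.
rewrite exchange_big; apply: eq_bigr => j _.
rewrite -(sum_dual_lin (E := fun f => E f 'h_j)); last exact: bE.1.
by apply: eq_bigr => i _; rewrite e.
Qed.

End DualCalculus.

(** * Integrals and bijectivity of the antipode *)
Section Integral.
Variables (k : fieldType) (H : hopfAlgebra k).
Implicit Types (x y : H) (f g : dual H).
Local Notation "\sw_ ( a , b <- x ) E" :=
  (tlift (fun a b : H => E) (comul x)) : ring_scope.
Local Notation "''h_' i" := (@hbas k H i) (at level 8, i at level 2).
Local Notation "''h*_' i" := (dual_basis i : dual H) (at level 8, i at level 2).

(** In terms of H this is x1 λ(x2) = λ(x) 1. *)
Definition is_integral (l : dual H) := forall f, convol f l = f 1 *: l.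

(** The dual of H is a Hopf module: shifting by the antipode is the action, and
    the convolution product encodes the coaction; this is their compatibility. *)
Lemma convol_shift f g y :
  convol f (shiftr (antipode y) g) =
  \sw_(a, b <- y) shiftr (antipode a) (convol (shiftr b f) g).
Proof.
have lC u v : linear (fun w : H => shiftr u (convol (shiftr w f) v)).
  apply: (lin_app2r _ (@shiftr_bilin k H).2).
  apply: (lin_app2l _ (@convol_bilin k H).1).
  exact: (@shiftr_bilin k H).1.
apply: dual_eq => x; rewrite convolE.
rewrite (lin_tliftE (f := fun h : dual H => h x : k^o)); last by lin.
transitivity (\sw_(a, b <- y) \sw_(c, d <- x) \sw_(a1, a2 <- antipode a)
  (f (c * a1 * b) * g (d * a2) : k^o)); last first.
  apply: eq_tlift => a b; rewrite shiftrE convolE sw_mul; last by lin.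
  by apply: eq_tlift => c d; apply: eq_tlift => a1 a2; rewrite shiftrE.
rewrite tlift_exch; apply: eq_tlift => c d; rewrite shiftrE.
transitivity (\sw_(a, b <- y) \sw_(a2, a1 <- a)
  (f (c * antipode a1 * b) * g (d * antipode a2) : k^o)); last first.
  by apply: eq_tlift => a b; rewrite sw_antipode //; lin.
rewrite (sw_coassoc (E := fun a2 a1 b => f (c * antipode a1 * b) * g (d * antipode a2) : k^o)); [|lin..].
transitivity (\sw_(a, b <- y) counit b *: (f (c * 1) * g (d * antipode a) : k^o)).
  rewrite (sw_counitr (E := fun a => f (c * 1) * g (d * antipode a) : k^o)) ?mulr1 //; lin.
apply: eq_tlift => a b.
rewrite -(sw_antipodel (E := fun z => f (c * z) * g (d * antipode a) : k^o)); last by lin.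
by apply: eq_tlift => a1 b1; rewrite mulrA.
Qed.

(** The projection of a Hopf module onto its coinvariants, for the dual of H. *)
Definition integral_of g : dual H :=
  \sum_i shiftr (antipode (antipode 'h_i)) (convol 'h*_i g).

Let lin_shift := @shiftr_bilin k H.
Let lin_conv := @convol_bilin k H.

(** By convol_shift and casimir_comul the left factor f can be gathered in the
    sum of (S(h_i) f) h_i^*, which the antipode axiom evaluates to f(1) eps. *)
Lemma integral_ofP g : is_integral (integral_of g).
Proof.
move=> f; rewrite /integral_of (lin_sum (lin_conv.2 f)).
transitivity (\sum_i \sw_(a, b <- 'h_i) shiftr (antipode (antipode b))
    (convol (shiftr (antipode a) f) (convol 'h*_i g))).
  apply: eq_bigr => i _; rewrite convol_shift sw_antipode //.
  lin.
rewrite (casimir_comul (E := fun h a b => shiftr (antipode (antipode b))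
    (convol (shiftr (antipode a) f) (convol h g)))); [|lin|lin].
rewrite exchange_big scaler_sumr; apply: eq_bigr => j _.
transitivity (shiftr (antipode (antipode 'h_j))
   (convol (\sum_i convol (shiftr (antipode 'h_i) f) 'h*_i) (convol 'h*_j g))).
  rewrite -(lin_sum (lin_shift.2 _)) (lin_sum (lin_conv.1 _)); congr shiftr.
  by apply: eq_bigr => i _; rewrite !convolA.
have -> : \sum_i convol (shiftr (antipode 'h_i) f) 'h*_i = f 1 *: (counit : dual H).
  apply: dual_eq => x; rewrite sum_lfunE scale_lfunE.
  transitivity (\sum_i \sw_(a, b <- x) ('h*_i b *: f (a * antipode 'h_i) : k^o)).
    apply: eq_bigr => i _; rewrite convolE; apply: eq_tlift => a b.
    rewrite shiftrE; exact: mulrC.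
  rewrite (@sum_tlift k).
  transitivity (\sw_(a, b <- x) (f (a * antipode b) : k^o)).
    apply: eq_tlift => a b.
    by rewrite (sum_basis_lin (E := fun z => f (a * antipode z) : k^o)) //; lin.
  rewrite (sw_antipoder (E := fun z => f z : k^o)); last by lin.
  exact: mulrC.
rewrite (linZ (lin_conv.1 _)) (linZ (lin_shift.2 _)).
by rewrite convol_counitl.
Qed.

(** The reconstruction of a Hopf module from its coinvariants.  It shows that
    nonzero coinvariants, here integrals, exist. *)
Lemma integral_of_expand g :
  g = \sum_i shiftr (antipode 'h_i) (integral_of (convol 'h*_i g)).
Proof.
transitivity (\sum_i \sum_j shiftr (antipode 'h_j * antipode (antipode 'h_i))
    (convol (convol 'h*_i 'h*_j) g)); last first.
  rewrite exchange_big; apply: eq_bigr => i _.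
  rewrite (lin_sum (lin_shift.2 _)); apply: eq_bigr => j _.
  by rewrite shiftr_mul convolA.
rewrite -(casimir_comul (E := fun h a b =>
  shiftr (antipode b * antipode (antipode a)) (convol h g))); [|lin|lin].
transitivity (\sum_i counit 'h_i *: shiftr 1 (convol 'h*_i g)).
  rewrite (sum_dual_lin (E := fun h => shiftr 1 (convol h g))); last by lin.
  by rewrite convol_counitl shiftr1.
apply: eq_bigr => i _.
transitivity (\sw_(a, b <- 'h_i) shiftr (antipode (antipode a * b)) (convol 'h*_i g)); last first.
  by apply: eq_tlift => a b; rewrite antipodeM.
rewrite (sw_antipodel (E := fun z => shiftr (antipode z) (convol 'h*_i g))) ?antipode1 //; lin.
Qed.

Lemma exists_integral : exists2 l, is_integral l & l != 0.
Proof.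
apply: contrapT => no.
have I0 g : integral_of g = 0.
  apply: contrapT => /eqP n0; apply: no.
  by exists (integral_of g) => //; exact: integral_ofP.
have : (counit : dual H) 1 = 0.
  rewrite (integral_of_expand counit) big1 ?zero_lfunE // => i _.
  by rewrite I0 (lin0 (lin_shift.2 _)).
by rewrite counit1 => /eqP; rewrite oner_eq0.
Qed.

(** If S(y) = 0 and l is an integral, then convol_shift says that the sum of
    the f(y2) S(y1) l vanishes for every f; the freeness of the Hopf module
    generated by l recovers l ⊗ y from these sums. *)
Lemma antipode_eq0 y : antipode y = 0 -> y = 0.
Proof.
move=> Sy0; have [l lP ln0] := exists_integral.
have T0 f : \sw_(a, b <- y) f b *: shiftr (antipode a) l = 0.
  have := convol_shift f l y; rewrite Sy0 (lin0 (lin_shift.1 _)) (lin0 (lin_conv.2 _)).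
  move->; apply: eq_tlift => a b.
  by rewrite lP shiftrE mul1r (linZ (lin_shift.2 _)).
have /eqP/lfunPn [x lx0] : l <> 0 by apply/eqP.
suff : l x *: y = 0.
  by move/eqP; rewrite scaler_eq0 (negPf (_ : l x != 0)) => [/eqP|]//; rewrite zero_lfunE in lx0.
transitivity (\sum_i \sw_(c, d <- 'h_i) (shiftr (antipode (antipode c))
  (\sw_(a, b <- y) 'h*_i b *: shiftr (antipode a) l)) x *: d); last first.
  apply: big1 => i _; rewrite T0 /tlift /feval big1 // => p _.
  by rewrite (lin0 (lin_shift.2 _)) zero_lfunE scale0r.
transitivity (\sw_(a, b <- y) \sw_(c, d <- b)
    l (x * antipode (a * antipode c)) *: d).
  rewrite -(sw_coassoc (E := fun a c d => l (x * antipode (a * antipode c)) *: d)); [|lin..].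
  transitivity (\sw_(a, b <- y) counit a *: (l (x * antipode 1) *: b)).
    rewrite (@sw_counitl k H _ (fun b => l (x * antipode 1) *: b)); last by lin.
    by rewrite antipode1 mulr1.
  apply: (@eq_tlift k) => a b.
  by rewrite (sw_antipoder (E := fun z => l (x * antipode z) *: b)) //; lin.
transitivity (\sw_(a, b <- y) \sum_i 'h*_i b *: \sw_(c, d <- 'h_i)
    l (x * antipode (a * antipode c)) *: d).
  apply: (@eq_tlift k) => a b.
  by rewrite (sum_basis_lin (E := fun z => \sw_(c, d <- z)
    l (x * antipode (a * antipode c)) *: d)) //; lin.
rewrite -(@sum_tlift k); apply: eq_bigr => i _.
transitivity (\sw_(a, b <- y) \sw_(c, d <- 'h_i) 'h*_i b *:
    (l (x * antipode (a * antipode c)) *: d)).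
  by apply: (@eq_tlift k) => a b; rewrite (@scale_tlift k).
rewrite tlift_exch; apply: (@eq_tlift k) => c d.
rewrite (lin_tliftE (f := fun u : dual H => shiftr (antipode (antipode c)) u x *: d)); last by lin.
apply: (@eq_tlift k) => a b.
rewrite (linZ (lin_shift.2 _)) scale_lfunE -scalerA; congr (_ *: (_ *: _)).
by rewrite !shiftrE antipodeM mulrA.
Qed.

Lemma antipodeK : cancel (@antipode k H) (antipode^-1)%VF.
Proof.
apply: lker0_lfunK; rewrite -subv0; apply/subvP => y.
by rewrite memv_ker memv0 => /eqP/antipode_eq0 ->.
Qed.

Lemma antipodeVK : cancel (antipode^-1)%VF (@antipode k H).
Proof.
apply: lker0_lfunVK; rewrite -subv0; apply/subvP => y.
by rewrite memv_ker memv0 => /eqP/antipode_eq0 ->.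
Qed.

Local Notation S' := ((@antipode k H)^-1)%VF.

Lemma antipodeV_M x y : S' (x * y) = S' y * S' x.
Proof. by apply: (can_inj antipodeK); rewrite antipodeM !antipodeVK. Qed.

Lemma antipodeV1 : S' (1 : H) = 1.
Proof. by apply: (can_inj antipodeK); rewrite antipode1 !antipodeVK. Qed.

Lemma counit_antipodeV x : counit (S' x) = counit x.
Proof. by rewrite -counit_antipode antipodeVK. Qed.

Lemma sw_antipodeV (U : lmodType k) (E : H -> H -> U) x : bilin E ->
  \sw_(a, b <- S' x) E a b = \sw_(a, b <- x) E (S' b) (S' a).
Proof.
move=> bE; case: (bE) => l1 l2; rewrite -{2}[x]antipodeVK sw_antipode; last by lin.
by apply: (@eq_tlift k) => a b; rewrite !antipodeK.
Qed.

Lemma sw_antipodeVl (U : lmodType k) (E : H -> U) x : linear E ->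
  \sw_(a, b <- x) E (S' b * a) = counit x *: E 1.
Proof.
move=> lE; rewrite -(counit_antipodeV x) -(sw_antipoder _ lE) sw_antipodeV; last by lin.
by apply: eq_tlift => a b; rewrite antipodeVK.
Qed.

Lemma sw_antipodeVr (U : lmodType k) (E : H -> U) x : linear E ->
  \sw_(a, b <- x) E (b * S' a) = counit x *: E 1.
Proof.
move=> lE; rewrite -(counit_antipodeV x) -(sw_antipodel _ lE) sw_antipodeV; last by lin.
by apply: eq_tlift => a b; rewrite antipodeVK.
Qed.

End Integral.

(** * Yetter-Drinfeld modules *)

(** The coaction w |-> sum of h_i^* w ⊗ h_i is encoded by the action of the dual
    that it induces; yd_compat is the straightening rule of D(H) for the product
    of x and f. *)
Record ydmodule (k : fieldType) (H : hopfAlgebra k) := YDModule {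
  ydmod :> hmodule H;
  dact : dual H -> ydmod -> ydmod;
  dact_bilin : bilin dact;
  dactM : forall f g w, dact f (dact g w) = dact (convol f g) w;
  yd_compat : forall (x : H) f w,
    tlift (fun a b : H => act a (dact (shiftl b f) w)) (comul x) =
    tlift (fun a b : H => dact (shiftr a f) (act b w)) (comul x)
}.
Arguments dact {k H y} f w.

Section YetterDrinfeld.
Variables (k : fieldType) (H : hopfAlgebra k).
Implicit Types (x y : H) (f g : dual H).
Local Notation "\sw_ ( a , b <- x ) E" :=
  (tlift (fun a b : H => E) (comul x)) : ring_scope.
Local Notation "''h_' i" := (@hbas k H i) (at level 8, i at level 2).
Local Notation "''h*_' i" := (dual_basis i : dual H) (at level 8, i at level 2).
Let lin_shr := @shiftr_bilin k H.
Let lin_shl := @shiftl_bilin k H.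
Let lin_conv := @convol_bilin k H.

Lemma act_tensorE (M N : hmodule H) x (m : M) (n : N) :
  act (h := mod_tensor M N) x (m ⊠ n) = \sw_(a, b <- x) (act a m ⊠ act b n).
Proof.
apply: eq_tlift => a b; rewrite tmap_pure //; exact: (act_bilin _).2.
Qed.

Section Braiding.
Variables (X : hmodule H) (W : ydmodule H).
Let lin_dact := @dact_bilin k H W.

Definition ydbraid : X ⊗ W -> W ⊗ X :=
  tlift (fun (x : X) (w : W) => \sum_i dact 'h*_i w ⊠ act 'h_i x).

Lemma ydbraid_bilin :
  bilin (fun (x : X) (w : W) => \sum_i dact 'h*_i w ⊠ act 'h_i x).
Proof. lin. Qed.

Lemma ydbraid_linear : linear ydbraid.
Proof. exact: tlift_linear ydbraid_bilin. Qed.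

Lemma ydbraid_pure (x : X) (w : W) : ydbraid (x ⊠ w) = \sum_i dact 'h*_i w ⊠ act 'h_i x.
Proof. exact: tlift_pure ydbraid_bilin. Qed.

(** Across the canonical element, multiplication by x on h_i becomes a shift of
    h_i^*, and the statement turns into yd_compat. *)
Lemma ydbraid_subproof :
  @is_hmap k H (mod_tensor X W) (mod_tensor W X) ydbraid.
Proof.
split=> [|x]; first exact: ydbraid_linear.
apply: tensor_ext => [||m w].
- exact: (lin_comp ydbraid_linear ((act_bilin (mod_tensor X W)).2 x)).
- exact: (lin_comp ((act_bilin (mod_tensor W X)).2 x) ydbraid_linear).
rewrite act_tensorE (lin_tliftE _ _ ydbraid_linear).
transitivity (\sw_(a, b <- x) \sum_i dact (shiftr a 'h*_i) (act b w) ⊠ act 'h_i m).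
  apply: eq_tlift => a b; rewrite ydbraid_pure.
  rewrite -(casimir_transpose (E := fun f z => dact f (act b w) ⊠ act z m)
    (T := fun z => z * a)); [|lin|lin|by move=> f z; rewrite shiftrE].
  by apply: eq_bigr => i _; rewrite actM.
rewrite -(@sum_tlift k) ydbraid_pure.
rewrite (lin_sum ((act_bilin (mod_tensor W X)).2 x)).
transitivity (\sum_i \sw_(a, b <- x) (act a (dact (shiftl b 'h*_i) w) ⊠ act 'h_i m)).
  apply: eq_bigr => i _.
  rewrite -(lin_tliftE (f := fun z => z ⊠ act 'h_i m)); last by lin.
  rewrite -(lin_tliftE (f := fun z => z ⊠ act 'h_i m)); last by lin.
  by rewrite yd_compat.
rewrite (@sum_tlift k).
transitivity (\sw_(a, b <- x) \sum_i act a (dact 'h*_i w) ⊠ act (b * 'h_i) m).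
  apply: eq_tlift => a b.
  rewrite -(casimir_transpose (E := fun f z => act a (dact f w) ⊠ act z m)
    (T := fun z => b * z)) //; [lin|lin|by move=> f z; rewrite shiftlE].
rewrite -(@sum_tlift k); apply: eq_bigr => i _; rewrite act_tensorE.
by apply: eq_tlift => a b; rewrite actM.
Qed.

Definition ydbraid_hmap : hmap (mod_tensor X W) (mod_tensor W X) :=
  mkhmap ydbraid_subproof.

End Braiding.

Lemma ydbraid_nat (X Y : hmodule H) (W : ydmodule H) (f : hmap X Y) (t : X ⊗ W) :
  ydbraid (tmap (hfun f) id t) = tmap id (hfun f) (ydbraid t).
Proof.
have lf := hmap_lin f; have lX := @ydbraid_linear X W.
have lY := @ydbraid_linear Y W.
apply: (tensor_ext (f := fun t => ydbraid (tmap (hfun f) id t))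
   (g := fun t => tmap id (hfun f) (ydbraid t))) => [||x w].
- by lin.
- by lin.
rewrite tmap_pure // !ydbraid_pure.
rewrite (lin_sum (f := tmap id (hfun f))); last by lin.
by apply: eq_bigr => i _; rewrite tmap_pure // hmap_act.
Qed.

(** This is casimir_comul applied to the action on X ⊗ Y. *)
Lemma ydbraid_hexagon (X Y : hmodule H) (W : ydmodule H) (x : X) (y : Y) (w : W) :
  ydbraid (X := mod_tensor X Y) ((x ⊠ y) ⊠ w) =
  \sum_i \sum_j dact 'h*_i (dact 'h*_j w) ⊠ (act 'h_i x ⊠ act 'h_j y).
Proof.
have lin_dact := @dact_bilin k H W.
rewrite ydbraid_pure.
transitivity (\sum_i \sw_(a, b <- 'h_i) (dact 'h*_i w ⊠ (act a x ⊠ act b y))).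
  apply: eq_bigr => i _; rewrite act_tensorE.
  by rewrite (lin_tliftE (f := fun z => dact 'h*_i w ⊠ z)) //; lin.
rewrite (casimir_comul (E := fun f a b => dact f w ⊠ (act a x ⊠ act b y))); [|lin|lin].
by do 2!apply: eq_bigr => ? _; rewrite dactM.
Qed.

Section Yang_Baxter.
Variable W : ydmodule H.
Local Notation c := (@ydbraid W W).
Let lin_dact := @dact_bilin k H W.

(** By the hexagon, c12 c23 is the half-braiding of W ⊗ W, which commutes with
    the H-linear map c. *)
Lemma yang_baxter (t : W ⊗ (W ⊗ W)) :
  let c12 t := tassoc (tmap c id (tassocV t)) in
  let c23 t := tmap id c t in
  c12 (c23 (c12 t)) = c23 (c12 (c23 t)).
Proof.
move=> c12 c23.
have lc : linear c := @ydbraid_linear W W.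
have l12 : linear c12 by rewrite /c12; lin.
have l23 : linear c23 by rewrite /c23; lin.
pose W2 := mod_tensor W W.
have lc2 : linear (@ydbraid W2 W) := @ydbraid_linear _ _.
have hex (s : (W ⊗ W) ⊗ W) : c12 (c23 (tassoc s)) = ydbraid (X := W2) s.
  move: s; apply: tensor3_ext => [||u v w]; [by lin|exact: lc2|].
  rewrite tassoc_pure /c23 tmap_pure // ydbraid_hexagon ydbraid_pure.
  rewrite (lin_sum (f := fun z => c12 (u ⊠ z))); last by lin.
  rewrite [RHS]exchange_big; apply: eq_bigr => j _.
  rewrite /c12 tassocV_pure tmap_pure // ydbraid_pure.
  rewrite (lin_sum (f := fun z => tassoc (z ⊠ _))); last by lin.
  by apply: eq_bigr => i _; rewrite tassoc_pure.
pose s := tassocV t; have -> : t = tassoc s by rewrite tassocVK.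
have c12s : c12 (tassoc s) = tassoc (tmap c id s) by rewrite /c12 tassocK.
by rewrite c12s !hex (ydbraid_nat (X := W2) (Y := W2) (ydbraid_hmap W W)).
Qed.

Hypothesis unital : forall w : W, dact counit w = w.

(** The antipode axioms make this the inverse of ydbraid. *)
Definition ydbraidV (X : hmodule H) : W ⊗ X -> X ⊗ W :=
  tlift (fun (w : W) (x : X) => \sum_i act (antipode 'h_i) x ⊠ dact 'h*_i w).

Variable X : hmodule H.

Lemma ydbraidV_bilin :
  bilin (fun (w : W) (x : X) => \sum_i act (antipode 'h_i) x ⊠ dact 'h*_i w).
Proof. lin. Qed.

Lemma ydbraidK : cancel (@ydbraid X W) (@ydbraidV X).
Proof.
have l1 : linear (@ydbraidV X) := tlift_linear ydbraidV_bilin; have l2 := @ydbraid_linear X W.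
apply: (tensor_ext (f := fun t => ydbraidV (ydbraid t)) (g := id)) => [||x w]; [|by []|].
  exact: (lin_comp l1 l2).
rewrite ydbraid_pure (lin_sum l1).
transitivity (\sum_i \sum_j act (antipode 'h_j) (act 'h_i x) ⊠ dact (convol 'h*_j 'h*_i) w).
  apply: eq_bigr => i _; rewrite /ydbraidV (tlift_pure _ _ ydbraidV_bilin).
  by apply: eq_bigr => j _; rewrite dactM.
rewrite exchange_big /=.
rewrite -(casimir_comul (E := fun f a b => act (antipode a) (act b x) ⊠ dact f w)); [|lin|lin].
transitivity (\sum_i counit 'h_i *: (act 1 x ⊠ dact 'h*_i w : (X ⊗ W : lmodType k))).
  apply: eq_bigr => i _.
  rewrite -(sw_antipodel (E := fun z => act z x ⊠ dact 'h*_i w)); last by lin.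
  by apply: eq_tlift => a b; rewrite actM.
rewrite (sum_dual_lin (E := fun f => act 1 x ⊠ dact f w)); last by lin.
by rewrite act1 unital.
Qed.

Lemma ydbraidVK : cancel (@ydbraidV X) (@ydbraid X W).
Proof.
have l1 : linear (@ydbraidV X) := tlift_linear ydbraidV_bilin; have l2 := @ydbraid_linear X W.
apply: (tensor_ext (f := fun t => ydbraid (ydbraidV t)) (g := id)) => [||w x]; [|by []|].
  exact: (lin_comp l2 l1).
rewrite /ydbraidV (tlift_pure _ _ ydbraidV_bilin) (lin_sum l2).
transitivity (\sum_i \sum_j dact (convol 'h*_j 'h*_i) w ⊠ act 'h_j (act (antipode 'h_i) x)).
  apply: eq_bigr => i _; rewrite ydbraid_pure.
  by apply: eq_bigr => j _; rewrite dactM.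
rewrite exchange_big /=.
rewrite -(casimir_comul (E := fun f a b => dact f w ⊠ act a (act (antipode b) x))); [|lin|lin].
transitivity (\sum_i counit 'h_i *: (dact 'h*_i w ⊠ act 1 x : (W ⊗ X : lmodType k))).
  apply: eq_bigr => i _.
  rewrite -(sw_antipoder (E := fun z => dact 'h*_i w ⊠ act z x)); last by lin.
  by apply: eq_tlift => a b; rewrite actM.
rewrite (sum_dual_lin (E := fun f => dact f w ⊠ act 1 x)); last by lin.
by rewrite act1 unital.
Qed.

End Yang_Baxter.

(** Both braidings are given by the same formula in the two actions. *)
Lemma ydbraid_morph (W W' : ydmodule H) (z : W -> W') :
  linear z -> (forall x w, z (act x w) = act x (z w)) ->
  (forall f w, z (dact f w) = dact f (z w)) ->
  forall t : W ⊗ W, ydbraid (X := W') (tmap z z t) = tmap z z (ydbraid (X := W) t).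
Proof.
move=> lz za zd; have lW := @ydbraid_linear W W.
have lW' := @ydbraid_linear W' W'.
apply: (tensor_ext (f := fun t => ydbraid (X := W') (tmap z z t))
   (g := fun t => tmap z z (ydbraid (X := W) t))) => [||v w].
- by lin.
- by lin.
rewrite tmap_pure // !ydbraid_pure.
rewrite (lin_sum (f := tmap z z)); last by lin.
by apply: eq_bigr => i _; rewrite tmap_pure // za zd.
Qed.

End YetterDrinfeld.

(** * The Drinfeld double as a Yetter-Drinfeld module *)
Section DoubleYD.
Variables (k : fieldType) (H : hopfAlgebra k).
Implicit Types (x y : H) (f g : dual H).
Local Notation "\sw_ ( a , b <- x ) E" :=
  (tlift (fun a b : H => E) (comul x)) : ring_scope.
Local Notation "''h_' i" := (@hbas k H i) (at level 8, i at level 2).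
Local Notation "''h*_' i" := (dual_basis i : dual H) (at level 8, i at level 2).
Local Notation S' := ((@antipode k H)^-1)%VF.
Local Notation D := (drinfeldDouble H).
Let lin_shr := @shiftr_bilin k H.
Let lin_shl := @shiftl_bilin k H.
Let lin_conv := @convol_bilin k H.

Lemma twist_shift g x y : twist g x y = shiftl (S' x) (shiftr y g).
Proof. by apply: dual_eq => z; rewrite twistE shiftlE shiftrE. Qed.

Lemma shiftl_mul x y f : shiftl x (shiftl y f) = shiftl (y * x) f.
Proof. by apply: dual_eq => z; rewrite !shiftlE mulrA. Qed.

Lemma shiftl1 f : shiftl 1 f = f.
Proof. by apply: dual_eq => z; rewrite !shiftlE mul1r. Qed.

Lemma shiftlr x y f : shiftl x (shiftr y f) = shiftr y (shiftl x f).
Proof. by apply: dual_eq => z; rewrite !(shiftrE, shiftlE) mulrA. Qed.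

Lemma dmul_pureE f x g y :
  dmul_pure f x g y =
  \sw_(a, b <- x) \sw_(c, d <- a) (convol f (shiftl (S' b) (shiftr c g)) ⊠ (d * y)) :> D.
Proof.
rewrite /dmul_pure /comul3 tlift_tmap; [| |exact: linearP|by []].
  by apply: eq_tlift => a b; apply: eq_tlift => c d; rewrite twist_shift.
split=> [w|v] /=.
  apply: lin_tlift; last by [].
  split=> v.
    apply: (lin_ext (g := fun x1 => convol f (shiftl (S' w) (shiftr x1 g)) ⊠ (v * y))) => [u|].
      by rewrite twist_shift.
    by lin.
  by lin.
apply: lin_tliftl => a b.
apply: (lin_ext (g := fun w => convol f (shiftl (S' w) (shiftr a g)) ⊠ (b * y))) => [u|].
  by rewrite twist_shift.
by lin.
Qed.

Lemma dmul_pure_bilin f x : bilin (@dmul_pure k H f x).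
Proof.
have e g y := dmul_pureE f x g y.
split=> [y|g].
  by apply: lin_ext => [g|]; [exact: dmul_pureE|lin].
by apply: lin_ext => [y|]; [exact: dmul_pureE|lin].
Qed.

Lemma dmul_bilin : bilin (@dmul k H).
Proof.
have b2 t : bilin (fun f x => tlift (fun g y => dmul_pure f x g y) t : D).
  split=> [x|f]; apply: lin_tliftl => g y.
    by apply: lin_ext => [f|]; [exact: dmul_pureE|lin].
  by apply: lin_ext => [x|]; [exact: dmul_pureE|lin].
split=> [t|s].
  exact: tlift_linear.
by apply: lin_tliftl => f x; apply: tlift_linear; exact: dmul_pure_bilin.
Qed.

Lemma dmul_pureP f x g y : dmul (f ⊠ x) (g ⊠ y) = dmul_pure f x g y.
Proof.
rewrite /dmul tlift_pure ?tlift_pure //; first exact: dmul_pure_bilin.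
split=> [x'|f']; apply: lin_tliftl => g' y'.
  by apply: lin_ext => [f'|]; [exact: dmul_pureE|lin].
by apply: lin_ext => [x'|]; [exact: dmul_pureE|lin].
Qed.

Definition double_act x (t : D) : D := dmul (@pure k (dual H) H counit x) t.
Definition double_dact f (t : D) : D := dmul (@pure k (dual H) H f 1) t.

Lemma double_act_pure x g y : double_act x (g ⊠ y) =
  \sw_(a, b <- x) \sw_(c, d <- a) (shiftl (S' b) (shiftr c g) ⊠ (d * y)) :> D.
Proof.
rewrite /double_act dmul_pureP dmul_pureE.
by apply: eq_tlift => a b; apply: eq_tlift => c d; rewrite convol_counitl.
Qed.

Lemma double_dact_pure f g y : double_dact f (g ⊠ y) = convol f g ⊠ y :> D.
Proof.
rewrite /double_dact dmul_pureP dmul_pureE sw_1; last by lin.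
rewrite sw_1; last by lin.
by rewrite (antipodeV1 H) shiftl1 shiftr1 mul1r.
Qed.

Lemma double_act_bilin : bilin double_act.
Proof.
split=> [t|x]; last exact: dmul_bilin.2.
by apply: (lin_comp_app (dmul_bilin.1 t)); lin.
Qed.

Lemma double_dact_bilin : bilin double_dact.
Proof.
split=> [t|x]; last exact: dmul_bilin.2.
by apply: (lin_comp_app (dmul_bilin.1 t)); lin.
Qed.

Let lin_act := double_act_bilin.
Let lin_dact := double_dact_bilin.

Lemma double_act1 t : double_act 1 t = t.
Proof.
apply: (tensor_ext (f := double_act 1) (g := id)) => [||g y]; [by lin|by []|].
rewrite double_act_pure sw_1; last by lin.
rewrite sw_1; last by lin.
by rewrite (antipodeV1 H) shiftl1 shiftr1 mul1r.
Qed.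

Lemma double_actM x x' t : double_act (x * x') t = double_act x (double_act x' t).
Proof.
apply: (tensor_ext (f := double_act (x * x')) (g := fun t => double_act x (double_act x' t)))
  => [||g y]; [by lin|by lin|].
rewrite !double_act_pure sw_mul; last by lin.
rewrite (lin_tliftE (f := double_act x)); last by lin.
rewrite tlift_exch; apply: eq_tlift => a' b'.
rewrite (lin_tliftE (f := double_act x)); last by lin.
transitivity (\sw_(a, b <- x) \sw_(c', d' <- a') \sw_(c, d <- a)
   (shiftl (S' (b * b')) (shiftr (c * c') g) ⊠ (d * d' * y) : (dual H ⊗ H : lmodType k))).
  by apply: eq_tlift => a b; rewrite sw_mul; [rewrite tlift_exch | lin].
rewrite tlift_exch; apply: eq_tlift => c' d'; rewrite double_act_pure.
apply: eq_tlift => a b; apply: eq_tlift => c d.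
by rewrite (antipodeV_M b b') -shiftl_mul -shiftr_mul mulrA shiftlr.
Qed.

Lemma double_dactM f g t : double_dact f (double_dact g t) = double_dact (convol f g) t.
Proof.
apply: (tensor_ext (f := fun t => double_dact f (double_dact g t)) (g := double_dact (convol f g)))
  => [||h y]; [by lin|by lin|].
by rewrite !double_dact_pure convolA.
Qed.

Lemma double_dact1 t : double_dact counit t = t.
Proof.
apply: (tensor_ext (f := double_dact counit) (g := id)) => [||h y]; [by lin|by []|].
by rewrite double_dact_pure convol_counitl.
Qed.

(** A twist of a product, as the inverse antipode reverses coproducts. *)
Lemma shift_convol f g x y :
  shiftl (S' x) (shiftr y (convol f g)) =
  \sw_(a, b <- x) \sw_(c, d <- y)
    convol (shiftl (S' b) (shiftr c f)) (shiftl (S' a) (shiftr d g)).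
Proof.
apply: dual_eq => z; rewrite shiftlE shiftrE convolE.
rewrite (lin_tliftE (f := fun h : dual H => h z : k^o)); last by lin.
rewrite sw_mul; last by lin.
transitivity (\sw_(a, b <- y) \sw_(c, d <- S' x * z) (f (c * a) * g (d * b) : k^o)).
  exact: tlift_exch.
transitivity (\sw_(e, e' <- y) \sw_(a, b <- x) \sw_(c, d <- z)
   (f (S' b * c * e) * g (S' a * d * e') : k^o)).
  apply: eq_tlift => e e'; rewrite sw_mul; last by lin.
  by rewrite sw_antipodeV //; lin.
rewrite tlift_exch; apply: eq_tlift => a b.
rewrite (lin_tliftE (f := fun h : dual H => h z : k^o)); last by lin.
apply: eq_tlift => c d; rewrite convolE; apply: eq_tlift => z1 z2.
by rewrite !(shiftlE, shiftrE).
Qed.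

(** On the left the shift by b meets the last factor of the twist; they cancel
    by the axiom x2 S^-1(x1) = eps(x). *)
Lemma double_compat x f t :
  \sw_(a, b <- x) double_act a (double_dact (shiftl b f) t) =
  \sw_(a, b <- x) double_dact (shiftr a f) (double_act b t).
Proof.
apply: (tensor_ext
  (f := fun t => \sw_(a, b <- x) double_act a (double_dact (shiftl b f) t))
  (g := fun t => \sw_(a, b <- x) double_dact (shiftr a f) (double_act b t)))
  => [||g y]; [by lin|by lin|].
pose K c1 c2 d u : D := convol (shiftr c1 f) (shiftl (S' u) (shiftr c2 g)) ⊠ (d * y).
transitivity (\sw_(a, u <- x) \sw_(c, d <- a) \sw_(c1, c2 <- c) K c1 c2 d u); last first.
  transitivity (\sw_(a, u <- x) \sw_(c1, w <- a) \sw_(c2, d <- w) K c1 c2 d u).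
    apply: eq_tlift => a u.
    by rewrite (sw_coassoc (E := fun c1 c2 d => K c1 c2 d u)) // /K; lin.
  rewrite (sw_coassoc (E := fun c1 w u => \sw_(c2, d <- w) K c1 c2 d u)); rewrite /K; [|lin..].
  apply: eq_tlift => c1 s; rewrite double_act_pure.
  rewrite (lin_tliftE (f := double_dact (shiftr c1 f))); last by lin.
  apply: eq_tlift => w u.
  rewrite (lin_tliftE (f := double_dact (shiftr c1 f))); last by lin.
  by apply: eq_tlift => c2 d; rewrite double_dact_pure.
pose L c1 c2 d b1 b2 b : D :=
  convol (shiftl (b * S' b2) (shiftr c1 f)) (shiftl (S' b1) (shiftr c2 g)) ⊠ (d * y).
transitivity (\sw_(a, b <- x) \sw_(a', b' <- a) \sw_(c, d <- a')
    \sw_(b1, b2 <- b') \sw_(c1, c2 <- c) L c1 c2 d b1 b2 b).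
  apply: eq_tlift => a b; rewrite double_dact_pure double_act_pure.
  apply: eq_tlift => a' b'; apply: eq_tlift => c d.
  rewrite shift_convol (lin_tliftE (f := fun h => h ⊠ (d * y))); last by lin.
  apply: eq_tlift => b1 b2; rewrite (lin_tliftE (f := fun h => h ⊠ (d * y))); last by lin.
  by apply: eq_tlift => c1 c2; rewrite /L !shiftlr shiftl_mul.
rewrite (sw_coassoc (E := fun a' b' b => \sw_(c, d <- a')
    \sw_(b1, b2 <- b') \sw_(c1, c2 <- c) L c1 c2 d b1 b2 b)); rewrite /L; [|lin..].
apply: eq_tlift => a u; rewrite tlift_exch; apply: eq_tlift => c d.
transitivity (\sw_(b1, v <- u) \sw_(b2, b <- v) \sw_(c1, c2 <- c) L c1 c2 d b1 b2 b).
  by rewrite -(sw_coassoc (E := fun b1 b2 b => \sw_(c1, c2 <- c) L c1 c2 d b1 b2 b)) // /L; lin.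
transitivity (\sw_(b1, v <- u) counit v *: \sw_(c1, c2 <- c) K c1 c2 d b1).
  apply: eq_tlift => b1 v.
  pose M z : D := \sw_(c1, c2 <- c) (convol (shiftl z (shiftr c1 f)) (shiftl (S' b1) (shiftr c2 g)) ⊠ (d * y)).
  rewrite (sw_antipodeVr (E := M)); last by rewrite /M; lin.
  by congr (_ *: _); apply: eq_tlift => c1 c2; rewrite shiftl1.
by rewrite (sw_counitr (E := fun b1 => \sw_(c1, c2 <- c) K c1 c2 d b1)) // /K; lin.
Qed.

Definition double_module : hmodule H :=
  HModule double_act_bilin double_act1 double_actM.

Definition double_yd : ydmodule H :=
  @YDModule k H double_module double_dact double_dact_bilin double_dactM double_compat.

Lemma drinfeld_braidingE : @drinfeld_braiding k H =1 ydbraid (X := double_yd) (W := double_yd).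
Proof.
move=> t; apply: eq_tlift => v w.
have bb : bilin (fun s t : D => dmul t w ⊠ dmul s v).
  have lw := dmul_bilin.1 w; have lv := dmul_bilin.1 v.
  by split=> u; [apply: lin_purer|apply: lin_purel].
rewrite /Rmatrix (lin_sum (tlift_linear bb)).
by apply: eq_bigr => i _; rewrite (tlift_pure _ _ bb).
Qed.

End DoubleYD.

(** * The double is free on one generator *)
Section DoubleFree.
Variables (k : fieldType) (H : hopfAlgebra k).
Local Notation "\sw_ ( a , b <- x ) E" :=
  (tlift (fun a b : H => E) (comul x)) : ring_scope.
Local Notation S' := ((@antipode k H)^-1)%VF.
Local Notation D := (drinfeldDouble H).
Let lin_shr := @shiftr_bilin k H.
Let lin_shl := @shiftl_bilin k H.
Let lin_conv := @convol_bilin k H.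

Definition double_embed (x : H) : D := @pure k (dual H) H counit x.

Lemma double_embed_linear : linear double_embed.
Proof. exact: lin_pure_r. Qed.

Let lin_emb := double_embed_linear.

Lemma double_act_unit x : double_act x (double_embed 1) = double_embed x.
Proof.
rewrite double_act_pure.
transitivity (\sw_(a, b <- x) counit b *: double_embed a); last first.
  exact: (sw_counitr (E := fun a => double_embed a)).
apply: eq_tlift => a b.
rewrite -(@sw_counitl k H _ (fun d => counit b *: double_embed d) a); last (apply: lin_scaler; exact: lin_emb).
apply: eq_tlift => c d; rewrite mulr1.
have -> : shiftl (S' b) (shiftr c counit) = counit c *: (counit b *: (counit : dual H)).
  apply: dual_eq => z; rewrite shiftlE shiftrE !scale_lfunE !counitM counit_antipodeV.
  by rewrite mulrC.
by rewrite !(linZ (@lin_pure_l k (dual H) H d)).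
Qed.

Variable W : ydmodule H.
Let lin_dact := @dact_bilin k H W.

Definition double_to_yd (w : W) : D -> W := tlift (fun f x => dact f (act x w)).

Lemma double_to_yd_bilin (w : W) : bilin (fun (f : dual H) (x : H) => dact f (act x w)).
Proof. lin. Qed.

Lemma double_to_yd_linear w : linear (double_to_yd w).
Proof. exact: tlift_linear (double_to_yd_bilin w). Qed.

Lemma double_to_yd_pure w f x : double_to_yd w (f ⊠ x) = dact f (act x w).
Proof. exact: tlift_pure (double_to_yd_bilin w). Qed.

Lemma double_to_yd_dact w f t :
  double_to_yd w (double_dact f t) = dact f (double_to_yd w t).
Proof.
have lz := double_to_yd_linear w; have ld := @double_dact_bilin k H.
apply: (tensor_ext (f := fun t => double_to_yd w (double_dact f t))
  (g := fun t => dact f (double_to_yd w t))) => [||g y]; [by lin|by lin|].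
by rewrite double_dact_pure !double_to_yd_pure dactM.
Qed.

(** The compatibility condition, solved for x (g w).  The right-hand side is the
    formula for the product (eps ⋈ x)(g ⋈ 1) in D(H). *)
Lemma act_dact x g (w : W) : act x (dact g w) =
  \sw_(a, b <- x) \sw_(c, d <- a) dact (shiftl (S' b) (shiftr c g)) (act d w).
Proof.
transitivity (\sw_(a, b <- x) \sw_(c, d <- a) act c (dact (shiftl (S' b * d) g) w)); last first.
  apply: eq_tlift => a b.
  transitivity (\sw_(c, d <- a) act c (dact (shiftl d (shiftl (S' b) g)) w)).
    by apply: eq_tlift => c d; rewrite shiftl_mul.
  by rewrite yd_compat; apply: eq_tlift => c d; rewrite shiftlr.
rewrite (sw_coassoc (E := fun c d b => act c (dact (shiftl (S' b * d) g) w))); [|lin..].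
transitivity (\sw_(a, b <- x) counit b *: act a (dact g w)).
  by rewrite (sw_counitr (E := fun a => act a (dact g w))) //; lin.
apply: eq_tlift => a b.
rewrite (sw_antipodeVl (E := fun z => act a (dact (shiftl z g) w))) ?shiftl1 //; lin.
Qed.

Lemma double_to_yd_act w x t :
  double_to_yd w (double_act x t) = act x (double_to_yd w t).
Proof.
have lz := double_to_yd_linear w; have la := @double_act_bilin k H.
apply: (tensor_ext (f := fun t => double_to_yd w (double_act x t))
  (g := fun t => act x (double_to_yd w t))) => [||g y]; [by lin|by lin|].
rewrite double_act_pure double_to_yd_pure (lin_tliftE (f := double_to_yd w)) //.
rewrite act_dact; apply: eq_tlift => a b.
rewrite (lin_tliftE (f := double_to_yd w)) //; apply: eq_tlift => c d.
by rewrite double_to_yd_pure actM.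
Qed.

End DoubleFree.

(** * Braid group representations from Yang-Baxter operators *)
Section BraidRepresentation.
Variables (k : fieldType) (V : lmodType k).

Lemma braid_at_linear (c : V ⊗ V -> V ⊗ V) n i :
  linear c -> linear (@braid_at k V c n i).
Proof.
move=> lc; elim: n i => [|m IH] [|j] //=; last by have := IH j; lin.
by case: m IH => [|p] IH //=; lin.
Qed.

Lemma braid_atK (c c' : V ⊗ V -> V ⊗ V) n i :
  linear c -> linear c' -> cancel c c' ->
  cancel (@braid_at k V c n i) (@braid_at k V c' n i).
Proof.
move=> lc lc' cK; elim: n i => [|m IH] [|j] //=; last first.
  have l1 := @braid_at_linear c m j lc; have l2 := @braid_at_linear c' m j lc'.
  apply: (tensor_ext (f := fun t => tmap id (@braid_at k V c' m j) (tmap id (@braid_at k V c m j) t))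
    (g := id)) => [||v w]; [by lin|by []|].
  by rewrite !tmap_pure // IH.
case: m IH => [|p] IH //= t.
rewrite tassocK.
have -> : tmap c' id (tmap c id (tassocV t)) = tassocV t.
  apply: (tensor_ext (f := fun t => tmap c' id (tmap c id t)) (g := id)) => [||v w]; [by lin|by []|].
  by rewrite !tmap_pure // cK.
by rewrite tassocVK.
Qed.

Variable c : V ⊗ V -> V ⊗ V.
Hypothesis lc : linear c.

Lemma braid_at_far n i j (t : tpow V n) : (i.+1 < j)%N ->
  braid_at c i (braid_at c j t) = braid_at c j (braid_at c i t).
Proof.
elim: n i j t => [|m IH] [|i] [|j] //= t ij; last first.
  have l1 := @braid_at_linear c m i lc; have l2 := @braid_at_linear c m j lc.
  move: t; apply: tensor_ext => [||v w]; [by lin|by lin|].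
  by rewrite !tmap_pure // IH.
case: m IH t => [|p] IH //= t; case: j ij => [|j] //= _.
have l1 := @braid_at_linear c p j lc.
pose F t := tassoc (tmap c id (tassocV t)) : V ⊗ (V ⊗ tpow V p).
pose G (t : V ⊗ (V ⊗ tpow V p)) := tmap id (tmap id (@braid_at k V c p j)) t.
have lF : linear F by rewrite /F; lin.
have lG : linear G by rewrite /G; lin.
change (F (G t) = G (F t)).
move: t; apply: tensor3r_ext => [||u v w]; [by lin|by lin|].
have GE (u' v' : V) w' : G (u' ⊠ (v' ⊠ w')) = u' ⊠ (v' ⊠ braid_at c j w').
  by rewrite /G !tmap_pure //; lin.
have FE w' : F (u ⊠ (v ⊠ w')) = tassoc (c (u ⊠ v) ⊠ w').
  by rewrite /F tassocV_pure tmap_pure.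
rewrite GE !FE.
move: (c (u ⊠ v)); apply: tensor_ext => [||a b]; [by lin|by lin|].
by rewrite !tassoc_pure GE.
Qed.

Hypothesis yb : forall t : V ⊗ (V ⊗ V),
  let c12 t := tassoc (tmap c id (tassocV t)) in
  let c23 t := tmap id c t in
  c12 (c23 (c12 t)) = c23 (c12 (c23 t)).

Lemma braid_at_near n i (t : tpow V n) : (i.+2 < n)%N ->
  braid_at c i (braid_at c i.+1 (braid_at c i t)) =
  braid_at c i.+1 (braid_at c i (braid_at c i.+1 t)).
Proof.
elim: n i t => [|m IH] [|i] //= t im; last first.
  have l1 := @braid_at_linear c m i lc; have l2 := @braid_at_linear c m i.+1 lc.
  move: t; apply: tensor_ext => [||v w]; [by lin|by lin|].
  by rewrite !tmap_pure // IH.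
case: m IH t im => [|[|p]] //= _ t _.
pose X : lmodType k := tpow V p.
pose c12 (Y : lmodType k) t := tassoc (tmap c id (tassocV t)) : V ⊗ (V ⊗ Y).
have lc12 Y : linear (c12 Y) by rewrite /c12; lin.
pose R (s : (V ⊗ (V ⊗ V)) ⊗ X) := tmap id (@tassoc k V V X) (tassoc s).
have lta := @tassoc_linear k V V X.
have lR : linear R by rewrite /R; lin.
have lcV := lc12 V; have lcX := lc12 X; have lcVX := lc12 (V ⊗ X).
have R12 s : c12 (V ⊗ X) (R s) = R (tmap (c12 V) id s).
  move: s; apply: tensor_ext => [||u w]; [by lin|by lin|].
  rewrite tmap_pure //; move: u; apply: tensor3r_ext => [||u v v']; [by lin|by lin|].
  rewrite /R tassoc_pure tmap_pure // tassoc_pure /c12 !tassocV_pure !tmap_pure //.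
  move: (c (u ⊠ v)); apply: tensor_ext => [||a b]; [by lin|by lin|].
  by rewrite !tassoc_pure tmap_pure // tassoc_pure.
have R23 s : tmap id (c12 X) (R s) = R (tmap (tmap id c) id s).
  move: s; apply: tensor_ext => [||u w]; [by lin|by lin|].
  rewrite tmap_pure //; last by lin.
  move: u; apply: tensor3r_ext => [||u v v']; [by lin|by lin|].
  rewrite /R !tassoc_pure !tmap_pure // !tassoc_pure tmap_pure //.
  by rewrite /c12 tassocV_pure tmap_pure.
have [s ->] : exists s, t = R s.
  exists (tassocV (tmap id (@tassocV k V V X) t)); rewrite /R tassocVK.
  have ltaV := @tassocV_linear k V V X.
  move: t; apply: tensor_ext => [||u w]; [by []|by lin|].
  by rewrite !tmap_pure // tassocVK.
change (c12 (V ⊗ X) (tmap id (c12 X) (c12 (V ⊗ X) (R s))) =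
  tmap id (c12 X) (c12 (V ⊗ X) (tmap id (c12 X) (R s)))).
rewrite !(R12, R23); congr R.
have l23 : linear (tmap (@id V) c) by lin.
move: s; apply: tensor_ext => [||u w]; [by lin|by lin|].
rewrite !tmap_pure //; congr (_ ⊠ _); exact: yb.
Qed.

Variable c' : V ⊗ V -> V ⊗ V.
Hypotheses (lc' : linear c') (cK : cancel c c') (c'K : cancel c' c).
Variable n : nat.

Definition braid_letter (p : 'I_n.-1 * bool) : tpow V n -> tpow V n :=
  braid_at (if p.2 then c' else c) p.1.

Definition braid_word_act (s : braid_word n) (t : tpow V n) : tpow V n :=
  foldr braid_letter t s.

Lemma braid_word_act_eq s t : braid_eq s t -> braid_word_act s =1 braid_word_act t.
Proof.
elim=> {s t} [s|s t _ IH|s t u _ IH1 _ IH2|s t s' t' _ IH1 _ IH2|i b|i j ij|i j ij] v //.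
- by rewrite IH1.
- by rewrite /braid_word_act !foldr_cat -!/(braid_word_act _ _) IH2 IH1.
- by rewrite /braid_word_act /= /braid_letter /=; case: b => /=; rewrite braid_atK.
- exact: braid_at_far.
- rewrite /braid_word_act /= /braid_letter /= ij; apply: braid_at_near.
  by rewrite -ij -ltn_predRL.
Qed.

Lemma braid_representation_exists :
  exists r : representation (braid n) (tpow V n),
    forall (i : 'I_n.-1) t, r (sigma i) t = braid_at c i t.
Proof.
have lw s : linear (braid_word_act s).
  elim: s => [|p s IH] a x y //=; rewrite IH /braid_letter.
  by case: p.2; apply: braid_at_linear.
have w1 v : braid_word_act (repr (1%g : braid n)) v = v.
  by rewrite (braid_word_act_eq (braid_reprP _)).
have wM (g h : braid n) v :
    braid_word_act (repr (g * h)%g) v = braid_word_act (repr g) (braid_word_act (repr h) v).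
  by rewrite (braid_word_act_eq (braid_reprP _)) /braid_word_act foldr_cat.
exists (Representation (rho := fun g : braid n => braid_word_act (repr g)) (fun g => lw _) w1 wM).
by move=> i t /=; rewrite (braid_word_act_eq (braid_reprP _)).
Qed.

End BraidRepresentation.

(** * Finite-dimensional spaces *)
Lemma inj_surj_bijective (T U : Type) (f : T -> U) :
  injective f -> (forall u, exists t, f t = u) -> bijective f.
Proof.
move=> fI /choice[g gK]; exists g => // t; exact: fI.
Qed.

Section FiniteDimension.
Variable k : fieldType.

(** Carriers of modules are arbitrary spaces, without a chosen basis; an
    embedding in a coordinate space is the weakest form of finiteness and is
    inherited by subspaces at once. *)
Definition fdim (V : lmodType k) : Prop :=
  exists (d : nat) (f : V -> 'rV[k]_d), linear f /\ injective f.

Lemma linfun_lin (V W : vectType k) (f : V -> W) : linear f -> linfun f =1 f.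
Proof.
move=> lf x.
pose F := HB.pack_for {linear V -> W} f (GRing.isLinear.Build _ _ _ _ f lf).
exact: (lfunE F).
Qed.

Lemma fdim_vect (V : vectType k) : fdim V.
Proof.
exists (\dim {:V}), (fun v => \row_i coord (vbasis {:V}) i v); split.
  by move=> a u v; apply/rowP => i; rewrite !mxE linearP.
move=> u v /rowP e; rewrite (coord_vbasis (memvf u)) (coord_vbasis (memvf v)).
by apply: eq_bigr => i _; have := e i; rewrite !mxE => ->.
Qed.

Lemma fdim_inj (V W : lmodType k) (f : V -> W) :
  linear f -> injective f -> fdim W -> fdim V.
Proof.
move=> lf fI [d [g [lg gI]]]; exists d, (g \o f); split; first exact: lin_comp.
exact: inj_comp.
Qed.

Lemma can_lin (V W : lmodType k) (f : V -> W) (g : W -> V) :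
  linear f -> cancel f g -> cancel g f -> linear g.
Proof. by move=> lf fK gK a x y; apply: (can_inj fK); rewrite lf !gK. Qed.

Lemma max_vspace (V : vectType k) (P : {vspace V} -> Prop) U0 : P U0 ->
  exists2 U, P U & forall W, P W -> (\dim W <= \dim U)%N.
Proof.
move=> PU0; pose Q n := `[< exists2 U, P U & \dim U = n >].
have exQ : exists n, Q n by exists (\dim U0); apply/asboolP; exists U0.
have leQ n : Q n -> (n <= \dim {:V})%N.
  by move=> /asboolP[U _ <-]; apply: dimvS; exact: subvf.
case: (ex_maxnP exQ leQ) => n /asboolP[U PU <-] mx; exists U => // W PW.
by apply: mx; apply/asboolP; exists W.
Qed.

Lemma min_vspace (V : vectType k) (P : {vspace V} -> Prop) U0 : P U0 ->
  exists2 U, P U & forall W, P W -> (\dim U <= \dim W)%N.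
Proof.
move=> PU0; pose Q n := `[< exists2 U, P U & \dim U = n >].
have exQ : exists n, Q n by exists (\dim U0); apply/asboolP; exists U0.
case: (ex_minnP exQ) => n /asboolP[U PU <-] mn; exists U => // W PW.
by apply: mn; apply/asboolP; exists W.
Qed.

Lemma image_vspace (V : lmodType k) (W : vectType k) (f : V -> W) : linear f ->
  exists U : {vspace W}, forall w, w \in U <-> exists v, w = f v.
Proof.
move=> lf.
have [|U PU mx] := @max_vspace _ (fun U : {vspace W} =>
  forall u, u \in U -> exists v, u = f v) 0%VS.
  by move=> u; rewrite memv0 => /eqP ->; exists 0; rewrite (lin0 lf).
exists U => w; split=> [/PU //|[v ->]].
have le : (U <= U + <[f v]>)%VS by exact: addvSl.
have /mx hd : forall u, u \in (U + <[f v]>)%VS -> exists w, u = f w.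
  move=> u /memv_addP[x /PU[x' ->] [y /vlineP[a ->] ->]].
  by exists (x' + a *: v); rewrite (linD lf) (linZ lf).
have /eqP -> : U == (U + <[f v]>)%VS by rewrite eqEdim le hd.
by apply: (subvP (addvSr _ _)); exact: memv_line.
Qed.

Lemma separating_form (V : vectType k) (U : {vspace V}) x : x \notin U ->
  exists l : V -> k^o, [/\ linear l, forall u, u \in U -> l u = 0 & l x != 0].
Proof.
move=> xU.
have [i li] : exists i, coord (vbasis {:V}) i (x - projv U x) != 0.
  apply: contrapT => no; move/negP: xU; apply.
  have -> : x = projv U x; last exact: memv_proj.
  apply/eqP; rewrite -subr_eq0 [_ - _](coord_vbasis (memvf _)) big1 // => i _.
  have [->|n0] := eqVneq (coord (vbasis {:V}) i (x - projv U x)) 0.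
    by rewrite scale0r.
  by case: no; exists i.
exists (fun y => coord (vbasis {:V}) i (y - projv U y)); split=> // [a u v|u uU].
  by rewrite linearP opprD addrACA -scalerN -scalerDr linearP.
by rewrite projv_id // subrr linear0.
Qed.

Lemma fdim_basis (V : lmodType k) : fdim V ->
  exists (d : nat) (f : V -> 'rV[k]_d), linear f /\ bijective f.
Proof.
move=> [d [f [lf fI]]]; have [U UP] := image_vspace lf.
have fU v : f v \in U by apply/UP; exists v.
have PU u : u \in U -> exists v, u = f v by move/UP.
exists (\dim U), (fun v => \row_i coord (vbasis U) i (f v)).
have lg : linear (fun v => \row_i coord (vbasis U) i (f v)).
  by move=> a u v; apply/rowP => i; rewrite !mxE lf linearP.
split=> //.
have PU' i : exists v, (vbasis U)`_i = f v.
  have [iU|iU] := ltnP i (\dim U); first by apply/PU/vbasis_mem/mem_nth; rewrite size_tuple.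
  by exists 0; rewrite (lin0 lf) nth_default // size_tuple.
have [b bE] := choice PU'.
exists (fun r : 'rV[k]_(\dim U) => \sum_i r 0 i *: b i) => [v|r].
  apply: fI; rewrite (lin_sum lf) [RHS](coord_vbasis (fU v)).
  by apply: eq_bigr => i _; rewrite (linZ lf) -bE mxE.
apply/rowP => i; rewrite mxE (lin_sum lf).
under eq_bigr do rewrite (linZ lf) -bE.
by rewrite coord_sum_free // (basis_free (vbasisP U)).
Qed.

Lemma vect_iso_dim (V W : vectType k) (f : V -> W) :
  linear f -> bijective f -> \dim {:V} = \dim {:W}.
Proof.
have le (V' W' : vectType k) (g : V' -> W') :
    linear g -> injective g -> (\dim {:V'} <= \dim {:W'})%N.
  move=> lg gI; have gE := linfun_lin lg.
  have k0 : (fullv :&: lker (linfun g) = 0)%VS.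
    apply/eqP; rewrite -subv0; apply/subvP => z.
    rewrite memv_cap memv_ker memv0 gE => /andP[_ /eqP e0].
    by apply/eqP/gI; rewrite e0 (lin0 lg).
  by rewrite -(limg_dim_eq k0); exact: dimvS (subvf _).
move=> lf [g fK gK]; apply/eqP; rewrite eqn_leq (le _ _ f lf (can_inj fK)).
exact: (le _ _ g (can_lin lf fK gK) (can_inj gK)).
Qed.

Lemma tensor_iso (V W : lmodType k) d e (f : V -> 'rV[k]_d) (g : W -> 'rV[k]_e) :
  linear f -> bijective f -> linear g -> bijective g ->
  exists2 h : V ⊗ W -> 'M[k]_(d, e), linear h & bijective h.
Proof.
move=> lf [f' fK f'K] lg [g' gK g'K].
have lf' := can_lin lf fK f'K; have lg' := can_lin lg gK g'K.
have bb : bilin (fun v w => (f v)^T *m g w).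
  split=> [w|v] a x y; first by rewrite lf linearP mulmxDl scalemxAl.
  by rewrite lg linearP.
pose h := tlift (fun v w => (f v)^T *m g w); have lh : linear h := tlift_linear bb.
pose h' (M : 'M[k]_(d, e)) : V ⊗ W :=
  \sum_i \sum_j M i j *: (f' (delta_mx 0 i) ⊠ g' (delta_mx 0 j)).
have lh' : linear h'.
  apply: lin_bigsum => i; apply: lin_bigsum => j; apply: lin_scalel => a x y.
  by rewrite !mxE.
exists h => //; exists h' => [t|M].
  move: t; apply: (tensor_ext (f := fun t => h' (h t)) (g := id)) => [||v w]; [exact: lin_comp|by []|].
  rewrite /h (tlift_pure _ _ bb) /h'.
  rewrite -{2}[v]fK -{2}[w]gK [f v]row_sum_delta [g w]row_sum_delta.
  rewrite (lin_sum lf') (lin_sum lg') (lin_sum (lin_pure_l _)).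
  apply: eq_bigr => i _; rewrite (lin_sum (lin_pure_r _)); apply: eq_bigr => j _.
  rewrite (linZ lf') (linZ lg') (linZ (lin_pure_l _)) (linZ (lin_pure_r _)) scalerA.
  by congr (_ *: _); rewrite !mxE big_ord1 mxE -!row_sum_delta.
rewrite [RHS]matrix_sum_delta /h' (lin_sum lh); apply: eq_bigr => i _.
rewrite (lin_sum lh); apply: eq_bigr => j _; rewrite (linZ lh) /h (tlift_pure _ _ bb).
by rewrite f'K g'K trmx_delta mul_delta_mx.
Qed.

(** The bijection t stands for the equality of the dimensions of V and W. *)
Lemma fdim_inj_surj (V W : lmodType k) (t f : V -> W) :
  fdim W -> linear t -> bijective t -> linear f ->
  injective f <-> (forall w, exists v, f v = w).
Proof.
move=> /fdim_basis[d [g [lg [g' gK g'K]]]] lt [t' tK t'K] lf.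
have lg' := can_lin lg gK g'K; have lt' := can_lin lt tK t'K.
pose h := g \o (f \o (t' \o g')).
have lh : linear h.
  by apply: lin_comp => //; apply: lin_comp => //; apply: lin_comp.
have hE := linfun_lin lh.
split=> [fI w|fS u v e].
  have k0 : lker (linfun h) == 0%VS.
    rewrite -subv0; apply/subvP => z; rewrite memv_ker memv0 hE => /eqP e0.
    apply/eqP; apply: (can_inj g'K); apply: (can_inj t'K); apply: fI.
    by apply: (can_inj gK); rewrite -[LHS]/(h z) e0 (lin0 lg') (lin0 lt') (lin0 lf) (lin0 lg).
  have /memv_imgP[z _] : g w \in limg (linfun h) by rewrite (lker0_limgf k0) memvf.
  by rewrite hE => /(can_inj gK) ->; exists (t' (g' z)).
have im : limg (linfun h) = fullv.
  apply/eqP; rewrite eqEsubv subvf; apply/subvP => z _.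
  have [v' e'] := fS (g' z); apply/memv_imgP; exists (g (t v')); rewrite ?memvf //.
  by rewrite hE /h /= gK tK e' g'K.
have /eqP := limg_ker_dim (linfun h) fullv; rewrite im capfv -[X in _ == X]add0n eqn_add2r dimv_eq0.
move=> /eqP k0.
have : g (t (u - v)) \in lker (linfun h).
  by rewrite memv_ker hE /h /= gK tK (linD lf) -scaleN1r (linZ lf) e scaleN1r subrr (lin0 lg).
rewrite k0 memv0 -(lin0 lg) (can_eq gK) -(lin0 lt) (can_eq tK).
by rewrite subr_eq0 => /eqP.
Qed.

End FiniteDimension.

(** * A criterion for a module to be free of rank one *)
Section RegularGenerator.
Variables (k : fieldType) (A : falgType k).
Implicit Types (a b e u : A).

Lemma amulrE u v : amulr u v = v * u.
Proof. by rewrite lfunE. Qed.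

Lemma regmod_subproof : bilin (fun a b : A => a * b).
Proof. lin. Qed.

Definition regmod : hmodule A :=
  @HModule k A A (fun a b => a * b) regmod_subproof (@mul1r A) (fun x y m => esym (mulrA x y m)).

Lemma orbit_subproof (M : hmodule A) (m : M) : @is_hmap k A regmod M (fun a => act a m).
Proof. by split=> [|x a] /=; [lin|rewrite actM]. Qed.
Definition orbit_map (M : hmodule A) (m : M) : hmap regmod M := mkhmap (orbit_subproof m).

Lemma orbit_mapE (M : hmodule A) (f : hmap regmod M) a : hfun f a = act a (hfun f 1).
Proof. by rewrite -(hmap_act f a (1 : A)) /= mulr1. Qed.

Definition lideal u : {vspace A} := limg (amulr u).

Lemma lidealP u x : reflect (exists a, x = a * u) (x \in lideal u).
Proof.
apply: (iffP idP) => [/memv_imgP[a _ ->]|[a ->]]; first by exists a; rewrite amulrE.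
by rewrite -amulrE memv_img ?memvf.
Qed.

(** Fitting's lemma for right multiplication by u: on the stable image A u^N it
    is invertible, and g is the unit of the corresponding corner algebra, in
    which w is the inverse of u. *)
Lemma fitting_idempotent u : (forall n, u ^+ n != 0) ->
  exists w g, [/\ g != 0, g * g = g, u * w = g, w * g = w
    & forall e, e * u = 0 -> u * e = 0 -> e * g = 0 /\ g * e = 0 /\ w * e = 0].
Proof.
move=> un0.
(* v is a power of u for which the left ideal A v = A v^2 is smallest *)
pose P (U : {vspace A}) := exists n, U = lideal (u ^+ n.+1).
have [_ [N ->] mn] := min_vspace (P := P) (ex_intro _ 0%N erefl).
pose v := u ^+ N.+1.
have dimv2 : (\dim (lideal v) <= \dim (lideal (v * v)%R))%N.
  by apply: mn; exists (N + N.+1)%N; rewrite /v -exprD addSn.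
have imE : (amulr v @: lideal v)%VS = lideal (v * v).
  by rewrite /lideal -limg_comp; congr (_ @: _)%VS; apply/lfunP => x; rewrite lfunE /= !amulrE mulrA.
have kv0 : (lideal v :&: lker (amulr v) = 0)%VS.
  apply/eqP; rewrite -dimv_eq0; have := limg_ker_dim (amulr v) (lideal v).
  rewrite imE => e; move: dimv2; rewrite -e -{2}[\dim (lideal _)]add0n leq_add2r leqn0.
  by [].
have canc x : x \in lideal v -> x * v = 0 -> x = 0.
  move=> xv xv0; apply/eqP; rewrite -memv0 -kv0 memv_cap xv memv_ker amulrE.
  exact/eqP.
have canc2 x y : x \in lideal v -> y \in lideal v -> x * v = y * v -> x = y.
  move=> xv yv e; apply/eqP; rewrite -subr_eq0; apply/eqP/canc; first exact: rpredB.
  by rewrite mulrBl e subrr.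
have eqI : lideal (v * v) = lideal v.
  apply/eqP; rewrite eqEdim dimv2 andbT; apply/subvP => x /lidealP[a ->].
  by apply/lidealP; exists (a * v); rewrite mulrA.
have [c gE] : exists c, v = c * v * v.
  have /lidealP[c cE] : v \in lideal (v * v).
    by rewrite eqI; apply/lidealP; exists 1; rewrite mul1r.
  by exists c; rewrite -mulrA.
pose g := c * v; have gv : g * v = v by rewrite /g -gE.
have vI x : x * v \in lideal v by apply/lidealP; exists x.
have gI x : x * g \in lideal v by rewrite /g mulrA.
have gg : g * g = g by apply: canc2; rewrite ?gI ?vI // -mulrA gv.
have vg : v * g = v.
  apply: canc2; [exact: gI | by have := vI 1; rewrite mul1r | by rewrite -mulrA gv].
pose c' := g * c * g.
have c'v : c' * v = g by rewrite /c' -mulrA gv -mulrA -/g gg.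
have vc' : v * c' = g.
  have gI1 : g \in lideal v by have := gI 1; rewrite mul1r.
  apply: canc2 => //; first by rewrite /c' mulrA; exact: gI.
  by rewrite -mulrA c'v gv vg.
exists (u ^+ N * c'), g; split=> //.
- by apply: contraNneq (un0 N.+1) => g0; rewrite -/v -gv g0 mul0r.
- by rewrite mulrA -exprS.
- by rewrite -mulrA /c' -(mulrA (g * c) g g) gg.
move=> e eu ue.
have g_e : g * e = 0 by rewrite -c'v /v exprSr -!mulrA ue !mulr0.
split; first by rewrite -vc' /v exprS !mulrA eu !mul0r.
by split=> //; rewrite -mulrA /c' -(mulrA (g * c)) g_e !mulr0.
Qed.

(** The quotient A / I is carried by the image of a projection with kernel I. *)
Section Quotient.
Variables (I : {vspace A}) (idI : forall a x, x \in I -> a * x \in I).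

Let p : 'End(A) := (\1 - projv I)%VF.

Lemma quot_projE x : p x = x - projv I x.
Proof. by rewrite /p add_lfunE opp_lfunE id_lfunE. Qed.

Lemma quot_proj_eq0 x : (p x == 0) = (x \in I).
Proof.
rewrite quot_projE subr_eq0; apply/eqP/idP => [->|xI]; first exact: memv_proj.
by rewrite projv_id.
Qed.

Definition quot_pi (x : A) : subvs_of (limg p) := vsproj (limg p) (p x).

Lemma quot_pi_linear : linear quot_pi.
Proof. by move=> a u v; rewrite /quot_pi !linearP. Qed.

Lemma quot_pi_eq0 x : (quot_pi x == 0) = (x \in I).
Proof.
rewrite -quot_proj_eq0 -(inj_eq (@subvs_inj _ _ _)) vsprojK ?memv_img ?memvf //.
Qed.

Lemma quot_pi_eq x y : x - y \in I -> quot_pi x = quot_pi y.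
Proof.
rewrite -quot_pi_eq0 (linD quot_pi_linear) -scaleN1r (linZ quot_pi_linear) scaleN1r subr_eq0.
exact: eqP.
Qed.

Lemma quot_pi_surj z : exists x, z = quot_pi x.
Proof.
have /memv_imgP[x _ e] := subvsP z; exists x.
by apply: subvs_inj; rewrite e /quot_pi vsprojK ?memv_img ?memvf.
Qed.

Definition quot_act (a : A) (z : subvs_of (limg p)) : subvs_of (limg p) :=
  quot_pi (a * vsval z).

Lemma quot_actE a x : quot_act a (quot_pi x) = quot_pi (a * x).
Proof.
rewrite /quot_act vsprojK ?memv_img ?memvf // quot_projE; apply: quot_pi_eq.
by rewrite mulrBr addrAC subrr add0r -mulrN idI // rpredN memv_proj.
Qed.

Lemma quot_act_bilin : bilin quot_act.
Proof.
split=> [z|x] a u v; rewrite /quot_act -quot_pi_linear; congr quot_pi.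
  by rewrite mulrDl scalerAl.
by rewrite linearP mulrDr -scalerAr.
Qed.

Lemma quot_act1 z : quot_act 1 z = z.
Proof. by have [x ->] := quot_pi_surj z; rewrite quot_actE mul1r. Qed.

Lemma quot_actM a b z : quot_act (a * b) z = quot_act a (quot_act b z).
Proof. by have [x ->] := quot_pi_surj z; rewrite !quot_actE mulrA. Qed.

Definition quotmod : hmodule A := HModule quot_act_bilin quot_act1 quot_actM.

End Quotient.

Section Generator.
Variables (M : hmodule A) (m : nat) (psi : 'I_m -> hmap M regmod) (y : 'I_m -> M).
Hypothesis dual_basisP : forall x : M, x = \sum_j act (hfun (psi j) x) (y j).
Hypothesis Hom_dim : forall Z : hmodule A, fdim Z ->
  exists t : hmap M Z -> Z, linear t /\ bijective t.

(** Hom(M, Z) and Z have the same dimension. *)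
Lemma eval_inj_surj (Z : hmodule A) (x : M) : fdim Z ->
  injective (fun f : hmap M Z => hfun f x) <->
  forall z, exists f : hmap M Z, hfun f x = z.
Proof.
move=> fZ; have [t [lt bt]] := Hom_dim fZ.
by apply: (fdim_inj_surj fZ lt bt).
Qed.

(** The map a |-> a m0 identifies A e with a direct summand of M: f is
    inverse to it on A m0.  As e = f m0 and f m0 e = f m0, such an e is
    idempotent. *)
Definition partial_generator e := exists (m0 : M) (f : hmap M regmod),
  [/\ hfun f m0 = e, act e m0 = m0 & forall x, hfun f x * e = hfun f x].

Lemma exists_maximal_lideal e : 1 \notin lideal e ->
  exists I : {vspace A}, [/\ forall a x, x \in I -> a * x \in I, e \in I, 1 \notin I
   & forall x, x \notin I -> exists a, 1 - a * x \in I].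
Proof.
move=> e1.
pose P (I : {vspace A}) := [/\ forall a x, x \in I -> a * x \in I, e \in I & 1 \notin I].
have PI0 : P (lideal e).
  split=> // [a x /lidealP[b ->]|]; apply/lidealP; first by exists (a * b); rewrite mulrA.
  by exists 1; rewrite mul1r.
have [I [idI eI oI] mx] := max_vspace PI0; exists I; split=> // x xI.
apply: contrapT => no.
have le : (I <= I + lideal x)%VS by exact: addvSl.
have /mx : P (I + lideal x)%VS.
  split.
  - move=> a z /memv_addP[u uI [w /lidealP[b ->] ->]]; rewrite mulrDr mulrA.
    by apply: memv_add; [exact: idI | apply/lidealP; exists (a * b)].
  - exact: subvP le _ eI.
  - apply/negP => /memv_addP[u uI [w /lidealP[b ->] e0]]; apply: no; exists b.
    by rewrite e0 addrK.
move=> hd; have /eqP e0 : I == (I + lideal x)%VS by rewrite eqEdim le hd.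
move/negP: xI; apply; rewrite e0; apply: (subvP (addvSr _ _)).
by apply/lidealP; exists 1; rewrite mul1r.
Qed.

(** If e is not 1, let Z be a simple quotient of A that kills e.  Evaluation at
    m0 has its values in e Z, so it is not onto Z; by equality of dimensions
    some nonzero h : M -> Z kills m0.  As M is projective, h and A -> Z lift to
    maps between A (1 - e) and the complement of A m0 in M whose composite u is
    not nilpotent.  The idempotent g that Fitting's lemma attaches to u is
    orthogonal to e, and e + g is realised in the same way as e. *)
Lemma partial_generator_step e : partial_generator e -> e != 1 ->
  exists2 e', partial_generator e' & (\dim (lideal e) < \dim (lideal e'))%N.
Proof.
move=> [m0 [f [fm0 em0 fe]]] ne1.
have ee : e * e = e by rewrite -{1}fm0 fe fm0.
have o1 : 1 \notin lideal e.
  apply/negP => /lidealP[a a1]; case/eqP: ne1.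
  by rewrite -[LHS]mul1r a1 -mulrA ee.
have [I [idI eI oI simI]] := exists_maximal_lideal o1.
pose Z := quotmod idI; pose z0 : Z := quot_pi I 1.
have piE a : quot_pi I a = act (h := Z) a z0 by rewrite /= quot_actE ?mulr1.
have fZ : fdim Z by exact: fdim_vect.
have z0n0 : z0 <> 0 by apply/eqP; rewrite quot_pi_eq0.
have ez0 : act e z0 = 0 by rewrite -piE; apply/eqP; rewrite quot_pi_eq0.
have lZ a := (act_bilin Z).2 a.
(* evaluation at m0 takes values in e Z, which does not contain z0 *)
have [h [hn0 hm0]] : exists h : hmap M Z, h <> 0 /\ hfun h m0 = 0.
  apply: contrapT => no; apply: z0n0.
  have /(eval_inj_surj m0 fZ)/(_ z0)[h hz0] : injective (fun h : hmap M Z => hfun h m0).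
    move=> h1 h2 e12; apply: contrapT => /eqP n12; apply: no; exists (h1 - h2); split.
      by apply/eqP; rewrite subr_eq0.
    by rewrite (hmapD h1) -scaleN1r hmapZ e12 scaleN1r subrr.
  by rewrite -hz0 -em0 hmap_act hz0.
have [x hx] : exists x, hfun h x = z0.
  have [x hx] : exists x, hfun h x <> 0.
    by apply: contrapT => no; apply: hn0; apply: hmap_eq => x; apply: contrapT => hx; apply: no; exists x.
  have [a ha] := quot_pi_surj (hfun h x).
  have [b bI] : exists b, 1 - b * a \in I.
    by apply: simI; apply/negP => aI; apply: hx; rewrite ha; apply/eqP; rewrite quot_pi_eq0.
  exists (act b x); rewrite hmap_act ha [act _ _](quot_actE idI); apply/esym.
  exact: quot_pi_eq.
(* r is the projection of M onto the complement of A m0 *)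
pose r (x : M) := x - act (hfun f x) m0.
have lr : linear r by rewrite /r; have l := hmap_lin f; lin.
have lf := hmap_lin f; have lh := hmap_lin h.
have fr x' : hfun f (r x') = 0.
  by rewrite /r (linD lf) -scaleN1r (linZ lf) scaleN1r hmap_act fm0 /= fe subrr.
have hr x' : hfun h (r x') = hfun h x'.
  by rewrite /r (linD lh) -scaleN1r (linZ lh) scaleN1r hmap_act hm0 (lin0 (lZ _)) subr0.
have ra a x' : r (act a x') = act a (r x').
  rewrite /r (linD ((act_bilin M).2 a)) hmap_act /= actM.
  by rewrite -[X in _ = _ + act a X]scaleN1r (linZ ((act_bilin M).2 a)) scaleN1r.
have rm0 : r m0 = 0 by rewrite /r fm0 em0 subrr.
pose m1 := act (1 - e) (r x).
have em1 : act e m1 = 0.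
  by rewrite /m1 -actM mulrBr mulr1 ee subrr (lin0 ((act_bilin M).1 _)).
have fm1 : hfun f m1 = 0 by rewrite /m1 hmap_act fr /= mulr0.
have hm1 : hfun h m1 = z0.
  rewrite /m1 hmap_act hr hx (linD ((act_bilin Z).1 z0)) act1 -scaleN1r.
  by rewrite (linZ ((act_bilin Z).1 z0)) ez0 scaler0 addr0.
clearbody m1.
have /choice[c cE] : forall j, exists a, act (h := Z) a z0 = hfun h (y j).
  by move=> j; have [a ha] := quot_pi_surj (hfun h (y j)); exists a; rewrite ha piE.
(* a lift of h to A, cut down so that it kills m0 and has values in A (1 - e) *)
pose s (x : M) : A := (\sum_j hfun (psi j) (r x) * c j) * (1 - e).
have ls : linear s.
  apply: lin_mull; apply: lin_bigsum => j; apply: lin_mull.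
  exact: (lin_comp (hmap_lin (psi j)) lr).
have sP : @is_hmap k A M regmod s.
  split=> [|a x']; first exact: ls.
  rewrite /s ra /= mulrA mulr_sumr; congr (_ * _); apply: eq_bigr => j _.
  by rewrite hmap_act /= mulrA.
pose g1 := mkhmap sP.
have g1m0 : hfun g1 m0 = 0.
  by rewrite /= /s rm0 big1 ?mul0r // => j _; rewrite (lin0 (hmap_lin _)) mul0r.
have g1e x' : hfun g1 x' * e = 0 by rewrite /= /s -mulrA mulrBl mul1r ee subrr mulr0.
have g1z x' : act (h := Z) (hfun g1 x') z0 = hfun h x'.
  rewrite -[LHS]/(act (h := Z) (s x') z0) /s actM.
  rewrite -[RHS]hr [in RHS](dual_basisP (r x')) (lin_sum lh).
  rewrite (linD ((act_bilin Z).1 z0)) act1 -scaleN1r.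
  rewrite (linZ ((act_bilin Z).1 z0)) ez0 scaler0 addr0 (lin_sum ((act_bilin Z).1 z0)).
  by apply: eq_bigr => j _; rewrite actM cE -hmap_act.
clearbody g1.
pose u : A := hfun g1 m1.
have uz : act (h := Z) u z0 = z0 by rewrite g1z hm1.
have un0 n : u ^+ n != 0.
  apply/eqP => un0; apply: z0n0; rewrite -(lin0 ((act_bilin Z).1 z0)) -un0.
  by elim: n {un0} => [|n IH]; rewrite ?expr0 ?act1 // exprS actM -IH uz.
have [w [g [gn0 gg uw wg gP]]] := fitting_idempotent un0.
have eu : e * u = 0.
  by rewrite -[e * u](hmap_act g1) em1 (lin0 (hmap_lin g1)).
have ue : u * e = 0 by exact: g1e.
have [eg [ge we]] := gP _ eu ue.
have gm0 : act g m0 = 0 by rewrite -em0 -actM ge (lin0 ((act_bilin M).1 _)).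
have s2P : @is_hmap k A M regmod (fun x => hfun f x + hfun g1 x * w).
  split=> [|a x'].
    by apply: lin_add; [exact: hmap_lin | apply: lin_mull; exact: (hmap_lin g1)].
  rewrite (hmap_act f) (hmap_act g1).
  by rewrite -[RHS]/(a * (hfun f x' + hfun g1 x' * w)) mulrDr mulrA.
pose f2 := mkhmap s2P.
have f2E x' : hfun f2 x' = hfun f x' + hfun g1 x' * w by [].
clearbody f2.
exists (e + g).
  exists (m0 + act g m1), f2; split.
  - rewrite f2E (linD lf) fm0 (hmap_act f) fm1 (linD (hmap_lin g1)) g1m0 (hmap_act g1).
    by rewrite (lin0 ((act_bilin regmod).2 g)) addr0 add0r -[act g _]/(g * u) -mulrA uw gg.
  - rewrite (linD ((act_bilin M).1 _)) !(linD ((act_bilin M).2 _)) em0 -!actM eg gg gm0.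
    by rewrite (lin0 ((act_bilin M).1 _)) addr0 add0r.
  - move=> x'; rewrite f2E mulrDl !mulrDr fe -mulrA we mulr0 add0r -(mulrA _ w) wg.
    by rewrite -{2}(fe x') -mulrA eg mulr0 addr0.
have e'e : (e + g) * e = e by rewrite mulrDl ee ge addr0.
have ee' : e * (e + g) = e by rewrite mulrDr ee eg addr0.
rewrite ltn_neqAle dimvS ?andbT; last first.
  by apply/subvP => a /lidealP[b ->]; apply/lidealP; exists (b * e); rewrite -mulrA ee'.
apply/negP => /eqP ed.
have /eqP E : lideal e == lideal (e + g).
  rewrite eqEdim ed leqnn andbT.
  by apply/subvP => a /lidealP[b ->]; apply/lidealP; exists (b * e); rewrite -mulrA ee'.
have /lidealP[b bE] : e + g \in lideal e by rewrite E; apply/lidealP; exists 1; rewrite mul1r.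
have : (e + g) * e = e + g by rewrite bE -mulrA ee.
by rewrite e'e -{1}[e]addr0 => /addrI/esym/eqP; rewrite (negPf gn0).
Qed.

(** For e of maximal rank the step lemma gives e = 1, so that M = A m0 ⊕ M'.
    Evaluation at m0 is then onto, hence injective, on Hom(M, A), so a map that
    vanishes at m0 is zero.  The coordinates psi, composed with the projection
    to M', are such maps, and they separate the points of M'; so M' is zero. *)
Lemma regular_generator : exists e : M, bijective (fun a => act a e).
Proof.
have pg0 : partial_generator 0.
  exists 0, 0; split=> //; first by rewrite (lin0 ((act_bilin M).1 _)).
  by move=> x; rewrite mulr0.
pose P (U : {vspace A}) := exists2 e, partial_generator e & U = lideal e.
have [U [e pe ->] mx] := max_vspace (P := P) (ex_intro2 _ _ 0 pg0 erefl).
have e1 : e = 1.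
  apply/eqP/negPn/negP => ne1; have [e' pe' lt] := partial_generator_step pe ne1.
  have /mx : P (lideal e') by exists e'.
  by rewrite leqNgt lt.
case: pe => [m0 [f [fm0 _ _]]]; rewrite e1 in fm0.
have fK : cancel (fun a => act a m0) (hfun f).
  by move=> a; rewrite hmap_act fm0 /= mulr1.
exists m0; exists (hfun f) => // x.
have fA : fdim regmod by exact: fdim_vect.
have surj : forall z : regmod, exists h : hmap M regmod, hfun h m0 = z.
  move=> z; exists (hmap_comp (orbit_map z) f); rewrite /= fm0; exact: mul1r.
have inj := (eval_inj_surj m0 fA).2 surj.
pose r (x : M) := x - act (hfun f x) m0.
have rP : is_hmap r.
  split=> [|a x']; first by rewrite /r; have l := hmap_lin f; lin.
  rewrite /r hmap_act /= actM (linD ((act_bilin M).2 a)).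
  by rewrite -[X in _ = _ + act a X]scaleN1r (linZ ((act_bilin M).2 a)) scaleN1r.
have r0 : r x = 0.
  rewrite (dual_basisP (r x)) big1 // => j _.
  have -> : hfun (psi j) (r x) = hfun (hmap_comp (psi j) (mkhmap rP)) x by [].
  rewrite (inj (hmap_comp (psi j) (mkhmap rP)) 0).
    by rewrite (lin0 ((act_bilin M).1 _)).
  rewrite /= /r fm0 act1 subrr; exact: (lin0 (hmap_lin (psi j))).
by apply/esym/eqP; rewrite -subr_eq0; apply/eqP.
Qed.

End Generator.
End RegularGenerator.

(** * Transport along a linear equivalence *)
Section Equivalence.
Variables (k : fieldType) (C D : lincat k) (F : linfunctor C D).

Definition fully_faithful := forall X Y (g : mor (F X) (F Y)),
  exists2 f : mor X Y, fmap F f = g & forall f', fmap F f' = g -> f' = f.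

Definition essentially_surjective := forall Y : D,
  exists (X : C) (i : mor (F X) Y) (j : mor Y (F X)),
    i ∘ j = idm Y /\ j ∘ i = idm (F X).

Lemma equivalence_esurj : is_equivalence F -> essentially_surjective.
Proof.
move=> [G [eta [eps [_ eps_iso _ _]]]] Y; have [j [ji ij]] := eps_iso Y.
by exists (G Y), (eps Y), j.
Qed.

Lemma equivalence_ff : is_equivalence F -> fully_faithful.
Proof.
move=> [G [eta [eps [eta_iso eps_iso eta_nat eps_nat]]]] X Y g.
have faith (C' D' : lincat k) (F' : linfunctor C' D') (G' : linfunctor D' C')
    (eta' : forall X : C', mor X (G' (F' X))) :
    (forall X, is_iso (eta' X)) ->
    (forall X X' (f : mor X X'), eta' X' ∘ f = fmap G' (fmap F' f) ∘ eta' X) ->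
    forall X Y (f f' : mor X Y), fmap F' f = fmap F' f' -> f = f'.
  move=> iso nat X' Y' f f' e; have [h [hK _]] := iso Y'.
  by rewrite -[f]cmp1f -hK -cmpA nat e -nat cmpA hK cmp1f.
have faithG X' Y' (f f' : mor X' Y') : fmap G f = fmap G f' -> f = f'.
  move=> e; have [h [_ hK]] := eps_iso X'.
  by rewrite -[f]cmpf1 -hK cmpA -eps_nat e eps_nat -cmpA hK cmpf1.
have [hX [hXK KhX]] := eta_iso X; have [hY [hYK KhY]] := eta_iso Y.
have E : fmap F (hY ∘ fmap G g ∘ eta X) = g.
  apply: faithG.
  have := eta_nat _ _ (hY ∘ fmap G g ∘ eta X).
  rewrite cmpA KhY cmp1f => /(congr1 (fun m => m ∘ hX)).
  by rewrite -!cmpA KhX !cmpf1.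
exists (hY ∘ fmap G g ∘ eta X) => // f' e.
by apply: (faith _ _ F G eta) => //; rewrite e E.
Qed.

End Equivalence.

Section Transport.
Variables (k : fieldType) (A B : falgType k).
Variable F : linfunctor (modlincat A) (modlincat B).
Hypotheses (ffF : fully_faithful F) (esF : essentially_surjective F).

Definition fo (X : hmodule A) : hmodule B := fob F X.
Definition fm (X Y : hmodule A) (f : hmap X Y) : hmap (fo X) (fo Y) :=
  @fmap k _ _ F X Y f.

Lemma fm_linear X Y : linear (@fm X Y).
Proof. exact (@fmap_linear k _ _ F X Y). Qed.

Lemma fm_id X x : hfun (fm (hmap_id X)) x = x.
Proof. by rewrite /fm (fmap1 F X). Qed.

Lemma fm_comp X Y Z (g : hmap Y Z) (f : hmap X Y) x :
  hfun (fm (hmap_comp g f)) x = hfun (fm g) (hfun (fm f) x).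
Proof. by rewrite /fm (fmap_cmp F g f). Qed.

Lemma fm_full X Y (g : hmap (fo X) (fo Y)) : exists f : hmap X Y, fm f = g.
Proof. by have [f e _] := ffF g; exists f. Qed.

Lemma fm_faithful X Y (f f' : hmap X Y) : fm f = fm f' -> f = f'.
Proof. by move=> e; have [h _ u] := ffF (fm f'); rewrite (u f e) (u f' erefl). Qed.

Lemma fo_esurj (Y : hmodule B) : exists (X : hmodule A) (i : hmap (fo X) Y)
  (j : hmap Y (fo X)), cancel (hfun i) (hfun j) /\ cancel (hfun j) (hfun i).
Proof.
have [X [i [j [ij ji]]]] := esF Y; exists X, i, j; split=> x.
  by have := congr1 (fun h : hmap _ _ => hfun h x) ji.
by have := congr1 (fun h : hmap _ _ => hfun h x) ij.
Qed.

(** The coregular module.  A linear form l on a module N is the same thing as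
    the morphism from N to it that sends n to a |-> l(a n), so that quotients by
    submodules can be replaced by linear forms that vanish on them. *)
Definition coind_act (a : A) (f : 'Hom(A, k^o)) : 'Hom(A, k^o) :=
  linfun (fun z : A => f (z * a) : k^o).

Lemma coind_actE a (f : 'Hom(A, k^o)) z : coind_act a f z = f (z * a).
Proof. by rewrite linfun_lin //; lin. Qed.

Lemma coind_bilin : bilin coind_act.
Proof.
split=> [f|a] c u v; apply/lfunP => z; rewrite !(add_lfunE, scale_lfunE, coind_actE) //.
by rewrite mulrDr linearD -scalerAr linearZ.
Qed.

Lemma coind1 f : coind_act 1 f = f.
Proof. by apply/lfunP => z; rewrite coind_actE mulr1. Qed.

Lemma coindM a b f : coind_act (a * b) f = coind_act a (coind_act b f).
Proof. by apply/lfunP => z; rewrite !coind_actE mulrA. Qed.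

Definition coind : hmodule A := HModule coind_bilin coind1 coindM.

(** The values of the morphisms from M to A span a left ideal; if it were
    proper, a linear form that vanishes on it would give a nonzero morphism d
    from A with d c = 0 for all c. *)
Lemma trace_ideal (M : hmodule A) :
  (forall (N : hmodule A) (d : hmap (regmod A) N),
     (forall c : hmap M (regmod A), hmap_comp d c = 0) -> d = 0) ->
  exists s : seq (hmap M (regmod A) * M), (1 : A) = \sum_(p <- s) hfun p.1 p.2.
Proof.
move=> hM.
pose P (U : {vspace A}) := forall u, u \in U ->
  exists s : seq (hmap M (regmod A) * M), u = \sum_(p <- s) hfun p.1 p.2.
have P0 : P 0%VS by move=> u; rewrite memv0 => /eqP ->; exists [::]; rewrite big_nil.
have [U PU mx] := max_vspace P0; apply (PU 1); apply: contrapT => /negP oU.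
have inU (c : hmap M (regmod A)) x : hfun c x \in U.
  have le : (U <= U + <[hfun c x : A]>)%VS by exact: addvSl.
  have /mx hd : P (U + <[hfun c x : A]>)%VS.
    move=> u /memv_addP[z /PU[s ->] [y /vlineP[a ->] ->]].
    exists (rcons s (c, a *: x)); rewrite -cats1 big_cat big_seq1 /=.
    by rewrite (linZ (hmap_lin c)).
  have /eqP -> : U == (U + <[hfun c x : A]>)%VS by rewrite eqEdim le hd.
  by apply: (subvP (addvSr _ _)); exact: memv_line.
have [l [ll lU l1]] := separating_form oU.
pose lf : 'Hom(A, k^o) := linfun l; have lfE := linfun_lin ll.
have dP : @is_hmap k A (regmod A) coind (fun a => coind_act a lf).
  split=> [|a b]; first exact: coind_bilin.1.
  exact: coindM.
have d0 : mkhmap dP = 0.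
  apply: hM => c; apply: hmap_eq => x; apply/lfunP => z; rewrite /= coind_actE lfE.
  have -> : z * hfun c x = hfun c (act z x) by rewrite hmap_act.
  by rewrite lU ?zero_lfunE.
have := congr1 (fun h : hmap (regmod A) coind => (hfun h (1 : A) : 'Hom(A, k^o)) 1) d0.
by rewrite /= coind_actE lfE mulr1 zero_lfunE => e; rewrite e eqxx in l1.
Qed.

(** F(A) is finitely generated and projective: the hypothesis of trace_ideal is
    categorical, so it can be checked after F, where the preimage of B is a
    generator.  Applying F to the resulting factorisation of the identity of A
    gives the dual basis. *)
Lemma fo_reg_dual_basis : exists (m : nat)
    (psi : 'I_m -> hmap (fo (regmod A)) (regmod B)) (y : 'I_m -> fo (regmod A)),
  forall x, x = \sum_j act (hfun (psi j) x) (y j).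
Proof.
have [P [i [j [iK jK]]]] := fo_esurj (regmod B).
have [s sP] : exists s : seq (hmap P (regmod A) * P), (1 : A) = \sum_(p <- s) hfun p.1 p.2.
  apply: trace_ideal => N d dc0; apply: fm_faithful; apply: hmap_eq => y.
  rewrite (lin0 (@fm_linear _ _)).
  have [c cE] := fm_full (hmap_comp (orbit_map y) i).
  transitivity (hfun (fm (hmap_comp d c)) (hfun j 1)).
    by rewrite fm_comp cE /= jK act1.
  by rewrite dc0 (lin0 (@fm_linear _ _)).
pose p0 : hmap P (regmod A) * P := (0, 0).
exists (size s), (fun n => hmap_comp i (fm (orbit_map (nth p0 s n).2))),
  (fun n => hfun (fm (nth p0 s n).1) (hfun j 1)) => x.
have idE : hmap_id (regmod A) = \sum_(p <- s) hmap_comp p.1 (orbit_map p.2).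
  apply: hmap_eq => a.
  have le : linear (fun f : hmap (regmod A) (regmod A) => hfun f a) by [].
  rewrite (lin_sum le) /= -[LHS]mulr1 sP mulr_sumr; apply: eq_bigr => p _.
  by rewrite hmap_act.
rewrite -{1}[x]fm_id idE (lin_sum (@fm_linear _ _)).
have le : linear (fun f : hmap (fo (regmod A)) (fo (regmod A)) => hfun f x) by [].
rewrite (lin_sum le) (big_nth p0) big_mkord; apply: eq_bigr => n _.
rewrite fm_comp -hmap_act -(hmap_act j) /= mulr1.
by rewrite iK.
Qed.

Lemma fo_reg_fdim : fdim (fo (regmod A)).
Proof.
have [m [psi [y yP]]] := fo_reg_dual_basis.
pose f x : {ffun 'I_m -> B} := [ffun j => hfun (psi j) x].
apply: (fdim_inj (f := f)); last exact: fdim_vect.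
  by move=> a u v; apply/ffunP => j; rewrite !ffunE (hmap_lin (psi j)).
move=> u v /ffunP e; rewrite (yP u) (yP v); apply: eq_bigr => j _.
by have := e j; rewrite !ffunE => ->.
Qed.

Lemma orbit_map_linear (M : hmodule A) : linear (@orbit_map k A M).
Proof.
move=> a u v; apply: hmap_eq => x; rewrite hmapD hmapZ /=.
exact: (act_bilin M).2.
Qed.

Lemma orbit_map_inj (M : hmodule A) : injective (@orbit_map k A M).
Proof.
move=> u v /(congr1 (fun h : hmap (regmod A) M => hfun h (1 : A))) /=.
by rewrite !act1.
Qed.

(** X embeds in a power of F(X), since a morphism from F(A) is determined by its
    values at the finitely many y_j. *)
Lemma fo_fdim (X : hmodule A) : fdim (fo X) -> fdim X.
Proof.
move=> [d [g [lg gI]]]; have [m [psi [y yP]]] := fo_reg_dual_basis.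
pose f x : {ffun 'I_m -> 'rV[k]_d} := [ffun j => g (hfun (fm (orbit_map x)) (y j))].
apply: (fdim_inj (f := f)); last exact: fdim_vect.
  move=> a u v; apply/ffunP => j; rewrite !ffunE orbit_map_linear fm_linear -lg.
  by rewrite hmapD hmapZ.
move=> u v /ffunP e; apply/orbit_map_inj/fm_faithful/hmap_eq => x.
rewrite (yP x) !(lin_sum (hmap_lin _)); apply: eq_bigr => j _; rewrite !hmap_act.
by congr act; apply: gI; have := e j; rewrite !ffunE.
Qed.

(** With a free generator e of F(A), the elements of X, the morphisms from A to
    X, the morphisms from F(A) to F(X) and the elements of F(X) correspond. *)
Section Fiber.
Variable e : fo (regmod A).
Hypothesis eP : bijective (fun b : B => act b e).

Definition fiber_map (X : hmodule A) (x : X) : fo X := hfun (fm (orbit_map x)) e.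

Lemma fiber_map_linear X : linear (@fiber_map X).
Proof. by move=> a u v; rewrite /fiber_map orbit_map_linear fm_linear. Qed.

Lemma fiber_map_nat X Y (f : hmap X Y) x :
  fiber_map (hfun f x) = hfun (fm f) (fiber_map x).
Proof.
rewrite /fiber_map -fm_comp; congr (hfun (fm _) e); apply: hmap_eq => a /=.
by rewrite hmap_act.
Qed.

Lemma fiber_map_bij X : bijective (@fiber_map X).
Proof.
case: eP => g gK Kg.
have gP : @is_hmap k B (fo (regmod A)) (regmod B) g.
  split=> [|b x]; first exact: (can_lin ((act_bilin _).1 e) gK Kg).
  by apply: (can_inj gK); rewrite /= actM !Kg.
apply: inj_surj_bijective => [x x' h|z].
  apply/orbit_map_inj/fm_faithful/hmap_eq => y; rewrite -(Kg y) !hmap_act.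
  by congr act.
have [c cE] := fm_full (hmap_comp (orbit_map z) (mkhmap gP)).
exists (hfun c 1) => //.
have -> : fiber_map (hfun c 1) = hfun (fm c) e.
  by rewrite /fiber_map; congr (hfun (fm _) e); apply: hmap_eq => a; rewrite [RHS]orbit_mapE.
by rewrite cE /= -[e]act1 gK act1.
Qed.
End Fiber.

End Transport.

(** * Monoidal equivalences preserve dimensions *)
Section FreeTensor.
Variables (k : fieldType) (H : hopfAlgebra k) (X : hmodule H).
Local Notation "\sw_ ( a , b <- x ) E" :=
  (tlift (fun a b : H => E) (comul x)) : ring_scope.
Local Notation R := (regmod H).
Variables (d : nat) (g : X -> 'rV[k]_d) (g' : 'rV[k]_d -> X).
Hypotheses (lg : linear g) (gK : cancel g g') (g'K : cancel g' g).

Let bas (i : 'I_d) : X := g' (delta_mx 0 i).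
Let co (i : 'I_d) (x : X) : k^o := g x 0 i.

Let lin_g' : linear g' := can_lin lg gK g'K.

Lemma lin_co i : linear (co i).
Proof. by move=> a u v; rewrite /co lg !mxE. Qed.

Lemma bas_expand x : x = \sum_i co i x *: bas i.
Proof.
rewrite -{1}[x]gK [g x]row_sum_delta (lin_sum lin_g').
by apply: eq_bigr => i _; rewrite (linZ lin_g').
Qed.

Lemma co_bas i j : co i (bas j) = (i == j)%:R.
Proof. by rewrite /co /bas g'K mxE eqxx eq_sym. Qed.

(** H ⊗ X is free on the vectors 1 ⊗ x_i, for a basis x_i of X.  The coordinate
    maps come from the isomorphism h ⊗ x |-> h1 ⊗ S(h2) x onto the module in
    which H acts on the first factor only. *)
Definition free_in (i : 'I_d) : hmap R (mod_tensor R X) :=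
  orbit_map (@pure k R X 1 (bas i) : mod_tensor R X).

Definition free_out_fun (i : 'I_d) : R ⊗ X -> R :=
  tlift (fun (h : H) (x : X) => \sw_(a, b <- h) co i (act (antipode b) x) *: a).

Lemma free_out_bilin i :
  bilin (fun (h : H) (x : X) => \sw_(a, b <- h) co i (act (antipode b) x) *: a : H).
Proof. have lc := lin_co i; lin. Qed.

Lemma free_in_out i j h : free_out_fun i (hfun (free_in j) h) = (i == j)%:R *: h.
Proof.
have lc := lin_co i; have lo : linear (free_out_fun i) := tlift_linear (free_out_bilin i).
rewrite [hfun _ _]act_tensorE (lin_tliftE (f := free_out_fun i)) //.
transitivity (\sw_(a, b <- h) \sw_(c, d <- a) co i (act (antipode d * b) (bas j)) *: c).
  apply: eq_tlift => a b; rewrite /free_out_fun (tlift_pure _ _ (free_out_bilin i)) /= mulr1.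
  by apply: (@eq_tlift k) => c d'; rewrite actM.
rewrite (@sw_coassoc k H _ (fun c d b => co i (act (antipode d * b) (bas j)) *: c)); [|lin..].
transitivity (\sw_(a, b <- h) counit b *: (co i (act 1 (bas j)) *: a)).
  apply: (@eq_tlift k) => a b.
  by rewrite (@sw_antipodel k H _ (fun z => co i (act z (bas j)) *: a)) //; lin.
rewrite (@sw_counitr k H _ (fun a => co i (act 1 (bas j)) *: a)); last by lin.
by rewrite act1 co_bas.
Qed.

Lemma free_out_in t : t = \sum_i hfun (free_in i) (free_out_fun i t).
Proof.
pose pr : H -> X -> (H ⊗ X : lmodType k) := @pure k H X.
have lpr : bilin pr := pure_bilin H X.
have lc i := lin_co i; have lo i : linear (free_out_fun i) := tlift_linear (free_out_bilin i).
have lA := act_bilin (mod_tensor R X).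
apply: (tensor_ext (f := id) (g := fun t => \sum_i hfun (free_in i) (free_out_fun i t)))
  => [||h x]; [by []| |].
  apply: lin_bigsum => i; exact: (lin_comp (hmap_lin (free_in i)) (lo i)).
transitivity (\sw_(a, b <- h) \sw_(c, d <- a) (pr c (act (d * antipode b) x))).
  rewrite (@sw_coassoc k H _ (fun c d b => pr c (act (d * antipode b) x))); [|lin..].
  transitivity (\sw_(a, b <- h) counit b *: (pr a (act 1 x))).
    rewrite (@sw_counitr k H _ (fun a => pr a (act 1 x))); last by lin.
    by rewrite act1.
  apply: (@eq_tlift k) => a b.
  by rewrite (@sw_antipoder k H _ (fun z => pr a (act z x))) //; lin.
transitivity (\sw_(a, b <- h) \sum_i co i (act (antipode b) x) *: hfun (free_in i) a).
  apply: (@eq_tlift k) => a b.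
  transitivity (\sum_i co i (act (antipode b) x) *:
     \sw_(c, d <- a) (pr c (act d (bas i)))).
    transitivity (\sw_(c, d <- a) (pr c (act d (act (antipode b) x)))).
      by apply: (@eq_tlift k) => c d'; rewrite actM.
    rewrite {1}[act (antipode b) x]bas_expand.
    have lE : linear (fun z : X => \sw_(c, d <- a) (pr c (act d z))) by lin.
    by rewrite (lin_sum lE); apply: eq_bigr => i _; rewrite (linZ lE).
  apply: eq_bigr => i _; congr (_ *: _); rewrite [RHS]act_tensorE.
  by apply: (@eq_tlift k) => c d' /=; rewrite mulr1.
rewrite -(@sum_tlift k); apply: eq_bigr => i _.
rewrite /free_out_fun (tlift_pure _ _ (free_out_bilin i)).
rewrite (lin_tliftE (f := fun z : H => hfun (free_in i) z)); last exact: (hmap_lin (free_in i)).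
by apply: (@eq_tlift k) => a b; rewrite (linZ (hmap_lin (free_in i))).
Qed.

Lemma free_out_subproof i : @is_hmap k H (mod_tensor R X) R (free_out_fun i).
Proof.
have lo j : linear (free_out_fun j) := tlift_linear (free_out_bilin j).
split=> [|x t]; first exact: lo.
have sumE s : free_out_fun i (\sum_j hfun (free_in j) (s j)) = s i.
  rewrite (lin_sum (lo i)) (bigD1 i) //= big1 => [|j ji].
    by rewrite free_in_out eqxx scale1r addr0.
  by rewrite free_in_out eq_sym (negPf ji) scale0r.
rewrite {1}(free_out_in t) (lin_sum ((act_bilin (mod_tensor R X)).2 x)).
transitivity (free_out_fun i (\sum_j hfun (free_in j) (act x (free_out_fun j t)))).
  by congr free_out_fun; apply: eq_bigr => j _; rewrite hmap_act.
exact: sumE.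
Qed.

Definition free_out i : hmap (mod_tensor R X) R := mkhmap (free_out_subproof i).

End FreeTensor.

Section Evaluation.
Variables (k : fieldType) (L : hopfAlgebra k).

(** Equations between morphisms of Mod L are used pointwise; the lemmas below
    compute the structure maps of Mod L on elements. *)
Definition ev (M N : Mod L) (f : mor M N) (x : (M : hmodule L)) : (N : hmodule L) :=
  @hfun k L M N f x.

Lemma ev_linear (M N : Mod L) (f : mor M N) : linear (ev f).
Proof. exact (@hmap_lin k L M N f). Qed.

Lemma ev_cmp (M N P : Mod L) (g : mor N P) (f : mor M N) x : ev (g ∘ f) x = ev g (ev f x).
Proof. by []. Qed.

Lemma ev_tmor (M M' N N' : Mod L) (f : mor M M') (g : mor N N') t :
  ev (tmor f g) t = tmap (ev f) (ev g) t.
Proof. by []. Qed.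

Lemma ev_massoc (M N P : Mod L) t : ev (massoc M N P) t = @tassoc k (M : hmodule L) (N : hmodule L) (P : hmodule L) t.
Proof. by []. Qed.

End Evaluation.

Section MonoidalTransport.
Variables (k : fieldType) (H L : hopfAlgebra k) (F : monfunctor (Mod H) (Mod L)).
Hypothesis eqF : is_equivalence F.
Local Notation RH := (regmod H).
Local Notation RL := (regmod L).

Definition modfun : linfunctor (modlincat H) (modlincat L) := mfun F.
Local Notation fo := (fo modfun).
Local Notation fm := (fm modfun).

Lemma modfun_ff : fully_faithful modfun.
Proof. exact: (equivalence_ff eqF). Qed.

Lemma modfun_esurj : essentially_surjective modfun.
Proof. exact: (equivalence_esurj eqF). Qed.

Definition tensorator (X Y : hmodule H) : hmap (mod_tensor (fo X) (fo Y)) (fo (mod_tensor X Y)) :=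
  @mf2 k _ _ F X Y.

Lemma tensorator_bij X Y : exists J' : hmap (fo (mod_tensor X Y)) (mod_tensor (fo X) (fo Y)),
  cancel (hfun (tensorator X Y)) (hfun J') /\ cancel (hfun J') (hfun (tensorator X Y)).
Proof.
have [J' [h1 h2]] := mf2_iso F X Y; exists J'; split=> t.
  by have := congr1 (fun h : hmap (mod_tensor (fo X) (fo Y)) _ => hfun h t) h1.
by have := congr1 (fun h : hmap (fo (mod_tensor X Y)) _ => hfun h t) h2.
Qed.

Lemma tensorator_nat X X' Y Y' (f : hmap X X') (g : hmap Y Y') t :
  hfun (tensorator X' Y') (tmap (hfun (fm f)) (hfun (fm g)) t) =
  hfun (fm (mod_tmor f g)) (hfun (tensorator X Y) t).
Proof.
exact: (congr1 (fun h : hmap (mod_tensor (fo X) (fo Y)) _ => hfun h t)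
  (@mf2_nat k _ _ F X X' Y Y' f g)).
Qed.

Lemma tensorator_assoc X Y Z (t : (fo X ⊗ fo Y) ⊗ fo Z) :
  hfun (fm (mod_assoc X Y Z)) (hfun (tensorator (mod_tensor X Y) Z) (tmap (hfun (tensorator X Y)) id t)) =
  hfun (tensorator X (mod_tensor Y Z)) (tmap id (hfun (tensorator Y Z)) (tassoc t)).
Proof.
have := congr1 (fun h => @ev k L (tob (tob (mfun F X) (mfun F Y)) (mfun F Z))
  (mfun F (tob (X : Mod H) (tob (Y : Mod H) (Z : Mod H)))) h t) (@mf2_assoc k _ _ F X Y Z).
rewrite !ev_cmp !ev_tmor ev_massoc.
exact.
Qed.

Lemma fo_reg_neq0 : exists x : fo RH, x != 0.
Proof.
apply: contrapT => no; have : hmap_id RH = 0.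
  apply: (fm_faithful modfun_ff); apply: hmap_eq => x; rewrite fm_id (lin0 (@fm_linear _ _ _ _ _ _)).
  by apply: contrapT => /eqP xn0; apply: no; exists x.
move=> /(congr1 (fun h : hmap RH RH => hfun h (1 : H))) /= /eqP.
by rewrite oner_eq0.
Qed.

(** H ⊗ X is free of rank d = dim X, so F(H) ⊗ F(X) is isomorphic to a sum of d
    copies of F(H).  Comparing dimensions, q e = d q with q = dim F(H) > 0. *)
Lemma fo_dim (X : hmodule H) d e (g : X -> 'rV[k]_d) (h : fo X -> 'rV[k]_e) :
  linear g -> bijective g -> linear h -> bijective h -> d = e.
Proof.
move=> lg [g' gK g'K] lh bh.
have [q [f [lf bf]]] := fdim_basis (fo_reg_fdim modfun_ff modfun_esurj).
have [a la ba] := tensor_iso lf bf lh bh.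
case: bf => f' fK f'K; have lf' := can_lin lf fK f'K.
pose u i := free_out lg gK g'K i; pose v i := free_in g' i.
have [J' [JK KJ]] := tensorator_bij RH X; pose J := tensorator RH X.
pose b (t : fo RH ⊗ fo X) : 'M[k]_(d, q) :=
  \matrix_(i, j) (f (hfun (fm (u i)) (hfun J t)) 0 j).
have lb : linear b.
  move=> c x y; apply/matrixP => i j; rewrite !mxE (hmap_lin J) (hmap_lin (fm (u i))).
  by rewrite lf !mxE.
pose b' (M : 'M[k]_(d, q)) : fo RH ⊗ fo X :=
  hfun J' (\sum_i hfun (fm (v i)) (f' (row i M))).
have uv i j x : hfun (fm (u i)) (hfun (fm (v j)) x) = (i == j)%:R *: x.
  rewrite -fm_comp (_ : hmap_comp _ _ = (i == j)%:R *: hmap_id RH).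
    by rewrite (linZ (@fm_linear _ _ _ _ _ _)) hmapZ fm_id.
  by apply: hmap_eq => y; exact (free_in_out lg g'K i j y).
have vu y : \sum_i hfun (fm (v i)) (hfun (fm (u i)) y) = y.
  rewrite -[RHS]fm_id (_ : hmap_id _ = \sum_i hmap_comp (v i) (u i)).
    rewrite (lin_sum (@fm_linear _ _ _ _ _ _)).
    have le : linear (fun m : hmap (fo (mod_tensor RH X)) (fo (mod_tensor RH X)) => hfun m y) by [].
    by rewrite (lin_sum le); apply: eq_bigr => i _; rewrite fm_comp.
  apply: hmap_eq => t.
  have le : linear (fun m : hmap (mod_tensor RH X) (mod_tensor RH X) => hfun m t) by [].
  rewrite (lin_sum le) /=; exact (free_out_in lg gK g'K t).
have bb : bijective b.
  exists b' => [t|M].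
    rewrite /b' -[RHS]JK; congr (hfun J' _); rewrite -[RHS]vu; apply: eq_bigr => i _.
    congr (hfun _ _); rewrite -[RHS]fK; congr (f' _); apply/rowP => j; by rewrite !mxE.
  apply/matrixP => i j; rewrite mxE /b' KJ (lin_sum (hmap_lin (fm (u i)))) (bigD1 i) //=.
  rewrite big1 => [|l li]; first by rewrite addr0 uv eqxx scale1r f'K mxE.
  by rewrite uv eq_sym (negPf li) scale0r.
case: ba => a' aK a'K.
have la' := can_lin la aK a'K.
have := vect_iso_dim (lin_comp lb la') (bij_comp bb (Bijective a'K aK)).
rewrite !dimvf !dim_matrix => /eqP.
have q0 : (0 < q)%N.
  rewrite lt0n; apply/eqP => q0; have [x /eqP xn0] := fo_reg_neq0; apply: xn0.
  by apply: (can_inj fK); apply/rowP => -[j jq]; exfalso; move: jq; rewrite q0.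
by rewrite -![GRing.mul _ _]/(_ * _)%N (mulnC d) eqn_pmul2l // => /eqP.
Qed.

(** Hom(F(H), Z) = Hom(F(H), F(P)) = Hom(H, P) = P has the dimension of F(P) = Z. *)
Lemma reg_generator : exists e : fo RH, bijective (fun b : L => act b e).
Proof.
have [m [psi [y yP]]] := fo_reg_dual_basis modfun_ff modfun_esurj.
apply: (regular_generator yP) => Z fZ.
have [P [i [j [iK jK]]]] := fo_esurj modfun_esurj Z.
have li := hmap_lin i; have lj := hmap_lin j.
have fFP : fdim (fo P) by exact: (fdim_inj li (can_inj iK) fZ).
have fP := fo_fdim modfun_ff modfun_esurj fFP.
have [d [g [lg bg]]] := fdim_basis fP.
have [d' [h [lh bh]]] := fdim_basis fFP.
have dd' := fo_dim lg bg lh bh; subst d'.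
pose s (p : P) : hmap (fo RH) Z := hmap_comp i (fm (orbit_map p)).
have ls : linear s.
  by move=> a u v; apply: hmap_eq => x; rewrite /= orbit_map_linear fm_linear (hmap_lin i).
have bs : bijective s.
  apply: inj_surj_bijective => [p p' e|f].
    apply/orbit_map_inj/(fm_faithful modfun_ff)/hmap_eq => x; apply: (can_inj iK).
    by have := congr1 (fun m : hmap _ _ => hfun m x) e.
  have [c cE] := fm_full modfun_ff (hmap_comp j f).
  exists (hfun c (1 : H)); rewrite /s (_ : orbit_map _ = c); last first.
    by apply: hmap_eq => a; rewrite [RHS]orbit_mapE.
  by apply: hmap_eq => x; rewrite cE /= jK.
case: bs => s' sK s'K; have ls' := can_lin ls sK s'K.
case: bg => g' gK g'K; case: bh => h' hK h'K.
have lh' := can_lin lh hK h'K; have lg' := can_lin lg gK g'K.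
exists (hfun i \o (h' \o (g \o s'))); split.
  by apply: lin_comp => //; apply: lin_comp => //; apply: lin_comp.
apply: bij_comp; first by exists (hfun j).
apply: bij_comp; first by exists h.
apply: bij_comp; first by exists g'.
by exists s.
Qed.

End MonoidalTransport.

(** * Transport of Yetter-Drinfeld modules *)
Section AssocInverse.
Variables (k : fieldType) (H : hopfAlgebra k).

Lemma mod_assocV_subproof (M N P : hmodule H) :
  @is_hmap k H (mod_tensor M (mod_tensor N P)) (mod_tensor (mod_tensor M N) P)
    (@tassocV k M N P).
Proof.
split=> [|x t]; first exact: tassocV_linear.
apply: (can_inj (@tassocK k M N P)).
by rewrite tassocVK -[RHS]/(hfun (mod_assoc M N P) _) (hmap_act (mod_assoc M N P)) /= tassocVK.
Qed.

Definition mod_assocV (M N P : hmodule H) :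
    hmap (mod_tensor M (mod_tensor N P)) (mod_tensor (mod_tensor M N) P) :=
  mkhmap (mod_assocV_subproof M N P).

(** The hexagon as an equation of morphisms, to which F can be applied. *)
Lemma ydbraid_hmap_hexagon (X Y : hmodule H) (W : ydmodule H) :
  ydbraid_hmap (mod_tensor X Y) W =
  hmap_comp (mod_assoc W X Y)
    (hmap_comp (mod_tmor (ydbraid_hmap X W) (hmap_id Y))
      (hmap_comp (mod_assocV X W Y)
        (hmap_comp (mod_tmor (hmap_id X) (ydbraid_hmap Y W)) (mod_assoc X Y W)))).
Proof.
have lX := @ydbraid_linear k H X W; have lY := @ydbraid_linear k H Y W.
apply: hmap_eq3 => x y w; rewrite /= tassoc_pure tmap_pure //.
rewrite -[LHS]/(ydbraid _) ydbraid_hexagon ydbraid_pure exchange_big.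
rewrite (lin_sum (@lin_pure_r _ _ _ x)) (lin_sum (@tassocV_linear k _ _ _)).
rewrite (lin_sum (tmap_linear lX (@lin_id _ _))) (lin_sum (@tassoc_linear k _ _ _)).
apply: eq_bigr => j _; rewrite tassocV_pure tmap_pure // ydbraid_pure.
rewrite (lin_sum (@lin_pure_l _ _ _ _)) (lin_sum (@tassoc_linear k _ _ _)).
by apply: eq_bigr => i _; rewrite tassoc_pure.
Qed.

End AssocInverse.

Section TransportYD.
Variables (k : fieldType) (H L : hopfAlgebra k) (F : monfunctor (Mod H) (Mod L)).
Hypothesis eqF : is_equivalence F.
Local Notation RH := (regmod H).
Local Notation RL := (regmod L).
Local Notation fo := (fo (modfun F)).
Local Notation fm := (fm (modfun F)).
Local Notation J := (@tensorator k H L F).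
Local Notation "\sw_ ( a , b <- x ) E" :=
  (tlift (fun a b : L => E) (comul x)) : ring_scope.
Local Notation "''h_' i" := (@hbas k L i) (at level 8, i at level 2).
Local Notation "''h*_' i" := (dual_basis i : dual L) (at level 8, i at level 2).

Definition tensoratorV X Y : hmap (fo (mod_tensor X Y)) (mod_tensor (fo X) (fo Y)) :=
  projT1 (cid (tensorator_bij F X Y)).

Lemma tensoratorK X Y : cancel (hfun (J X Y)) (hfun (tensoratorV X Y)).
Proof. by case: (projT2 (cid (tensorator_bij F X Y))). Qed.

Lemma tensoratorVK X Y : cancel (hfun (tensoratorV X Y)) (hfun (J X Y)).
Proof. by case: (projT2 (cid (tensorator_bij F X Y))). Qed.

Lemma fm_id_fun X : hfun (fm (hmap_id X)) = id.
Proof. by apply: funext => x; rewrite fm_id. Qed.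

Lemma tensorator_natl X X' Y (f : hmap X X') t :
  hfun (J X' Y) (tmap (hfun (fm f)) id t) = hfun (fm (mod_tmor f (hmap_id Y))) (hfun (J X Y) t).
Proof. by rewrite -tensorator_nat fm_id_fun. Qed.

Lemma tensorator_natr X Y Y' (f : hmap Y Y') t :
  hfun (J X Y') (tmap id (hfun (fm f)) t) = hfun (fm (mod_tmor (hmap_id X) f)) (hfun (J X Y) t).
Proof. by rewrite -tensorator_nat fm_id_fun. Qed.

Section Braiding.
Variable W : ydmodule H.

Definition half_braid (X : hmodule H) : hmap (mod_tensor (fo X) (fo W)) (mod_tensor (fo W) (fo X)) :=
  hmap_comp (tensoratorV W X) (hmap_comp (fm (ydbraid_hmap X W)) (J X W)).

Lemma tensorator_half_braid X t :
  hfun (J W X) (hfun (half_braid X) t) = hfun (fm (ydbraid_hmap X W)) (hfun (J X W) t).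
Proof. exact: tensoratorVK. Qed.

Lemma half_braid_nat X Y (f : hmap X Y) t :
  hfun (half_braid Y) (tmap (hfun (fm f)) id t) = tmap id (hfun (fm f)) (hfun (half_braid X) t).
Proof.
apply: (can_inj (@tensoratorK W Y)); rewrite tensorator_half_braid tensorator_natl tensorator_natr tensorator_half_braid.
rewrite -!fm_comp; congr (hfun (fm _) _); apply: hmap_eq => s.
exact: ydbraid_nat.
Qed.

(** From here on e is a free generator of F(H), and g gives the coordinate of a
    vector with respect to it. *)
Variables (e : fo RH) (g : fo RH -> L).
Hypotheses (gK : cancel g (fun b : L => act b e)) (Kg : cancel (fun b : L => act b e) g).

Lemma gen_inv_subproof : @is_hmap k L (fo RH) RL g.
Proof.
split=> [|b x]; first exact: (can_lin ((act_bilin (fo RH)).1 e) Kg gK).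
by apply: (can_inj Kg); rewrite /= actM !gK.
Qed.

Definition gen_inv : hmap (fo RH) RL := mkhmap gen_inv_subproof.

Let lin_g : linear g := hmap_lin gen_inv.

(** The coaction of FW is the half-braiding at F(H) = L, evaluated at the unit. *)
Definition transport_dact (f : dual L) (w : fo W) : fo W :=
  tlift (fun (w' : fo W) (x : fo RH) => f (g x) *: w') (hfun (half_braid RH) (e ⊠ w)).

Lemma dual_pairing_bilin (f : dual L) : bilin (fun (w' : fo W) (x : fo RH) => f (g x) *: w').
Proof. lin. Qed.

Lemma transport_dact_bilin : bilin transport_dact.
Proof.
split=> [w|f]; first by apply: lin_tliftl => w' x; lin.
apply: (lin_comp_app (tlift_linear (dual_pairing_bilin f))).
exact: (lin_comp (hmap_lin (half_braid RH)) (@lin_pure_r k _ _ e)).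
Qed.
Let lin_transport_dact := transport_dact_bilin.

(** By naturality along the morphism F(H) -> FX that sends e to x, the
    half-braiding is determined by its value at e. *)
Lemma half_braid_pure X (x : fo X) (w : fo W) :
  hfun (half_braid X) (x ⊠ w) = \sum_i transport_dact 'h*_i w ⊠ act 'h_i x.
Proof.
have [c cE] := fm_full (modfun_ff eqF) (hmap_comp (orbit_map x) gen_inv).
have cx y : hfun (fm c) y = act (g y) x by rewrite cE.
have ge1 : g e = 1 by rewrite -[e]act1 Kg.
rewrite -[x in LHS](act1 x) -ge1 -cx.
rewrite -(tmap_pure (f := hfun (fm c)) (g := id)); [|exact: hmap_lin|by []].
rewrite half_braid_nat.
pose pr : fo W -> fo X -> (fo W ⊗ fo X : lmodType k) := @pure k (fo W) (fo X).
transitivity (\sum_i tlift (fun (w' : fo W) (y : fo RH) => pr ('h*_i (g y) *: w') (act 'h_i x))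
   (hfun (half_braid RH) (e ⊠ w))).
  rewrite (@sum_tlift k).
  apply: eq_tlift => w' y; rewrite cx.
  have lE : linear (fun z : L => w' ⊠ act z x) by lin.
  rewrite -(sum_basis_lin (g y) lE); apply: eq_bigr => i _.
  by rewrite /pr (linZ (@lin_pure_l k _ _ _)).
apply: eq_bigr => i _.
by rewrite /transport_dact (lin_tliftE (f := fun z => z ⊠ act 'h_i x)); last by lin.
Qed.

(** L-linearity of the half-braiding at F(H), evaluated at e ⊗ w and paired
    with f. *)
Lemma transport_dact_compat (x : L) (f : dual L) (w : fo W) :
  \sw_(a, b <- x) act a (transport_dact (shiftl b f) w) =
  \sw_(a, b <- x) transport_dact (shiftr a f) (act b w).
Proof.
have lT := tlift_linear (dual_pairing_bilin f).
have := congr1 (tlift (fun (w' : fo W) (y : fo RH) => f (g y) *: w'))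
  (hmap_act (half_braid RH) x (e ⊠ w)).
rewrite half_braid_pure (lin_sum ((act_bilin (mod_tensor (fo W) (fo RH))).2 x)) (lin_sum lT).
rewrite act_tensorE (lin_tliftE (f := hfun (half_braid RH))); last exact: hmap_lin.
rewrite (lin_tliftE _ _ lT) => E.
transitivity (\sum_i tlift (fun (w' : fo W) (y : fo RH) => f (g y) *: w')
   (act (h := mod_tensor (fo W) (fo RH)) x (transport_dact 'h*_i w ⊠ act 'h_i e))); last first.
  rewrite -E; apply: eq_tlift => a b; rewrite half_braid_pure (lin_sum lT).
  have lE : linear (fun h => transport_dact h (act b w)) by lin.
  rewrite -(sum_dual_lin (shiftr a f) lE); apply: eq_bigr => i _.
  by rewrite (tlift_pure _ _ (dual_pairing_bilin f)) -actM Kg shiftrE.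
transitivity (\sum_i \sw_(a, b <- x) (f (b * 'h_i) *: act a (transport_dact 'h*_i w))).
  rewrite (@sum_tlift k); apply: eq_tlift => a b.
  have lE : linear (fun h => act a (transport_dact h w)) by lin.
  by rewrite -(sum_dual_lin (shiftl b f) lE); apply: eq_bigr => i _; rewrite shiftlE.
apply: eq_bigr => i _; rewrite act_tensorE (lin_tliftE _ _ lT).
apply: eq_tlift => a b.
by rewrite (tlift_pure _ _ (dual_pairing_bilin f)) -actM Kg.
Qed.

(** Both sides are F(ydbraid) evaluated at J(J(x ⊗ y) ⊗ w): the left one by
    half_braid_pure for X ⊗ Y, the right one by the hexagon of W and the
    compatibility of J with the associators. *)
Lemma half_braid_hexagon X Y (x : fo X) (y : fo Y) (w : fo W) :
  \sum_i transport_dact 'h*_i w ⊠ act (h := mod_tensor (fo X) (fo Y)) 'h_i (x ⊠ y) =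
  \sum_i \sum_j transport_dact 'h*_i (transport_dact 'h*_j w) ⊠ (act 'h_i x ⊠ act 'h_j y)
  :> (fo W ⊗ (fo X ⊗ fo Y)).
Proof.
have lJ M N := hmap_lin (J M N).
have e1 : \sum_i transport_dact 'h*_i w ⊠ act (h := mod_tensor (fo X) (fo Y)) 'h_i (x ⊠ y) =
    tmap id (hfun (tensoratorV X Y)) (hfun (half_braid (mod_tensor X Y)) (hfun (J X Y) (x ⊠ y) ⊠ w)).
  rewrite half_braid_pure (lin_sum (tmap_linear (@lin_id _ _) (hmap_lin (tensoratorV X Y)))).
  apply: eq_bigr => i _; rewrite tmap_pure //; last exact: hmap_lin.
  by rewrite -(hmap_act (J X Y)) tensoratorK.
rewrite e1.
have -> : hfun (half_braid (mod_tensor X Y)) (hfun (J X Y) (x ⊠ y) ⊠ w) =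
    tmap id (hfun (J X Y)) (\sum_i \sum_j transport_dact 'h*_i (transport_dact 'h*_j w) ⊠ (act 'h_i x ⊠ act 'h_j y)).
  apply: (can_inj (@tensoratorK W (mod_tensor X Y))); rewrite tensorator_half_braid ydbraid_hmap_hexagon.
  rewrite !fm_comp.
  have A1 M N P (m : fo M) (n : fo N) (p : fo P) :
      hfun (fm (mod_assoc M N P)) (hfun (J (mod_tensor M N) P) (hfun (J M N) (m ⊠ n) ⊠ p)) =
      hfun (J M (mod_tensor N P)) (m ⊠ hfun (J N P) (n ⊠ p)).
    have := @tensorator_assoc k H L F M N P ((m ⊠ n) ⊠ p).
    by rewrite tassoc_pure !tmap_pure //; exact: hmap_lin.
  have A2 M N P (m : fo M) (n : fo N) (p : fo P) :
      hfun (fm (mod_assocV M N P)) (hfun (J M (mod_tensor N P)) (m ⊠ hfun (J N P) (n ⊠ p))) =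
      hfun (J (mod_tensor M N) P) (hfun (J M N) (m ⊠ n) ⊠ p).
    rewrite -A1 -fm_comp -[RHS]fm_id; congr (hfun (fm _) _); apply: hmap_eq => t.
    exact: tassocK.
  rewrite A1.
  have B1 : hfun (fm (mod_tmor (hmap_id X) (ydbraid_hmap Y W)))
      (hfun (J X (mod_tensor Y W)) (x ⊠ hfun (J Y W) (y ⊠ w))) =
      \sum_j hfun (J X (mod_tensor W Y)) (x ⊠ hfun (J W Y) (transport_dact 'h*_j w ⊠ act 'h_j y)).
    rewrite -tensorator_natr tmap_pure //; last exact: hmap_lin.
    rewrite -tensorator_half_braid half_braid_pure (lin_sum (hmap_lin (J W Y))).
    by rewrite (lin_sum (@lin_pure_r k _ _ x)) (lin_sum (hmap_lin (J X _))).
  rewrite B1 (lin_sum (hmap_lin (fm (mod_assocV X W Y)))).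
  rewrite (lin_sum (hmap_lin (fm (mod_tmor (ydbraid_hmap X W) (hmap_id Y))))).
  rewrite (lin_sum (hmap_lin (fm (mod_assoc W X Y)))).
  rewrite exchange_big (lin_sum (tmap_linear (@lin_id _ _) (hmap_lin (J X Y)))).
  rewrite (lin_sum (hmap_lin (J W (mod_tensor X Y)))).
  apply: eq_bigr => j _; rewrite A2 -tensorator_natl tmap_pure //; last exact: hmap_lin.
  rewrite -tensorator_half_braid half_braid_pure (lin_sum (hmap_lin (J W X))).
  rewrite (lin_sum (@lin_pure_l k _ _ _)) (lin_sum (hmap_lin (J (mod_tensor W X) Y))).
  rewrite (lin_sum (hmap_lin (fm (mod_assoc W X Y)))).
  rewrite (lin_sum (tmap_linear (@lin_id _ _) (hmap_lin (J X Y)))).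
  rewrite (lin_sum (hmap_lin (J W (mod_tensor X Y)))).
  apply: eq_bigr => i _; rewrite A1 tmap_pure //; exact: hmap_lin.
have lV := hmap_lin (tensoratorV X Y); have lJXY := hmap_lin (J X Y).
move: (\sum_i _) => t; move: t.
apply: (tensor_ext (f := fun t => tmap id (hfun (tensoratorV X Y)) (tmap id (hfun (J X Y)) t)) (g := id))
  => [||w' s]; [by lin|by []|].
by rewrite !tmap_pure // tensoratorK.
Qed.

(** The hexagon at x = y = e, paired with f and h. *)
Lemma transport_dactM (f h : dual L) (w : fo W) : transport_dact f (transport_dact h w) = transport_dact (convol f h) w.
Proof.
pose K : fo W ⊗ (fo RH ⊗ fo RH) -> fo W :=
  tlift (fun w' s => (tlift (fun (x y : fo RH) => f (g x) * h (g y) : k^o) s : k) *: w').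
have bi : bilin (fun (x y : fo RH) => f (g x) * h (g y) : k^o) by lin.
have bK : bilin (fun (w' : fo W) s => (tlift (fun (x y : fo RH) => f (g x) * h (g y) : k^o) s : k) *: w').
  by lin.
have lK : linear K := tlift_linear bK.
have := congr1 K (half_braid_hexagon e e w).
rewrite !(lin_sum lK).
have -> : \sum_i K (transport_dact 'h*_i w ⊠ act (h := mod_tensor (fo RH) (fo RH)) 'h_i (e ⊠ e)) =
    transport_dact (convol f h) w.
  have lE : linear (fun u => transport_dact u w) by lin.
  rewrite -(sum_dual_lin (convol f h) lE); apply: eq_bigr => i _.
  rewrite /K (tlift_pure _ _ bK) act_tensorE (lin_tliftE _ _ (tlift_linear bi)).
  congr (_ *: _); rewrite convolE; apply: (@eq_tlift k _ _ (GRing.regular k)) => a b.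
  by rewrite (tlift_pure _ _ bi) !Kg.
move=> ->.
have lE : linear (fun u => transport_dact u (transport_dact h w)) by lin.
rewrite -(sum_dual_lin f lE); apply: eq_bigr => i _.
rewrite (lin_sum lK).
have lE2 : linear (fun u => transport_dact 'h*_i (transport_dact u w)) by lin.
rewrite -(sum_dual_lin h lE2) scaler_sumr; apply: eq_bigr => j _.
by rewrite /K (tlift_pure _ _ bK) (tlift_pure _ _ bi) !Kg scalerA.
Qed.

Definition transport_yd : ydmodule L :=
  @YDModule k L (fo W) transport_dact transport_dact_bilin transport_dactM transport_dact_compat.

Lemma transport_ydbraidE (X : hmodule H) (t : fo X ⊗ fo W) :
  ydbraid (X := fo X) (W := transport_yd) t = hfun (half_braid X) t.
Proof.
apply: (tensor_ext (f := @ydbraid k L (fo X) transport_yd) (g := hfun (half_braid X))) => [||x w].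
- exact: ydbraid_linear.
- exact: (hmap_lin (half_braid X)).
by rewrite half_braid_pure ydbraid_pure.
Qed.

End Braiding.
End TransportYD.

(** * The double of L is the transported double of H *)

(** The integer n is kept abstract in order to compare the doubles of two Hopf
    algebras of the same dimension. *)
Lemma double_iso (k : fieldType) (H : hopfAlgebra k) n : n = \dim {:H} ->
  exists2 h : drinfeldDouble H -> 'M[k]_(n, n), linear h & bijective h.
Proof.
move=> ->.
have [lf bf] : linear (fun f : dual H => \row_i f (hbas i)) /\
    bijective (fun f : dual H => \row_i f (hbas i)).
  split; first by move=> a u v; apply/rowP => i; rewrite !mxE add_lfunE scale_lfunE.
  exists (fun r : 'rV[k]_(\dim {:H}) => \sum_i r 0 i *: (dual_basis i : dual H)) => [f|r].
    by rewrite [RHS]sum_dual_basis; apply: eq_bigr => i _; rewrite mxE.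
  apply/rowP => i; rewrite mxE sum_lfunE (bigD1 i) //= big1 => [|j ji].
    by rewrite addr0 scale_lfunE dual_basisE eqxx; exact: mulr1.
  by rewrite scale_lfunE dual_basisE (negPf ji); exact: mulr0.
have [lx bx] : linear (fun x : H => \row_i (dual_basis i : dual H) x) /\
    bijective (fun x : H => \row_i (dual_basis i : dual H) x).
  split; first by move=> a u v; apply/rowP => i; rewrite !mxE linearP.
  exists (fun r : 'rV[k]_(\dim {:H}) => \sum_i r 0 i *: (hbas i : H)) => [x|r].
    by rewrite [RHS]basis_expand; apply: eq_bigr => i _; rewrite mxE.
  apply/rowP => i; rewrite mxE linear_sum (bigD1 i) //= big1 => [|j ji].
    by rewrite addr0 linearZ /= dual_basisE eqxx; exact: mulr1.
  by rewrite linearZ /= dual_basisE eq_sym (negPf ji); exact: mulr0.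
exact: tensor_iso lf bf lx bx.
Qed.

Section TransportDouble.
Variables (k : fieldType) (H L : hopfAlgebra k) (F : monfunctor (Mod H) (Mod L)).
Hypothesis eqF : is_equivalence F.
Local Notation RH := (regmod H).
Local Notation RL := (regmod L).
Local Notation fo := (fo (modfun F)).
Local Notation fm := (fm (modfun F)).
Local Notation J := (@tensorator k H L F).
Local Notation "''h_' i" := (@hbas k L i) (at level 8, i at level 2).
Local Notation "''h*_' i" := (dual_basis i : dual L) (at level 8, i at level 2).
Variables (e : fo RH) (g : fo RH -> L).
Hypotheses (gK : cancel g (fun b : L => act b e)) (Kg : cancel (fun b : L => act b e) g).
Local Notation W := (double_yd H).
Local Notation TW := (transport_yd eqF W gK Kg).

Definition fiber_iso (X : hmodule H) : X -> fo X := fiber_map e (X := X).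

Lemma fiber_iso_bij X : bijective (@fiber_iso X).
Proof. exact: (fiber_map_bij (modfun_ff eqF) (Bijective Kg gK)). Qed.

Lemma fiber_iso_linear X : linear (@fiber_iso X).
Proof. exact: fiber_map_linear. Qed.

Lemma fiber_iso_nat X Y (f : hmap X Y) x : fiber_iso (hfun f x) = hfun (fm f) (fiber_iso x).
Proof. exact: fiber_map_nat. Qed.

Definition double_comparison : drinfeldDouble L -> fo W :=
  double_to_yd (W := TW) (fiber_iso (X := W) (double_embed (1 : H))).

Lemma double_comparison_linear : linear double_comparison.
Proof. exact (@double_to_yd_linear k L TW _). Qed.

(** L is F(H), which is linearly isomorphic to H. *)
Lemma dim_hopf_eq : \dim {:L} = \dim {:H}.
Proof.
have bg : bijective g by exists (fun b : L => act b e).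
have lg : linear g := hmap_lin (gen_inv gK Kg).
apply/esym; apply: (vect_iso_dim (f := g \o fiber_iso (X := RH))).
  exact: (lin_comp lg (@fiber_iso_linear RH)).
exact: (bij_comp bg (fiber_iso_bij RH)).
Qed.

(** Otherwise some linear form l vanishes on the image, a submodule, but not at
    w.  It gives a morphism from F(D(H)) to the coregular module that kills the
    image, and, up to isomorphism, this is F(c) for some c on D(H).  All values
    of the half-braiding at y ⊗ F(iota)(x), where iota : H -> D(H) is
    x |-> eps ⋈ x, have their first factor in the image; hence
    (c ⊗ id) ydbraid (id ⊗ iota) vanishes after F, and so c(f ⋈ x) = 0. *)
Lemma double_comparison_surj w : exists t, double_comparison t = w.
Proof.
set z := double_comparison.
have lz : linear z := double_comparison_linear.
have [h lh bh] := double_iso (erefl (\dim {:H})).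
have [th' thK Kth] := fiber_iso_bij W; have lth := @fiber_iso_linear W.
have lth' := can_lin lth thK Kth.
case: bh => h' hK h'K; have lh' := can_lin lh hK h'K.
pose p := h \o (th' \o z).
have lp : linear p by apply: lin_comp => //; apply: lin_comp.
have [U UP] := image_vspace lp.
have [wU|wU] := boolP (h (th' w) \in U).
  have [t tE] := (UP _).1 wU; exists t.
  by apply: (can_inj Kth); apply: (can_inj hK).
have [l0 [ll0 l0U l0w]] := separating_form wU.
pose l (x : fo W) : k^o := l0 (h (th' x)).
have ll : linear l by apply: (lin_comp ll0); apply: (lin_comp lh).
have lz0 t : l (z t) = 0 by apply: l0U; apply/UP; exists t.
(* the morphism of modules that corresponds to the form l *)
pose q (x : fo W) : 'Hom(L, k^o) := linfun (fun b : L => l (act b x)).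
have qE x b : q x b = l (act b x) by rewrite linfun_lin //; lin.
have qP : @is_hmap k L (fo W) (coind L) q.
  split=> [a u v|b x]; apply/lfunP => b'.
    by rewrite add_lfunE scale_lfunE !qE (act_bilin (fo W)).2 ll.
  by rewrite qE /= coind_actE qE actM.
pose qh : hmap (fo W) (coind L) := mkhmap qP.
have qz t : q (z t) = 0.
  apply/lfunP => b; rewrite qE zero_lfunE -(lz0 (double_act b t)).
  by rewrite /z /double_comparison double_to_yd_act.
have [P [i [j [iK jK]]]] := fo_esurj (modfun_esurj eqF) (coind L).
have [c cE] := fm_full (modfun_ff eqF) (hmap_comp j qh).
have cz t : hfun (fm c) (z t) = 0.
  by rewrite cE /= qz (lin0 (hmap_lin j)).
suff c0 : c = 0.
  have : hfun i (hfun (fm c) w) = 0.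
    by rewrite c0 (lin0 (@fm_linear _ _ _ _ _ _)) (lin0 (hmap_lin i)).
  rewrite cE /= jK => /(congr1 (fun f : 'Hom(L, k^o) => f 1)).
  by rewrite qE act1 zero_lfunE /l => e0; rewrite e0 eqxx in l0w.
pose iota : hmap RH W := orbit_map (double_embed (1 : H) : W).
pose T := hmap_comp (mod_tmor c (hmap_id RH))
  (hmap_comp (ydbraid_hmap RH W) (mod_tmor (hmap_id RH) iota)).
have T0 : T = 0.
  apply: (fm_faithful (modfun_ff eqF)); apply: hmap_eq => s.
  rewrite (lin0 (@fm_linear _ _ _ _ _ _)) -[LHS]/(hfun (fm T) s).
  rewrite -(tensoratorVK s); move: (hfun (tensoratorV F RH RH) s) => {}s.
  have lJ := hmap_lin (J RH RH); have lT := hmap_lin (fm T).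
  have lc := hmap_lin (fm c).
  apply: (tensor_ext (f := fun s => hfun (fm T) (hfun (J RH RH) s)) (g := fun _ => 0)) => [||y x].
  - exact: (lin_comp lT lJ).
  - by move=> a u v; rewrite scaler0 addr0.
  rewrite /T !fm_comp -tensorator_natr -tensorator_half_braid -tensorator_natl.
  rewrite -[RHS](lin0 (hmap_lin (J P RH))); congr (hfun _ _).
  rewrite tmap_pure //; last exact: hmap_lin.
  have -> : hfun (fm iota) x = act (g x) (fiber_iso (X := W) (double_embed (1 : H))).
    by rewrite -{1}[x]gK hmap_act.
  rewrite (half_braid_pure eqF gK Kg).
  rewrite (lin_sum (tmap_linear lc (@lin_id _ _))) big1 // => n _.
  rewrite tmap_pure //.
  have -> : transport_dact (W := W) e g (dual_basis n) (act (g x) (fiber_iso (X := W) (double_embed (1 : H)))) =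
      z (dual_basis n ⊠ g x).
    by rewrite /z /double_comparison double_to_yd_pure.
  by rewrite cz (lin0 (@lin_pure_l k _ _ _)).
apply: hmap_eq => t; rewrite -[RHS]/(0 : P).
have lc := hmap_lin c.
apply: (tensor_ext (f := hfun c) (g := fun _ => 0)) => [||f x]; [exact: lc| |].
  by move=> a u v; rewrite scaler0 addr0.
have := congr1 (fun m : hmap (mod_tensor RH RH) (mod_tensor P RH) =>
   hfun m (@pure k RH RH 1 x)) T0.
have lb := @ydbraid_linear k H RH W.
rewrite /= tmap_pure //; last exact: (hmap_lin iota).
rewrite double_act_unit ydbraid_pure.
rewrite (lin_sum (tmap_linear lc (@lin_id _ _))) => E.
have bp : bilin (fun (p : P) (x : H) => f x *: p) by lin.
have := congr1 (tlift (fun (p : P) (x : H) => f x *: p)) E.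
rewrite (lin0 (tlift_linear bp)) (lin_sum (tlift_linear bp)) => <-.
have -> : hfun c (f ⊠ x) = hfun c (double_dact f (double_embed x)).
  by rewrite double_dact_pure convol_counitr.
have ld := @double_dact_bilin k H.
have lE : linear (fun f : dual H => hfun c (double_dact f (double_embed x))).
  exact: (lin_comp lc (ld.1 (double_embed x))).
rewrite -(sum_dual_lin f lE); apply: eq_bigr => n _.
by rewrite tmap_pure // (tlift_pure _ _ bp) /= mulr1.
Qed.

Lemma double_comparison_bij : bijective double_comparison.
Proof.
have lz : linear double_comparison := double_comparison_linear.
apply: inj_surj_bijective; last exact: double_comparison_surj.
have [h lh [h' hK h'K]] := double_iso (erefl (\dim {:H})).
have [hL lhL bhL] := double_iso (esym dim_hopf_eq).
have lh' := can_lin lh hK h'K.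
have [th' thK Kth] := fiber_iso_bij W; have lth' := can_lin (@fiber_iso_linear W) thK Kth.
apply/(fdim_inj_surj (t := fiber_iso (X := W) \o (h' \o hL))) => //.
- apply: (fdim_inj (f := h \o th')); last exact: fdim_vect.
    exact: lin_comp.
  exact: (inj_comp (can_inj hK) (can_inj Kth)).
- by apply: (lin_comp (@fiber_iso_linear W)); apply: (lin_comp lh' lhL).
- apply: (bij_comp (fiber_iso_bij W)); apply: (bij_comp _ bhL); by exists h.
- exact: double_comparison_surj.
Qed.

Lemma double_comparison_braid (t : drinfeldDouble L ⊗ drinfeldDouble L) :
  hfun (half_braid F W W) (tmap double_comparison double_comparison t) =
  tmap double_comparison double_comparison (ydbraid (X := double_yd L) (W := double_yd L) t).
Proof.
have lz : linear double_comparison := double_comparison_linear.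
rewrite -(transport_ydbraidE eqF gK Kg).
apply: (ydbraid_morph (W := double_yd L) (W' := TW)) => // [x w|f w].
  exact: double_to_yd_act.
exact: double_to_yd_dact.
Qed.

End TransportDouble.

(** * Tensor powers *)
Section TensorPowers.
Variable k : fieldType.

Lemma tmap_comp (V W X V' W' X' : lmodType k) (f' : W -> X) (f : V -> W)
    (g' : W' -> X') (g : V' -> W') t :
  linear f -> linear f' -> linear g -> linear g' ->
  tmap f' g' (tmap f g t) = tmap (f' \o f) (g' \o g) t.
Proof.
move=> lf lf' lg lg'.
have lff : linear (f' \o f) by exact: lin_comp.
have lgg : linear (g' \o g) by exact: lin_comp.
apply: (tensor_ext (f := fun t => tmap f' g' (tmap f g t)) (g := tmap (f' \o f) (g' \o g)))
  => [||v w]; [by lin|by lin|].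
by rewrite !tmap_pure.
Qed.

Lemma tmap_id (V W : lmodType k) (t : V ⊗ W) : tmap id id t = t.
Proof.
apply: (tensor_ext (f := tmap id id) (g := id)) => [||v w]; [by lin|by []|].
by rewrite tmap_pure.
Qed.

Lemma tmap_bij (V V' W W' : lmodType k) (f : V -> V') (g : W -> W') :
  linear f -> bijective f -> linear g -> bijective g -> bijective (tmap f g).
Proof.
move=> lf [f' fK f'K] lg [g' gK g'K].
have lf' := can_lin lf fK f'K; have lg' := can_lin lg gK g'K.
exists (tmap f' g') => t; rewrite tmap_comp // -[RHS]tmap_id.
  by congr (tmap _ _ t); apply: funext.
by congr (tmap _ _ t); apply: funext.
Qed.

Fixpoint tpow_map (V V' : lmodType k) (f : V -> V') n : tpow V n -> tpow V' n :=
  if n is m.+1 then tmap f (tpow_map f (n := m)) else id.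

Lemma tpow_map_linear (V V' : lmodType k) (f : V -> V') n :
  linear f -> linear (@tpow_map V V' f n).
Proof. by move=> lf; elim: n => //= n IH; apply: tmap_linear. Qed.

Lemma tpow_map_bij (V V' : lmodType k) (f : V -> V') n :
  linear f -> bijective f -> bijective (@tpow_map V V' f n).
Proof.
move=> lf bf; elim: n => [|n IH] /=; first by exists id.
by apply: tmap_bij => //; exact: tpow_map_linear.
Qed.

(** Taking g independent of f lets the remaining tensor factors change their
    nature, as is needed to compare tensor powers with powers of modules. *)
Lemma braid_at0_nat (V V' X X' : lmodType k) (f : V -> V') (g : X -> X')
    (c : V ⊗ V -> V ⊗ V) (c' : V' ⊗ V' -> V' ⊗ V') :
  linear f -> linear g -> linear c -> linear c' ->
  (forall t, tmap f f (c t) = c' (tmap f f t)) ->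
  forall t : V ⊗ (V ⊗ X),
    tmap f (tmap f g) (tassoc (tmap c id (tassocV t))) =
    tassoc (tmap c' id (tassocV (tmap f (tmap f g) t))).
Proof.
move=> lf lg lc lc' fc; apply: tensor3r_ext => [||u v w]; [by lin|by lin|].
rewrite tassocV_pure !tmap_pure //; last by lin.
rewrite tassocV_pure tmap_pure // -[f u ⊠ f v](tmap_pure u v lf lf) -fc.
move: (c (u ⊠ v)); apply: tensor_ext => [||a b]; [by lin|by lin|].
by rewrite tmap_pure // !tassoc_pure !tmap_pure //; lin.
Qed.

Lemma tpow_map_braid (V V' : lmodType k) (f : V -> V')
    (c : V ⊗ V -> V ⊗ V) (c' : V' ⊗ V' -> V' ⊗ V') n i t :
  linear f -> linear c -> linear c' ->
  (forall t, tmap f f (c t) = c' (tmap f f t)) ->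
  tpow_map f (braid_at c (n := n) i t) = braid_at c' i (tpow_map f t).
Proof.
move=> lf lc lc' fc; elim: n i t => [|m IH] [|i] //= t.
  by case: m IH t => [|p] IH //= t; apply: braid_at0_nat => //; exact: tpow_map_linear.
have l1 := @braid_at_linear k V c m i lc; have l2 := @braid_at_linear k V' c' m i lc'.
have lm := @tpow_map_linear V V' f m lf.
rewrite !tmap_comp //; congr (tmap _ _ t); apply: funext => s /=; exact: IH.
Qed.

End TensorPowers.

Section PowerModules.
Variables (k : fieldType) (H L : hopfAlgebra k) (F : monfunctor (Mod H) (Mod L)).
Local Notation fo := (fo (modfun F)).
Local Notation fm := (fm (modfun F)).
Local Notation J := (@tensorator k H L F).
Local Notation J' := (@tensoratorV k H L F).
Variable W : ydmodule H.
Local Notation c := (@ydbraid k H W W).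
Local Notation c' := (hfun (half_braid F W W)).

(** The n-th power of W in Mod(H).  Its carrier is tpow W n, but only by
    induction on n, which is why to_mpow is needed. *)
Fixpoint mpow (n : nat) : hmodule H :=
  if n is m.+1 then mod_tensor W (mpow m) else mod_unit H.

Fixpoint to_mpow n : tpow W n -> mpow n :=
  match n with 0 => id | m.+1 => tmap id (@to_mpow m) end.

Lemma to_mpow_linear n : linear (@to_mpow n).
Proof. by elim: n => //= n IH; exact: tmap_linear. Qed.

Lemma to_mpow_bij n : bijective (@to_mpow n).
Proof.
elim: n => [|n IH] /=; first by exists id.
apply: tmap_bij => //; [by exists id|exact: to_mpow_linear].
Qed.

Definition mbraid0 (X : hmodule H) :
    hmap (mod_tensor W (mod_tensor W X)) (mod_tensor W (mod_tensor W X)) :=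
  hmap_comp (mod_assoc W W X) (hmap_comp (mod_tmor (ydbraid_hmap W W) (hmap_id X))
    (mod_assocV W W X)).

Fixpoint mbraid (n i : nat) {struct n} : hmap (mpow n) (mpow n) :=
  match n return hmap (mpow n) (mpow n) with
  | m.+1 =>
    match i with
    | 0 =>
      match m return hmap (mpow m.+1) (mpow m.+1) with
      | p.+1 => mbraid0 (mpow p)
      | 0 => hmap_id (mpow 1)
      end
    | j.+1 => mod_tmor (hmap_id W) (mbraid m j)
    end
  | 0 => hmap_id (mpow 0)
  end.

Lemma to_mpow_braid n i t : to_mpow (braid_at c (n := n) i t) = hfun (mbraid n i) (to_mpow t).
Proof.
have lc := @ydbraid_linear k H W W.
elim: n i t => [|m IH] [|i] //= t.
  case: m IH t => [|p] IH //= t.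
  have idc s : tmap id id (c s) = c (tmap id id s) by rewrite !tmap_id.
  exact: (braid_at0_nat (@lin_id _ _) (@to_mpow_linear p) lc lc idc).
have l1 := @braid_at_linear k W c m i lc; have l2 := hmap_lin (mbraid m i).
have lm := @to_mpow_linear m.
rewrite !tmap_comp //; congr (tmap _ _ t); apply: funext => s /=; exact: IH.
Qed.

(** The image of the unit object is one-dimensional; u0 chooses a coordinate. *)
Variable u0 : fo (mod_unit H) -> k^o.
Hypotheses (lu0 : linear u0) (bu0 : bijective u0).

Fixpoint from_mpow n : fo (mpow n) -> tpow (fo W) n :=
  match n with
  | 0 => u0
  | m.+1 => fun z => tmap id (@from_mpow m) (hfun (J' W (mpow m)) z)
  end.

Lemma from_mpow_linear n : linear (@from_mpow n).
Proof.
elim: n => //= n IH; apply: (lin_comp (tmap_linear (@lin_id _ _) IH)); exact: (hmap_lin (J' W (mpow n))).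
Qed.

Lemma from_mpow_bij n : bijective (@from_mpow n).
Proof.
elim: n => [//|n IH] /=.
apply: (bij_comp (tmap_bij (@lin_id _ _) _ (@from_mpow_linear n) IH)); first by exists id.
by exists (hfun (J W (mpow n))); [exact: tensoratorVK|exact: tensoratorK].
Qed.

(** F turns the action on the first two factors of a power of W into the one on
    the powers of FW; this combines the compatibility of J with the associators
    and the definition of half_braid. *)
Lemma fm_mbraid0 X (t : fo W ⊗ (fo W ⊗ fo X)) :
  hfun (fm (mbraid0 X)) (hfun (J W (mod_tensor W X)) (tmap id (hfun (J W X)) t)) =
  hfun (J W (mod_tensor W X)) (tmap id (hfun (J W X)) (tassoc (tmap c' id (tassocV t)))).
Proof.
have lJ M N := hmap_lin (J M N); have lc' := hmap_lin (half_braid F W W).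
rewrite -{1}[t]tassocVK; move: (tassocV t) => s.
rewrite -!tensorator_assoc /mbraid0 !fm_comp; congr (hfun _ _).
have -> x : hfun (fm (mod_assocV W W X)) (hfun (fm (mod_assoc W W X)) x) = x.
  rewrite -fm_comp -[RHS]fm_id; congr (hfun (fm _) _); apply: hmap_eq => y; exact: tassocK.
rewrite -tensorator_natl; congr (hfun _ _).
have lcc := hmap_lin (fm (ydbraid_hmap W W)).
have lWW := lJ W W.
rewrite !tmap_comp //; congr (tmap _ _ s); apply: funext => x /=.
by rewrite tensoratorVK.
Qed.

Lemma from_mpow_braid n i z :
  from_mpow (hfun (fm (mbraid n i)) z) = braid_at c' (n := n) i (from_mpow z).
Proof.
have lc' := hmap_lin (half_braid F W W).
elim: n i z => [|m IH] [|i] /= z; [by rewrite fm_id|by rewrite fm_id| |].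
  case: m IH z => [|p] IH /= z; first by rewrite fm_id.
  have lJ := hmap_lin (J W (mpow p)); have lV := hmap_lin (J' W (mpow p)).
  have lf := @from_mpow_linear p.
  pose t : fo W ⊗ (fo W ⊗ fo (mpow p)) :=
    tmap id (hfun (J' W (mpow p))) (hfun (J' W (mod_tensor W (mpow p))) z).
  have zE : z = hfun (J W (mod_tensor W (mpow p))) (tmap id (hfun (J W (mpow p))) t).
    rewrite /t tmap_comp // -[LHS]tensoratorVK; congr (hfun _ _).
    by rewrite -[LHS]tmap_id; congr (tmap _ _ _); apply: funext => x /=; rewrite tensoratorVK.
  have E s : tmap id (fun x => tmap id (@from_mpow p) (hfun (J' W (mpow p)) x))
      (hfun (J' W (mod_tensor W (mpow p))) (hfun (J W (mod_tensor W (mpow p)))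
        (tmap id (hfun (J W (mpow p))) s))) = tmap id (tmap id (@from_mpow p)) s.
    rewrite tensoratorK tmap_comp //; last by lin.
    by congr (tmap _ _ s); apply: funext => x /=; rewrite tensoratorK.
  rewrite {1}zE fm_mbraid0 E [in RHS]zE E.
  have idc s : tmap id id (c' s) = c' (tmap id id s) by rewrite !tmap_id.
  exact: (braid_at0_nat (@lin_id _ _) lf lc' lc' idc t).
have lm := @from_mpow_linear m.
have l1 := @braid_at_linear k (fo W) c' m i lc'; have l2 := hmap_lin (fm (mbraid m i)).
rewrite -{1}[z]tensoratorVK -tensorator_natr tensoratorK.
rewrite !tmap_comp //; congr (tmap _ _ _); apply: funext => x /=; exact: IH.
Qed.

End PowerModules.

(** * Equivalence of the representations *)

Lemma braid_equivalent (k : fieldType) n (V W : lmodType k)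
    (r : representation (braid n) V) (s : representation (braid n) W) (f : V -> W) :
  linear f -> bijective f -> (forall i v, f (r (sigma i) v) = s (sigma i) (f v)) ->
  equivalent_representations r s.
Proof.
move=> lf bf fs; exists f; split=> // x v.
have inv y : (forall v, f (r y v) = s y (f v)) -> forall v, f (r y^-1%g v) = s y^-1%g (f v).
  move=> fy v'.
  by rewrite -{2}[v'](rho1 r) -(mulgV y) rhoM fy -rhoM mulVg rho1.
rewrite -[x]reprK; elim: (repr x) v => [|[i b] w IH] v.
  by rewrite -[\pi_(braid n)%qT [::]]/(1%g : braid n) !rho1.
have -> : \pi_(braid n)%qT ((i, b) :: w) =
    ((\pi_(braid n)%qT [:: (i, b)] : braid n) * \pi_(braid n)%qT w)%g.
  by rewrite -[RHS]/(braid_mul _ _) braid_mul_pi.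
rewrite !rhoM -IH; case: b; last exact: fs.
have -> : \pi_(braid n)%qT [:: (i, true)] = ((sigma i)^-1)%g.
  by rewrite -[RHS]/(braid_inv _) braid_inv_pi.
exact: inv.
Qed.

Lemma double_braid_representation (k : fieldType) (H : hopfAlgebra k) n :
  exists r : representation (braid n) (tpow (drinfeldDouble H) n),
    is_drinfeld_braid_representation r.
Proof.
rewrite /is_drinfeld_braid_representation (funext (@drinfeld_braidingE k H)).
pose W := double_yd H; have un := @double_dact1 k H.
exact: (braid_representation_exists (@ydbraid_linear k H W W) (@yang_baxter k H W)
  (tlift_linear (@ydbraidV_bilin k H W W)) (@ydbraidK k H W un W) (@ydbraidVK k H W un W)).
Qed.

Theorem theorem3p1 (k : fieldType) (H L : hopfAlgebra k)
    (HL : monoidally_Morita_equivalent H L) (n : nat) (hn : (2 <= n)%N) :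
  exists (rhoH : representation (braid n) (tpow (drinfeldDouble H) n))
         (rhoL : representation (braid n) (tpow (drinfeldDouble L) n)),
    [/\ is_drinfeld_braid_representation rhoH,
        is_drinfeld_braid_representation rhoL
      & equivalent_representations rhoH rhoL].
Proof.
have [rH rHP] := double_braid_representation H n.
have [rL rLP] := double_braid_representation L n.
exists rH, rL; split=> //.
case: HL => F eqF; have [e [g Kg gK]] := reg_generator eqF.
pose W := double_yd H.
have [u0 [lu0 bu0]] : exists u0 : fo (modfun F) (mod_unit H) -> k^o, linear u0 /\ bijective u0.
  have [m [m1 m2]] := mf0_iso F; exists (@ev k L (mfun F munit) munit m); split.
    exact (ev_linear m).
  exists (@ev k L munit (mfun F munit) (mf0 F)) => x.
    by rewrite -ev_cmp m2.
  by rewrite -ev_cmp m1.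
pose z := double_comparison eqF gK Kg.
have lz : linear z := double_comparison_linear eqF gK Kg.
have [z' zK Kz] : bijective z := double_comparison_bij eqF gK Kg.
have lz' := can_lin lz zK Kz.
have lcH := @ydbraid_linear k H W W; have lcL := @ydbraid_linear k L (double_yd L) (double_yd L).
have lcW := hmap_lin (half_braid F W W).
(* z' : F(D(H)) -> D(L) is an isomorphism of braided objects *)
have zb t : tmap z' z' (hfun (half_braid F W W) t) =
    ydbraid (X := double_yd L) (W := double_yd L) (tmap z' z' t).
  have lzz := tmap_linear lz lz.
  have zzK s : tmap z' z' (tmap z z s) = s.
    rewrite tmap_comp // -[RHS]tmap_id; by congr (tmap _ _ s); apply: funext.
  have zKz s : tmap z z (tmap z' z' s) = s.
    rewrite tmap_comp // -[RHS]tmap_id; by congr (tmap _ _ s); apply: funext.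
  by rewrite -{1}[t]zKz double_comparison_braid zzK.
(* first to F of the n-th power, then to the n-th power of F(D(H)) *)
pose Phi (v : tpow (drinfeldDouble H) n) : tpow (drinfeldDouble L) n :=
  tpow_map z' (from_mpow u0 (fiber_iso e (to_mpow (W := W) v))).
apply: (braid_equivalent (f := Phi)) => [||i v].
- apply: (lin_comp (@tpow_map_linear k _ _ z' n lz')).
  apply: (lin_comp (@from_mpow_linear k H L F W u0 lu0 n)).
  exact: (lin_comp (@fiber_iso_linear k H L F e _) (@to_mpow_linear k H W n)).
- apply: (bij_comp (@tpow_map_bij k _ _ z' n lz' _)); first by exists z.
  apply: (bij_comp (@from_mpow_bij k H L F W u0 lu0 bu0 n)).
  exact: (bij_comp (fiber_iso_bij eqF gK Kg _) (@to_mpow_bij k H W n)).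
rewrite rHP rLP (funext (@drinfeld_braidingE k H)) (funext (@drinfeld_braidingE k L)) /Phi.
rewrite (to_mpow_braid (W := W)) fiber_iso_nat from_mpow_braid //.
exact: tpow_map_braid.
Qed.
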